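(* Let $n\ge 2$ be an integer. For every $H\in\left(0,\frac{2\sqrt{n-1}}{n\sqrt{3}}\right)$ there exists a non-isoparametric compact embedded hypersurface in $S^{n+1}$ with constant mean curvature $H$. More generally, for every integer $m>1$ and every real number $H$ lying (strictly) between the two numbers $$\cot\frac{\pi}{m}\quad\text{and}\quad \frac{(m^2-2)\sqrt{n-1}}{n\sqrt{m^2-1}}$$ (in whichever order they occur), there exists a non-isoparametric compact embedded hypersurface in $S^{n+1}$ with constant mean curvature $H$ whose group of isometries contains the group $O(n)\times \mathbb{Z}_m$.
   Context: $S^{n+1}$ is the unit sphere in $\mathbb{R}^{n+2}$. The mean curvature of a hypersurface with principal curvatures $\kappa_1,\dots,\kappa_n$ (eigenvalues of the shape operator $A(v)=-\bar\nabla_v\nu$ for a unit normal field $\nu$) is the average $H=\frac{\kappa_1+\dots+\kappa_n}{n}$. A hypersurface is isoparametric if all its principal curvatures are constant. $O(n)$ is the group of $n\times n$ orthogonal matrices and $\mathbb{Z}_m$ is the group of integers mod $m$. *)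

(* Defs.v *)
From HB Require Import structures.
From mathcomp Require Import all_boot all_order all_algebra.
From mathcomp Require Import all_classical all_reals all_analysis.

Set Implicit Arguments.
Unset Strict Implicit.
Unset Printing Implicit Defensive.

Import Order.TTheory GRing.Theory Num.Theory.
Import numFieldNormedType.Exports.

Local Open Scope classical_set_scope.
Local Open Scope ring_scope.

Section Smooth.
Variables (R : realType) (V W : normedModType R).

(* Meant for open U, in which case only the values
   of f on U matter.  In finite dimension this is the usual C^k, since it
   says that all iterated partial derivatives up to order k exist and are
   continuous. *)
Fixpoint is_Ck (k : nat) (U : set V) (f : V -> W) : Prop :=
  (forall x, U x -> {for x, continuous f}) /\
  (if k is k'.+1 then
     forall v, (forall x, U x -> derivable f x v) /\ is_Ck k' U ('D_v f)
   else True).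

Definition smooth_on (U : set V) (f : V -> W) : Prop :=
  forall k, is_Ck k U f.

(* The submanifolds below are compact, so that a map is smooth on them exactly
   when it is the restriction of a map smooth on an open neighbourhood in the
   ambient space.  Maps on a submanifold M are therefore represented by maps on
   the ambient space, of which only the restriction to M is meaningful; their
   differential at p, on vectors v tangent to M, is v |-> 'D_v f p. *)
Definition smooth_near (M : set V) (f : V -> W) : Prop :=
  exists U : set V, [/\ open U, M `<=` U & smooth_on U f].

End Smooth.

(* The norm that the library puts on row vectors is the max norm, hence an
   explicit Euclidean inner product. *)
Definition dotp (R : realType) (d : nat) (u v : 'rV[R]_d) : R :=
  \sum_(i < d) u 0 i * v 0 i.

Section Hypersurface.
Variables (R : realType) (n : nat).

Local Notation E := 'rV[R]_(n.+2).

Definition unit_sphere : set E := [set x | dotp x x = 1].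

(* M is locally, in the sphere, the zero set of a smooth function whose
   differential at p does not vanish on the tangent space of the sphere. *)
Definition embedded_hypersurface (M : set E) : Prop :=
  M `<=` unit_sphere /\
  forall p, M p -> exists (U : set E) (f : E -> R),
    [/\ open U, U p, smooth_on U f,
        M `&` U = [set x | [/\ unit_sphere x, U x & f x = 0]]
      & exists v : E, dotp v p = 0 /\ 'D_v f p != 0].

Definition compact_embedded_hypersurface (M : set E) : Prop :=
  [/\ M !=set0, connected M, compact M & embedded_hypersurface M].

Definition tangent (M : set E) (p v : E) : Prop :=
  exists (e : R) (c : R -> E),
    [/\ 0 < e, smooth_on [set t : R | `|t| < e] c,
        (forall t : R, `|t| < e -> M (c t)), c 0 = p & derive1 c 0 = v].

Definition unit_normal_field (M : set E) (nu : E -> E) : Prop :=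
  smooth_near M nu /\
  forall p, M p ->
    [/\ dotp (nu p) (nu p) = 1, dotp (nu p) p = 0
      & forall v, tangent M p v -> dotp (nu p) v = 0].

(* The Levi-Civita connection of the sphere is the tangential part of the
   derivative in the ambient Euclidean space. *)
Definition sphere_connection (nu : E -> E) (p v : E) : E :=
  'D_v nu p - dotp ('D_v nu p) p *: p.

Definition shape_operator (nu : E -> E) (p v : E) : E :=
  - sphere_connection nu p v.

(* kappa lists the eigenvalues, with multiplicity and in some order, of the
   shape operator on the n-dimensional tangent space of M at p: the rows of B
   are a basis of eigenvectors of this space. *)
Definition principal_curvatures (M : set E) (nu : E -> E) (p : E)
    (kappa : 'I_n -> R) : Prop :=
  exists B : 'M[R]_(n, n.+2),
    row_free B /\
    forall i, tangent M p (row i B) /\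
              shape_operator nu p (row i B) = kappa i *: row i B.

Definition mean_curvature (kappa : 'I_n -> R) : R :=
  (\sum_(i < n) kappa i) / n%:R.

Definition constant_mean_curvature (M : set E) (H : R) : Prop :=
  exists nu, unit_normal_field M nu /\
    forall p, M p -> exists kappa,
      principal_curvatures M nu p kappa /\ mean_curvature kappa = H.

Definition isoparametric (M : set E) : Prop :=
  exists nu, unit_normal_field M nu /\
    exists kappa, forall p, M p -> principal_curvatures M nu p kappa.

(* Isometries for the Riemannian metric that M inherits from the sphere. *)
Definition isometry (M : set E) (g : E -> E) : Prop :=
  [/\ smooth_near M g, set_bij M M g
    & forall p, M p -> forall v w, tangent M p v -> tangent M p w ->
        dotp ('D_v g p) ('D_w g p) = dotp v w].

Definition orthogonal_matrix (A : 'M[R]_n) : Prop := A *m A^T = 1%:M.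

(* An injective group morphism from O(n) x Z_m to the isometries of M, the
   latter being identified when they agree on M.  To be used with m > 1, as
   'Z_m is the ring of integers mod m only in this case. *)
Definition isometries_contain_OnZm (m : nat) (M : set E) : Prop :=
  exists Phi : 'M[R]_n -> 'Z_m -> E -> E,
    [/\ forall A k, orthogonal_matrix A -> isometry M (Phi A k),
        forall A B k l, orthogonal_matrix A -> orthogonal_matrix B ->
          forall x, M x -> Phi (A *m B) (k + l) x = Phi A k (Phi B l x)
      & forall A B k l, orthogonal_matrix A -> orthogonal_matrix B ->
          (forall x, M x -> Phi A k x = Phi B l x) -> A = B /\ k = l].

End Hypersurface.

(* cot x; trigo only has tan, whose inverse is meaningless at pi / 2. *)
Definition cotan (R : realType) (x : R) : R := cos x / sin x.

Definition strictly_between (R : realType) (x a b : R) : Prop :=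
  Num.min a b < x < Num.max a b.

(* Main.v *)
(** The hypersurface is rotational: in R^2 x R^n it is the set of points
    (z(x), r(x) y) with |y| = 1, where |z|^2 + r^2 = 1 and x is the polar angle
    of the planar curve z.  If e^{it} is the normal of this curve and h its
    support function, the hypersurface is the envelope of the totally umbilic
    spheres <p, e^{it}> = h(t) centred on the circle r = 0.  Put h = sin tau and
    lam = tan tau: then lam is a principal curvature of multiplicity n - 1, and
    the mean curvature is H exactly when the remaining one is n H - (n - 1) lam.
    With the normal angle t as time and g = (lam - H)^(-1/n), this second order
    equation has a first integral: with sg = tau', the quantity
    V(g) / (1 - sg^2) is constant, for V(g) = g^2 (1 + lam^2).

    V has a single critical point g0, a minimum, and tends to +oo at both ends
    of (0, +oo).  In the Morse coordinate y, with V(g) = V(g0) + y^2, the orbit of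
    amplitude e is y = e sin phi, so that the time needed for a full oscillation
    is the integral over a period of an explicit positive function of phi; it is
    continuous in e.  It tends to 2 pi / sqrt((n - 1) lam0^2 + 1) as e -> 0, where
    lam0 = lam(g0), and to pi - 2 atan H as e -> oo.  Comparing these limits with
    2 pi / m amounts to comparing H with the two bounds of the theorem, so when H
    lies between them some amplitude e > 0 gives the period 2 pi / m.  The curve
    then closes up after one turn, with m-fold symmetry; as it turns once around
    the origin monotonically, the hypersurface is embedded, and it is not
    isoparametric because lam is not constant. *)
Require Import Defs.
From mathcomp Require Import all_boot all_order all_algebra.
From mathcomp Require Import all_classical all_reals all_analysis.
From mathcomp Require Import ring lra.

Import Order.TTheory GRing.Theory Num.Theory.
Import numFieldNormedType.Exports.

Local Open Scope classical_set_scope.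
Local Open Scope ring_scope.

(** * Smooth maps between matrix spaces *)

(** The first integral is geometric. Since |z|^2 + r^2 = 1 reads r^2 (1 + lam^2) = 1 - sg^2, the
    quantity V(g) / (1 - sg^2) is g^2 / r^2; its constancy says that g is proportional to the orbit
    radius, in other words that (lam - H) r^n is constant, whence the exponent -1/n. No existence
    theorem for differential equations is used: in the Morse coordinate the orbit is known in
    advance, and the normal angle is recovered from phi by one integration. Smoothness is the
    obstacle that shapes the rest. It is required on an open set of the ambient space, while the
    profile functions live on a circle. The profile is therefore reparametrised by its polar angle,
    which ambient points possess too, and all derivatives are kept as field expressions in finitely
    many periodic functions; composed with the polar angle, these generate a class of ambient
    functions closed under derivation. Being isoparametric allows any unit normal field, so each
    such field has to be compared with the explicit one. *)

Lemma continuous_mx {R : realType} {T : topologicalType} {m n : nat}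
    (f : T -> 'M[R]_(m, n)) (x : T) :
  (forall i j, {for x, continuous (fun y => f y i j)}) ->
  {for x, continuous f}.
Proof.
move=> fc; apply/cvgrPdist_le => /= e e0; near=> y.
rewrite /Num.Def.normr/= mx_normrE (bigmax_le _ (ltW e0))//= => i _.
rewrite !mxE/=.
move: i; near: y; apply: filter_forall => /= i.
exact: ((cvgrPdist_le _ _).1 (fc i.1 i.2)).
Unshelve. all: by end_near. Qed.

Section SmoothClasses.
Context {R : realType} {V : normedModType R}.

Lemma is_Ck_eq {W : normedModType R} (k : nat) (U : set V) (f g : V -> W) :
  open U -> (forall x, U x -> f x = g x) -> is_Ck k U f -> is_Ck k U g.
Proof.
move=> oU; elim: k f g => [|k IHk] f g fg [fc fd]; split=> //.
- move=> x Ux; rewrite /prop_for /continuous_at -(fg x Ux).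
  apply: cvg_trans (fc x Ux); apply: near_eq_cvg; near=> y.
  by apply: fg; near: y; exact: open_nbhs_nbhs.
- move=> x Ux; rewrite /prop_for /continuous_at -(fg x Ux).
  apply: cvg_trans (fc x Ux); apply: near_eq_cvg; near=> y.
  by apply: fg; near: y; exact: open_nbhs_nbhs.
- move=> v; have [dv Dv] := fd v.
  have fgn x : U x -> \near x, f x = g x.
    by move=> Ux; near=> y; apply: fg; near: y; exact: open_nbhs_nbhs.
  split => [x Ux|]; first by apply: near_eq_derivable (fgn x Ux) _; exact: dv.
  by apply: IHk Dv => x Ux; rewrite (near_eq_derive _ (fgn x Ux)).
Unshelve. all: by end_near. Qed.

(** A set of continuous functions stable under directional derivatives consists of smooth functions,
    since k can be lowered by one without leaving the set. The smoothness of every explicit map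
    below comes from such a set. *)
Lemma smooth_on_class {W : normedModType R} (U : set V) (A : set (V -> W)) :
  open U ->
  (forall f, A f -> forall x, U x -> {for x, continuous f}) ->
  (forall f, A f -> forall v, exists2 g, A g &
     forall x, U x -> is_derive x v f (g x)) ->
  forall f, A f -> smooth_on U f.
Proof.
move=> oU Ac Ad f Af k; elim: k f Af => [|k IHk] f Af; split=> //; try exact: Ac.
move=> v; have [g Ag fg] := Ad f Af v; split=> [x /fg[]//|].
apply: (is_Ck_eq _ _ g) => //; last exact: IHk.
by move=> x /fg[_ ->].
Qed.

Lemma is_derive_mx {m n : nat} (f : V -> 'M[R]_(m, n)) (x v : V)
    (df : 'M[R]_(m, n)) :
  (forall i j, is_derive x v (fun y => f y i j) (df i j)) ->
  is_derive x v f df.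
Proof.
move=> fd; have dv : derivable f x v by apply/derivable_mxP => i j; case: (fd i j).
split=> //; rewrite derive_mx //; apply/matrixP => i j; rewrite mxE.
by case: (fd i j).
Qed.

Lemma smooth_on_mx {m n : nat} (U : set V) (A : set (V -> R)) :
  open U ->
  (forall f, A f -> forall x, U x -> {for x, continuous f}) ->
  (forall f, A f -> forall v, exists2 g, A g &
     forall x, U x -> is_derive x v f (g x)) ->
  forall f : V -> 'M[R]_(m, n), (forall i j, A (fun x => f x i j)) ->
  smooth_on U f.
Proof.
move=> oU Ac Ad f Af.
apply: (@smooth_on_class 'M[R]_(m, n) U
  [set f : V -> 'M[R]_(m, n) | forall i j, A (fun x => f x i j)]) => //.
  by move=> g Ag x Ux; apply: continuous_mx => i j; exact: Ac.
move=> g Ag v.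
have H i j := cid2 (Ad _ (Ag i j) v).
exists (fun x => \matrix_(i, j) (sval (H i j) x)).
  move=> i j /=; have -> : (fun x => (\matrix_(i, j) sval (H i j) x) i j) = sval (H i j).
    by apply/funext => x; rewrite mxE.
  by case: (H i j).
move=> x Ux; apply: is_derive_mx => i j; rewrite mxE.
by case: (H i j) => /= h _; exact.
Qed.

End SmoothClasses.

Lemma is_Ck_coord {R : realType} {V : normedModType R} {m n : nat} (k : nat)
    (U : set V) (f : V -> 'M[R]_(m, n)) i j :
  open U -> is_Ck k U f -> is_Ck k U (fun x => f x i j).
Proof.
move=> oU; elim: k f => [|k IHk] f [fc fd]; split=> //.
- move=> x Ux; apply: (@continuous_comp _ _ _ f (fun A : 'M[R]_(m, n) => A i j)).
    exact: fc.
  exact: coord_continuous.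
- move=> x Ux; apply: (@continuous_comp _ _ _ f (fun A : 'M[R]_(m, n) => A i j)).
    exact: fc.
  exact: coord_continuous.
- move=> v; have [dv Dv] := fd v; split=> [x Ux|].
    by have /derivable_mxP := dv x Ux; exact.
  apply: (is_Ck_eq _ _ (fun x => 'D_v f x i j)) => //; last exact: IHk.
  by move=> x Ux; rewrite derive_mx ?mxE //; exact: dv.
Qed.

Section ChainRule.
Context {R : realType} {d : nat}.
Implicit Types (f : 'rV[R]_d -> R) (p q : 'rV[R]_d).

(** A path from p to q that changes one coordinate at a time, so that f q - f p telescopes into
    increments along the axes. *)
Let mix p q (k : nat) : 'rV[R]_d :=
  \row_j (if (j < k)%N then q 0 j else p 0 j).

Lemma is_derive_line f p v df : is_derive p v f df ->
  is_derive (0 : R) 1 (fun s => f (s *: v + p)) df.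
Proof.
move=> [fd <-]; split.
  exact: ((derivable1P f p v).1 fd).
rewrite /derive; set g1 := fun h => h^-1 *: _; set g2 := fun h => h^-1 *: _.
suff -> : g1 = g2 by [].
by apply/funext => h; rewrite /g1 /g2 /= scale0r add0r addr0 [h%:A]mulr1.
Qed.

Lemma is_derive_line_at f p v s df : is_derive (s *: v + p) v f df ->
  is_derive s 1 (fun s => f (s *: v + p)) df.
Proof.
move=> /is_derive_line fd.
have -> : (fun s => f (s *: v + p)) =
    (fun u => f (u *: v + (s *: v + p))) \o (fun u => u - s).
  by apply/funext => u /=; rewrite addrA -scalerDl subrK.
have -> : df = df * (1 - 0) by rewrite subr0 mulr1.
by apply: is_derive1_comp; rewrite subrr.
Qed.

(* Hadamard's decomposition, with difference quotients as coefficients. *)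
Lemma C1_decomposition (U : set 'rV[R]_d) f p :
  open U -> U p -> is_Ck 1 U f ->
  exists G : 'I_d -> 'rV[R]_d -> R,
    [/\ forall q, f q - f p = \sum_k G k q * (q 0 k - p 0 k),
        forall k, {for p, continuous (G k)}
      & forall k, G k p = 'D_(delta_mx 0 k) f p].
Proof.
move=> oU Up [fc fd].
pose G (k : 'I_d) q := if q 0 k == p 0 k then 'D_(delta_mx 0 k) f p
  else (f (mix p q k.+1) - f (mix p q k)) / (q 0 k - p 0 k).
have mixS q (k : 'I_d) :
    mix p q k.+1 = (q 0 k - p 0 k) *: delta_mx 0 k + mix p q k.
  apply/rowP => j; rewrite !mxE eqxx /= ltnS leq_eqVlt -val_eqE /=.
  case: eqVneq => [jk|_] /=; last by rewrite mulr0 add0r.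
  by rewrite (val_inj jk) ltnn mulr1 subrK.
exists G; split; last by move=> k; rewrite /G eqxx.
- move=> q.
  transitivity (\sum_(k < d) (f (mix p q k.+1) - f (mix p q k))).
    rewrite -(big_mkord xpredT (fun k => f (mix p q k.+1) - f (mix p q k))).
    rewrite telescope_sumr //; congr (f _ - f _); apply/rowP => j; rewrite !mxE //.
    by rewrite ltn_ord.
  apply: eq_bigr => k _; rewrite /G mixS; case: eqP => [->|/eqP qp].
    by rewrite subrr scale0r add0r subrr mulr0.
  by rewrite divfK // subr_eq0.
- move=> k; rewrite /prop_for /continuous_at.
  have [Dd [Dc _]] := fd (delta_mx 0 k).
  have FF : Filter (nbhs p) by exact: nbhs_filter.
  apply: (iffRL (@cvgrPdist_le _ _ _ (nbhs p) FF _ _)) => e e0.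
  have : \forall q \near p,
      U q /\ `|'D_(delta_mx 0 k) f p - 'D_(delta_mx 0 k) f q| <= e.
    near=> q; split; first by near: q; exact: open_nbhs_nbhs.
    by near: q; move/cvgrPdist_le : (Dc p Up); exact.
  (* The ball is one of the max norm: as soon as it contains q, it contains every [mix p q k] and
     the segments joining them. *)
  move=> /nbhs_ballP[r /= r0 rD].
  have pr : \forall q \near p, ball p r q by exact: nbhsx_ballx.
  near=> q.
  have pq j : `|p 0 j - q 0 j| < r.
    have pq : ball p r q by near: q.
    exact: (pq.2 0 j).
  rewrite {1}/G eqxx /G; case: eqP => [_|/eqP qp].
    by rewrite subrr normr0 ltW.
  set a := q 0 k - p 0 k; have a0 : a != 0 by rewrite subr_eq0.
  have inr (s : R) : 0 <= s <= 1 -> ball p r ((a * s) *: delta_mx 0 k + mix p q k).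
    move=> /andP[s0 s1]; split=> // i j; rewrite (ord1 i) /ball /= !mxE eqxx /=.
    case: eqVneq => [->|_] /=; last first.
      by rewrite mulr0 add0r; case: ifP => _; [exact: pq | rewrite subrr normr0].
    rewrite ltnn mulr1 opprD addrCA subrr addr0 normrN normrM.
    apply: le_lt_trans (pq k); rewrite distrC -/a (ger0_norm s0).
    by rewrite ler_piMr.
  pose F (s : R) : R := f ((a * s) *: delta_mx 0 k + mix p q k).
  pose dF (s : R) : R := a * 'D_(delta_mx 0 k) f ((a * s) *: delta_mx 0 k + mix p q k).
  have FD (s : R) : 0 <= s <= 1 -> is_derive s 1 F (dF s).
    move=> s01; rewrite /dF mulrC.
    have -> : F = (fun u => f (u *: delta_mx 0 k + mix p q k)) \o (fun s => a * s) by [].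
    apply: is_derive1_comp; last first.
      by rewrite -[X in is_derive _ _ _ X]mulr1; apply: is_deriveZ.
    apply: is_derive_line_at; apply/derivableP/Dd.
    by case: (rD _ (inr s s01)).
  (* The quotient is thus a value of the partial derivative at a point of the ball. *)
  have [||c c01] := @MVT _ F dF 0 1 ltr01.
  - by move=> s; rewrite in_itv /= => /andP[s0 s1]; apply: FD; rewrite !ltW.
  - apply: derivable_within_continuous => s; rewrite in_itv /= => s01.
    by case: (FD s s01).
  rewrite subr0 mulr1 /F /dF mulr1 mulr0 scale0r add0r -mixS => ->.
  rewrite mulrC mulrA mulVf // mul1r.
  apply: (rD _ _).2; apply: inr.
  by move: c01; rewrite in_itv /= => /andP[s0 s1]; rewrite !ltW.
Unshelve. all: by end_near. Qed.

(** Derivatives along lines alone say nothing about curved paths. The decomposition, whose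
    coefficients are continuous at [c 0], yields through Caratheodory's criterion the chain rule for
    a curve that is merely differentiable at 0. *)
Lemma is_derive_comp_C1 (U : set 'rV[R]_d) f (c : R -> 'rV[R]_d) v :
  open U -> U (c 0) -> is_Ck 1 U f -> is_derive (0 : R) 1 c v ->
  is_derive (0 : R) 1 (f \o c) ('D_v f (c 0)).
Proof.
move=> oU Uc Cf.
have [G [fG Gc Gp]] := C1_decomposition U f (c 0) oU Uc Cf.
have key (e : R -> 'rV[R]_d) w : e 0 = c 0 -> is_derive (0 : R) 1 e w ->
    is_derive (0 : R) 1 (f \o e) (\sum_k 'D_(delta_mx 0 k) f (c 0) * w 0 k).
  move=> e0 ew; have ec : {for 0, continuous e}.
    by apply/differentiable_continuous/derivable1_diffP; case: ew.
  have H k : exists h : R -> R, [/\ forall z, e z 0 k - e 0 0 k = h z * (z - 0),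
        {for 0, continuous h} & h 0 = w 0 k].
    apply/is_derive1_caratheodory; case: ew => ed <-; split.
      by move/derivable_mxP : ed; exact.
    by rewrite derive_mx // mxE.
  have [h hP] := choice H.
  apply/is_derive1_caratheodory.
  exists (fun t => \sum_k G k (e t) * h k t); split.
  - move=> t /=; rewrite e0 fG mulr_suml; apply: eq_bigr => k _.
    by have [he _ _] := hP k; rewrite -e0 he mulrA.
  - rewrite /prop_for /continuous_at.
    apply: cvg_big => [|k _]; first exact: add_continuous; apply: cvgM.
      by apply: continuous_comp; rewrite ?e0 //; exact: Gc.
    by have [] := hP k.
  - by apply: eq_bigr => k _; rewrite e0 Gp; have [_ _ ->] := hP k.
(* The sum over coordinates depends on the curve only through its velocity; the straight line of
   velocity v identifies it with ['D_v f (c 0)]. *)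
move=> cv; have := key c v erefl cv.
suff -> : 'D_v f (c 0) = \sum_k 'D_(delta_mx 0 k) f (c 0) * v 0 k by [].
have lv : is_derive (0 : R) 1 (fun s : R => s *: v + c 0) v.
  apply: is_derive_mx => i j.
  have -> : (fun s : R => (s *: v + c 0) i j) =
      ((fun s => s) * cst (v i j) : R -> R) + cst (c 0 i j).
    by apply/funext => s; rewrite !mxE.
  by apply: is_derive_eq; rewrite addr0 scaler0 add0r [X in X = _]mulr1.
have := key _ v _ lv; rewrite scale0r add0r => /(_ erefl)[_ <-].
rewrite /derive; set g1 := fun h => h^-1 *: _; set g2 := fun h => h^-1 *: _.
suff -> : g1 = g2 by [].
by apply/funext => h; rewrite /g1 /g2 /= scale0r add0r addr0 [h%:A]mulr1.
Qed.

End ChainRule.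

(** * Rational expressions in a class of functions *)

Section PointwiseContinuity.
Context {R : realType} {T : topologicalType}.
Implicit Types (f g : T -> R) (x : T).

Lemma cont_add f g x : {for x, continuous f} -> {for x, continuous g} ->
  {for x, continuous (fun y => f y + g y)}.
Proof. by move=> fc gc; exact: cvgD. Qed.

Lemma cont_sub f g x : {for x, continuous f} -> {for x, continuous g} ->
  {for x, continuous (fun y => f y - g y)}.
Proof. by move=> fc gc; exact: cvgB. Qed.

Lemma cont_mul f g x : {for x, continuous f} -> {for x, continuous g} ->
  {for x, continuous (fun y => f y * g y)}.
Proof. by move=> fc gc; exact: cvgM. Qed.

Lemma cont_inv f x : f x != 0 -> {for x, continuous f} ->
  {for x, continuous (fun y => (f y)^-1)}.
Proof. by move=> f0 fc; exact: cvgV. Qed.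

Lemma cont_cst (c : R) x : {for x, continuous (fun=> c)}.
Proof. exact: cvg_cst. Qed.

Lemma cont_comp (K : R -> R) f x : {for f x, continuous K} ->
  {for x, continuous f} -> {for x, continuous (fun y => K (f y))}.
Proof. by move=> Kc fc; exact: continuous_comp. Qed.

End PointwiseContinuity.

Lemma is_derive_cont {R : realType} (f : R -> R) (x d : R) :
  is_derive x 1 f d -> {for x, continuous f}.
Proof. by move=> [fd _]; apply/differentiable_continuous/derivable1_diffP. Qed.

Section PointwiseDerivatives.
Context {R : realType} {V : normedModType R}.
Implicit Types (f g : V -> R) (x v : V).

Lemma is_derive_add f g x v df dg : is_derive x v f df -> is_derive x v g dg ->
  is_derive x v (fun y => f y + g y) (df + dg).
Proof. by move=> fd gd; exact: is_deriveD. Qed.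

Lemma is_derive_sub f g x v df dg : is_derive x v f df -> is_derive x v g dg ->
  is_derive x v (fun y => f y - g y) (df - dg).
Proof. by move=> fd gd; exact: is_deriveB. Qed.

Lemma is_derive_mul f g x v df dg : is_derive x v f df -> is_derive x v g dg ->
  is_derive x v (fun y => f y * g y) (df * g x + f x * dg).
Proof.
move=> fd gd; have := is_deriveM fd gd.
by rewrite addrC /GRing.scale /= [g x * df]mulrC.
Qed.

Lemma is_derive_mulc f (c : R) x v df : is_derive x v f df ->
  is_derive x v (fun y => f y * c) (df * c).
Proof.
move=> fd; have := is_derive_mul _ _ _ _ _ _ fd (is_derive_cst c x v).
by rewrite mulr0 addr0.
Qed.

Lemma is_derive_cmul f (c : R) x v df : is_derive x v f df ->
  is_derive x v (fun y => c * f y) (c * df).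
Proof.
move=> fd; have := is_derive_mul _ _ _ _ _ _ (is_derive_cst c x v) fd.
by rewrite mul0r add0r.
Qed.

Lemma is_derive_inv f x v df : f x != 0 -> is_derive x v f df ->
  is_derive x v (fun y => (f y)^-1) (- (df / (f x) ^+ 2)).
Proof.
move=> fx [fd <-]; split; first exact: derivableV.
by rewrite deriveV // /GRing.scale /= mulNr mulrC.
Qed.

Lemma is_derive_comp1 (K : R -> R) f x v dK df :
  is_derive (f x) 1 K dK -> is_derive x v f df ->
  is_derive x v (fun y => K (f y)) (dK * df).
Proof.
move=> Kd fd.
have H : is_derive (0 : R) 1 (fun s : R => K (f (s *: v + x))) (dK * df).
  apply: (@is_derive1_comp _ K (fun s : R => f (s *: v + x))).
    by rewrite scale0r add0r.
  have [fd' <-] := fd; split; first exact: ((derivable1P f x v).1 fd').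
  rewrite /derive; set g1 := fun h => h^-1 *: _; set g2 := fun h => h^-1 *: _.
  suff -> : g1 = g2 by [].
  by apply/funext => h; rewrite /g1 /g2 /= scale0r add0r addr0 [h%:A]mulr1.
have [Hd <-] := H; split; first exact: ((derivable1P (K \o f) x v).2 Hd).
rewrite /derive; set g1 := fun h => h^-1 *: _; set g2 := fun h => h^-1 *: _.
suff -> : g1 = g2 by [].
by apply/funext => h; rewrite /g1 /g2 /= scale0r add0r addr0 [h%:A]mulr1.
Qed.

End PointwiseDerivatives.

Lemma is_derive_dir {R : realType} (f : R -> R) (x v df : R) :
  is_derive x 1 f df -> is_derive x v f (df * v).
Proof.
move=> fd; apply: (@is_derive_comp1 _ _ f id) => //.
Qed.

(* The functions below have no closed system of derivatives, but each is built
   by field operations from a base whose derivatives are again built so; the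
   class of all these functions is closed under derivation, hence smooth. *)
Inductive ratfun {R : realType} {T : Type} (U : set T) (B : set (T -> R)) :
  (T -> R) -> Prop :=
| ratfun_base b : B b -> ratfun U B b
| ratfun_cst c : ratfun U B (fun=> c)
| ratfun_add f g : ratfun U B f -> ratfun U B g -> ratfun U B (fun x => f x + g x)
| ratfun_mul f g : ratfun U B f -> ratfun U B g -> ratfun U B (fun x => f x * g x)
| ratfun_inv f : (forall x, U x -> f x != 0) -> ratfun U B f ->
    ratfun U B (fun x => (f x)^-1).

Lemma ratfun_opp {R : realType} {T : Type} (U : set T) (B : set (T -> R)) f :
  ratfun U B f -> ratfun U B (fun x => - f x).
Proof.
move=> Bf; have -> : (fun x => - f x) = (fun x => (- 1) * f x).
  by apply/funext => x; rewrite mulN1r.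
by apply: ratfun_mul => //; exact: ratfun_cst.
Qed.

Lemma ratfun_sum {R : realType} {T : Type} (U : set T) (B : set (T -> R))
    (I : Type) (q : seq I) (f : I -> T -> R) :
  (forall i, ratfun U B (f i)) -> ratfun U B (fun x => \sum_(i <- q) f i x).
Proof.
move=> Bf; elim: q => [|i q IHq].
  have -> : (fun x => \sum_(i <- [::]) f i x) = fun=> 0.
    by apply/funext => x; rewrite big_nil.
  exact: ratfun_cst.
have -> : (fun x => \sum_(j <- i :: q) f j x) =
    (fun x => f i x + \sum_(j <- q) f j x).
  by apply/funext => x; rewrite big_cons.
exact: ratfun_add.
Qed.

Section RationalFunctions.
Context {R : realType} {V : normedModType R} (U : set V) (B : set (V -> R)).

Lemma ratfun_continuous :
  (forall b, B b -> forall x, U x -> {for x, continuous b}) ->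
  forall f, ratfun U B f -> forall x, U x -> {for x, continuous f}.
Proof.
move=> Bc f; elim=> {f} [b Bb|c|f g _ IHf _ IHg|f g _ IHf _ IHg|f f0 _ IHf] x Ux.
- exact: Bc.
- exact: cvg_cst.
- by apply: cvgD; [exact: IHf | exact: IHg].
- by apply: cvgM; [exact: IHf | exact: IHg].
- by apply: cvgV; [exact: f0 | exact: IHf].
Qed.

Lemma ratfun_derive :
  (forall b, B b -> forall v, exists2 g, ratfun U B g &
     forall x, U x -> is_derive x v b (g x)) ->
  forall f, ratfun U B f -> forall v, exists2 g, ratfun U B g &
     forall x, U x -> is_derive x v f (g x).
Proof.
move=> Bd f; elim=> {f} [b Bb|c|f g Bf IHf Bg IHg|f g Bf IHf Bg IHg|f f0 Bf IHf] v.
- exact: Bd.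
- by exists (fun=> 0); [exact: ratfun_cst | move=> x _; exact: is_derive_cst].
- have [f' Bf' ff'] := IHf v; have [g' Bg' gg'] := IHg v.
  exists (fun x => f' x + g' x); first exact: ratfun_add.
  by move=> x Ux; apply: is_derive_add; [exact: ff'|exact: gg'].
- have [f' Bf' ff'] := IHf v; have [g' Bg' gg'] := IHg v.
  exists (fun x => f' x * g x + f x * g' x).
    by apply: ratfun_add; exact: ratfun_mul.
  by move=> x Ux; apply: is_derive_mul; [exact: ff'|exact: gg'].
- have [f' Bf' ff'] := IHf v.
  exists (fun x => - (f' x * (f x * f x)^-1)); last first.
    by move=> x Ux; apply: is_derive_inv; [exact: f0|exact: ff'].
  apply: ratfun_opp; apply: ratfun_mul => //; apply: ratfun_inv; last exact: ratfun_mul.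
  by move=> x Ux; rewrite mulf_neq0 // f0.
Qed.

Lemma ratfun_smooth :
  open U ->
  (forall b, B b -> forall x, U x -> {for x, continuous b}) ->
  (forall b, B b -> forall v, exists2 g, ratfun U B g &
     forall x, U x -> is_derive x v b (g x)) ->
  forall f, ratfun U B f -> smooth_on U f.
Proof.
move=> oU Bc Bd; apply: (smooth_on_class _ (ratfun U B)) => //.
  exact: ratfun_continuous.
exact: ratfun_derive.
Qed.

Lemma ratfun_smooth_mx {m n : nat} (f : V -> 'M[R]_(m, n)) :
  open U ->
  (forall b, B b -> forall x, U x -> {for x, continuous b}) ->
  (forall b, B b -> forall v, exists2 g, ratfun U B g &
     forall x, U x -> is_derive x v b (g x)) ->
  (forall i j, ratfun U B (fun x => f x i j)) -> smooth_on U f.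
Proof.
move=> oU Bc Bd Bf; apply: (smooth_on_mx _ (ratfun U B)) => //.
  exact: ratfun_continuous.
exact: ratfun_derive.
Qed.

End RationalFunctions.

(** * The polar angle *)

Section Angle.
Context {R : realType}.
Implicit Types (a b x y : R).

Lemma sin_atan x : sin (atan x) = x / Num.sqrt (1 + x ^+ 2).
Proof.
have cx : cos (atan x) != 0.
  by rewrite cos_atan invr_eq0 sqrtr_eq0 -ltNge ltr_pwDl // sqr_ge0.
by rewrite -[X in X / _]atanK /tan -cos_atan divfK.
Qed.

Lemma periodicz (f : R -> R) T : periodic f T ->
  forall (k : int) x, f (x + T *~ k) = f x.
Proof.
move=> fT [k|k] x; first exact: periodicn.
by rewrite NegzE mulrNz -pmulrn -[LHS](periodicn fT k.+1) subrK.
Qed.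

Lemma eq_angle x y : cos x = cos y -> sin x = sin y ->
  exists k : int, x = y + (pi *+ 2) *~ k.
Proof.
move=> cxy sxy; have p0 : 0 < pi :> R by exact: pi_gt0.
have p2 : 0 < pi *+ 2 :> R by rewrite mulrn_wgt0.
(* k is the integer nearest to (x - y) / (2 pi), so that the remainder e lies in [-pi, pi], where
   cos e = 1 forces e = 0. *)
have [k /andP[ke ek]] : exists k : int,
    k%:~R <= (x - y) / (pi *+ 2) + 2^-1 < k%:~R + 1.
  exists (Num.floor ((x - y) / (pi *+ 2) + 2^-1)).
  by rewrite -[1]/(1%:~R) -intrD floor_itv.
exists k; set T : R := (pi *+ 2); pose e := x - y - T *~ k.
have ce : cos e = 1.
  rewrite /e -mulrNz (@periodicz (@cos R) T (@cosD2pi R)) cosB cxy sxy -!expr2.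
  exact: cos2Dsin2.
have eT : e = (pi *+ 2) * ((x - y) / (pi *+ 2) - k%:~R).
  by rewrite mulrBr mulrCA divff ?gt_eqF // mulr1 /e mulrzr.
have bnd (q c P E : R) : 0 < P -> c <= q + 2^-1 < c + 1 -> E = P *+ 2 * (q - c) ->
    - P <= E <= P.
  by move=> P0 /andP[h1 h2] ->; nra.
have /andP[e1 e2] := bnd _ _ _ _ p0 (introT andP (conj ke ek)) eT.
suff e0 : e = 0 by move: e0; rewrite /e; lra.
have [e_ge0|e_lt0] := leP 0 e.
  by apply: (@cos_inj R); rewrite ?in_itv /= ?lexx ?cos0 ?e_ge0 // ltW.
apply: oppr_inj; rewrite oppr0; apply: (@cos_inj R); last by rewrite cosN cos0.
  by rewrite in_itv /=; apply/andP; split; lra.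
by rewrite in_itv /= lexx ltW.
Qed.

(* The polar angle of (a, b), in [-pi, pi]; it jumps across the negative
   half-axis, and only its composites with functions of period 2 pi are used. *)
Definition ang a b : R :=
  let c := acos (a / Num.sqrt (a ^+ 2 + b ^+ 2)) in if 0 <= b then c else - c.

Lemma ang_bound a b : - pi <= ang a b <= pi.
Proof.
have ab : 0 <= a ^+ 2 + b ^+ 2 by rewrite addr_ge0 ?sqr_ge0.
have c1 : -1 <= a / Num.sqrt (a ^+ 2 + b ^+ 2) <= 1.
  have [r0|r0] := eqVneq (Num.sqrt (a ^+ 2 + b ^+ 2)) 0.
    by rewrite r0 invr0 mulr0 lerN10 ler01.
  rewrite -ler_norml normrM normfV [X in _ / X]ger0_norm ?sqrtr_ge0 //.
  rewrite ler_pdivrMr ?lt_neqAle 1?eq_sym ?r0 ?sqrtr_ge0 // mul1r -sqrtr_sqr.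
  by rewrite ler_wsqrtr // lerDl sqr_ge0.
have h0 := acos_ge0 c1; have h1 := acos_lepi c1; have p0 := pi_ge0 R.
rewrite /ang; case: ifP => _; apply/andP; split => //; lra.
Qed.

Lemma angP a b : 0 < a ^+ 2 + b ^+ 2 ->
  a = Num.sqrt (a ^+ 2 + b ^+ 2) * cos (ang a b) /\
  b = Num.sqrt (a ^+ 2 + b ^+ 2) * sin (ang a b).
Proof.
move=> ab0; set r := Num.sqrt _; have r0 : 0 < r by rewrite sqrtr_gt0.
have r2 : r ^+ 2 = a ^+ 2 + b ^+ 2 by rewrite sqr_sqrtr // ltW.
have ar : -1 <= a / r <= 1.
  rewrite ler_pdivlMr // ler_pdivrMr // mulN1r mul1r -ler_norml.
  rewrite -(ger0_norm (ltW r0)) -ler_sqr ?nnegrE // !real_normK ?num_real //.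
  by rewrite r2 lerDl sqr_ge0.
have cE : cos (ang a b) = a / r.
  by rewrite /ang -/r; case: ifP => _; rewrite ?cosN acosK ?in_itv.
split; first by rewrite cE mulrC divfK // gt_eqF.
have sE : sin (acos (a / r)) = `|b| / r.
  rewrite sin_acos // -sqrtr_sqr -[r in RHS]gtr0_norm // -sqrtr_sqr -sqrtrV ?sqr_ge0 //.
  rewrite -sqrtrM ?sqr_ge0 //; congr Num.sqrt.
  by rewrite expr_div_n -{1}(@divff _ (r ^+ 2)) ?expf_neq0 ?gt_eqF // -mulrBl r2 addrC addKr.
rewrite /ang -/r; case: leP => b0; rewrite ?sinN sE ?(ger0_norm b0) ?(ltr0_norm b0).
  by rewrite mulrC divfK // gt_eqF.
by rewrite mulNr opprK mulrC divfK // gt_eqF.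
Qed.

Lemma periodic_ang (K : R -> R) a b x (rho : R) : periodic K (pi *+ 2) ->
  0 < rho -> a = rho * cos x -> b = rho * sin x -> K (ang a b) = K x.
Proof.
move=> Kp r0 ax bx.
have ab : a ^+ 2 + b ^+ 2 = rho ^+ 2.
  by rewrite ax bx !exprMn -mulrDr cos2Dsin2 mulr1.
have ab0 : 0 < a ^+ 2 + b ^+ 2 by rewrite ab exprn_gt0.
have [ca sb] := angP a b ab0.
move: ca sb; rewrite ab sqrtr_sqr gtr0_norm // => ca sb.
have nr : rho != 0 by rewrite gt_eqF.
have cE : cos (ang a b) = cos x by apply: (mulfI nr); rewrite -ca.
have sE : sin (ang a b) = sin x by apply: (mulfI nr); rewrite -sb.
have [k ->] := eq_angle _ _ cE sE.
by rewrite periodicz.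
Qed.

(** The fraction is the tangent of the argument of (a' + i b') / (a + i b), whose real part is
    positive. The angle on the right depends smoothly on (a', b') whereas [ang] may jump;
    periodicity of K erases the difference. *)
Lemma periodic_ang_local (K : R -> R) a b a' b' : periodic K (pi *+ 2) ->
  0 < a ^+ 2 + b ^+ 2 -> 0 < a * a' + b * b' ->
  K (ang a' b') = K (ang a b + atan ((a * b' - b * a') / (a * a' + b * b'))).
Proof.
move=> Kp ab0 X0; have [] := angP a b ab0.
set r := Num.sqrt _ => ca sb; have r0 : 0 < r by rewrite sqrtr_gt0.
set Y := _ - _; set X := _ + _ in X0 *.
have r2 : r ^+ 2 = a ^+ 2 + b ^+ 2 by rewrite sqr_sqrtr // ltW.
have XY : Num.sqrt (1 + (Y / X) ^+ 2) = Num.sqrt (X ^+ 2 + Y ^+ 2) / X.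
  have -> : 1 + (Y / X) ^+ 2 = (X ^+ 2 + Y ^+ 2) * (X^-1) ^+ 2.
    by field; rewrite gt_eqF.
  by rewrite sqrtrM ?addr_ge0 ?sqr_ge0 // sqrtr_sqr gtr0_norm // invr_gt0.
have s0 : 0 < Num.sqrt (X ^+ 2 + Y ^+ 2).
  by rewrite sqrtr_gt0 ltr_pwDl ?sqr_ge0 ?exprn_gt0.
apply: (@periodic_ang _ _ _ _ (Num.sqrt (X ^+ 2 + Y ^+ 2) / r)) => //.
- by rewrite divr_gt0.
- rewrite cosD cos_atan sin_atan XY.
  have cE : cos (ang a b) = a / r by rewrite [in RHS]ca mulrAC divff ?mul1r // gt_eqF.
  have sE : sin (ang a b) = b / r by rewrite [in RHS]sb mulrAC divff ?mul1r // gt_eqF.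
  rewrite cE sE.
  transitivity ((a * X - b * Y) / r ^+ 2); last by field; rewrite !gt_eqF.
  by rewrite r2 /X /Y; field; rewrite gt_eqF.
- rewrite sinD cos_atan sin_atan XY.
  have cE : cos (ang a b) = a / r by rewrite [in RHS]ca mulrAC divff ?mul1r // gt_eqF.
  have sE : sin (ang a b) = b / r by rewrite [in RHS]sb mulrAC divff ?mul1r // gt_eqF.
  rewrite cE sE.
  transitivity ((b * X + a * Y) / r ^+ 2); last by field; rewrite !gt_eqF.
  by rewrite r2 /X /Y; field; rewrite gt_eqF.
Qed.

End Angle.

(** * The splitting of R^(n+2) as R^2 x R^n *)

Section Coordinates.
Context {R : realType} {n : nat}.
Local Notation E := 'rV[R]_(n.+2).

Definition crd1 (p : E) : R := p 0 ord0.
Definition crd2 (p : E) : R := p 0 (lift ord0 ord0).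
Definition tailv (p : E) : 'rV[R]_n := \row_i p 0 (lift ord0 (lift ord0 i)).

Definition mkv (a b : R) (x : 'rV[R]_n) : E :=
  \row_j (if unlift ord0 j is Some j1 then
            if unlift ord0 j1 is Some i then x 0 i else b
          else a).

Lemma crd1_mkv a b x : crd1 (mkv a b x) = a.
Proof. by rewrite /crd1 mxE unlift_none. Qed.

Lemma crd2_mkv a b x : crd2 (mkv a b x) = b.
Proof. by rewrite /crd2 mxE liftK unlift_none. Qed.

Lemma tailv_mkv a b x : tailv (mkv a b x) = x.
Proof. by apply/rowP => i; rewrite !mxE !liftK. Qed.

Lemma mkv_eta p : mkv (crd1 p) (crd2 p) (tailv p) = p.
Proof.
apply/rowP => j; rewrite mxE; case: (unliftP ord0 j) => [j1|] -> //.
by case: (unliftP ord0 j1) => [i|] -> //; rewrite mxE.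
Qed.

Lemma mkv_eq p q : crd1 p = crd1 q -> crd2 p = crd2 q -> tailv p = tailv q ->
  p = q.
Proof. by move=> h1 h2 h3; rewrite -(mkv_eta p) h1 h2 h3 mkv_eta. Qed.

Lemma dotp_mkv p q :
  dotp p q = crd1 p * crd1 q + crd2 p * crd2 q + dotp (tailv p) (tailv q).
Proof.
rewrite /dotp !big_ord_recl addrA; congr (_ + _).
by apply: eq_bigr => i _; rewrite !mxE.
Qed.

Lemma crd1D p q : crd1 (p + q) = crd1 p + crd1 q. Proof. by rewrite /crd1 mxE. Qed.
Lemma crd2D p q : crd2 (p + q) = crd2 p + crd2 q. Proof. by rewrite /crd2 mxE. Qed.
Lemma tailvD p q : tailv (p + q) = tailv p + tailv q.
Proof. by apply/rowP => i; rewrite !mxE. Qed.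
Lemma crd1N p : crd1 (- p) = - crd1 p. Proof. by rewrite /crd1 mxE. Qed.
Lemma crd2N p : crd2 (- p) = - crd2 p. Proof. by rewrite /crd2 mxE. Qed.
Lemma tailvN p : tailv (- p) = - tailv p.
Proof. by apply/rowP => i; rewrite !mxE. Qed.
Lemma crd1Z a p : crd1 (a *: p) = a * crd1 p. Proof. by rewrite /crd1 mxE. Qed.
Lemma crd2Z a p : crd2 (a *: p) = a * crd2 p. Proof. by rewrite /crd2 mxE. Qed.
Lemma tailvZ a p : tailv (a *: p) = a *: tailv p.
Proof. by apply/rowP => i; rewrite !mxE. Qed.

Definition crdE := (crd1_mkv, crd2_mkv, tailv_mkv, crd1D, crd2D, tailvD, crd1N,
  crd2N, tailvN, crd1Z, crd2Z, tailvZ).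

(** An arbitrary predicate on coordinate functions lets this serve continuity, the ambient
    smoothness class and classes of curves alike. *)
Lemma mkv_coord {T : Type} (P : (T -> R) -> Prop) (a b : T -> R)
    (x : T -> 'rV[R]_n) : P a -> P b -> (forall i, P (fun u => x u 0 i)) ->
  forall i j, P (fun u => mkv (a u) (b u) (x u) i j).
Proof.
move=> Pa Pb Px i j; rewrite (ord1 i).
have [j1|] := unliftP ord0 j => ->; last first.
  by have -> : (fun u => mkv (a u) (b u) (x u) 0 (ord0 : 'I_n.+2)) = a
    by apply/funext => u; exact: crd1_mkv.
have [k|] := unliftP ord0 j1 => ->; last first.
  by have -> : (fun u => mkv (a u) (b u) (x u) 0 (lift ord0 (ord0 : 'I_n.+1))) = b
    by apply/funext => u; exact: crd2_mkv.
have -> : (fun u => mkv (a u) (b u) (x u) 0 (lift ord0 (lift ord0 k))) =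
    (fun u => x u 0 k) by apply/funext => u; rewrite mxE !liftK.
exact: Px.
Qed.

Lemma is_derive_mkv {V : normedModType R} (a b : V -> R) (x : V -> 'rV[R]_n)
    (p v : V) da db (dx : 'rV[R]_n) :
  is_derive p v a da -> is_derive p v b db ->
  (forall i, is_derive p v (fun u => x u 0 i) (dx 0 i)) ->
  is_derive p v (fun u => mkv (a u) (b u) (x u)) (mkv da db dx).
Proof.
move=> ad bd xd; apply: is_derive_mx => i j; rewrite (ord1 i).
have [j1|] := unliftP ord0 j => ->; last first.
  have -> : (fun u => mkv (a u) (b u) (x u) 0 (ord0 : 'I_n.+2)) = a.
    by apply/funext => u; exact: crd1_mkv.
  by rewrite [mkv da db dx _ _]crd1_mkv.
have [k|] := unliftP ord0 j1 => ->; last first.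
  have -> : (fun u => mkv (a u) (b u) (x u) 0 (lift ord0 (ord0 : 'I_n.+1))) = b.
    by apply/funext => u; exact: crd2_mkv.
  by rewrite [mkv da db dx _ _]crd2_mkv.
have -> : (fun u => mkv (a u) (b u) (x u) 0 (lift ord0 (lift ord0 k))) =
    (fun u => x u 0 k) by apply/funext => u; rewrite mxE !liftK.
by rewrite [mkv da db dx _ _]mxE !liftK.
Qed.

End Coordinates.

Section DotProduct.
Context {R : realType} {d : nat}.
Implicit Types (u v w : 'rV[R]_d) (a : R).

Lemma dotpC u v : dotp u v = dotp v u.
Proof. by apply: eq_bigr => i _; rewrite mulrC. Qed.
Lemma dotpDl u v w : dotp (u + v) w = dotp u w + dotp v w.
Proof. by rewrite -big_split; apply: eq_bigr => i _; rewrite mxE mulrDl. Qed.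
Lemma dotpZl a u w : dotp (a *: u) w = a * dotp u w.
Proof. by rewrite mulr_sumr; apply: eq_bigr => i _; rewrite mxE mulrA. Qed.
Lemma dotpNl u w : dotp (- u) w = - dotp u w.
Proof. by rewrite -scaleN1r dotpZl mulN1r. Qed.
Lemma dotpDr u v w : dotp w (u + v) = dotp w u + dotp w v.
Proof. by rewrite dotpC dotpDl !(dotpC w). Qed.
Lemma dotpZr a u w : dotp w (a *: u) = a * dotp w u.
Proof. by rewrite dotpC dotpZl dotpC. Qed.
Lemma dotpNr u w : dotp w (- u) = - dotp w u.
Proof. by rewrite dotpC dotpNl dotpC. Qed.
Lemma dotp0l w : dotp 0 w = 0.
Proof. by rewrite -(scale0r 0) dotpZl mul0r. Qed.
Lemma dotp_ge0 u : 0 <= dotp u u.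
Proof. by apply: sumr_ge0 => i _; rewrite -expr2 sqr_ge0. Qed.
Lemma dotp_eq0 u : dotp u u = 0 -> u = 0.
Proof.
move=> u0; apply/rowP => i; rewrite mxE; apply/eqP.
rewrite -sqrf_eq0 expr2; apply/eqP.
by apply: (psumr_eq0P _ u0) => // j _; rewrite -expr2 sqr_ge0.
Qed.
Lemma is_derive_coord {m} (u v : 'M[R]_(m, d)) i j :
  is_derive u v (fun w : 'M[R]_(m, d) => w i j) (v i j).
Proof.
have dv : derivable (@id 'M[R]_(m, d)) u v by exact: derivable_id.
split; first by move/derivable_mxP : dv; exact.
by have := derive_mx dv; rewrite derive_id => /matrixP /(_ i j); rewrite mxE => ->.
Qed.

End DotProduct.

Definition dotpE {R : realType} {d : nat} := (@dotpDl R d, @dotpDr R d, @dotpZl R d,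
  @dotpZr R d, @dotpNl R d, @dotpNr R d).

(** * The polar angle of the first two coordinates *)

Section PuncturedPlane.
Context {R : realType} {n : nat}.
Local Notation E := 'rV[R]_(n.+2).
Implicit Types (p q v : E) (K : R -> R).

Definition offaxis : set E := [set p | 0 < crd1 p ^+ 2 + crd2 p ^+ 2].
Definition angv p : R := ang (crd1 p) (crd2 p).

Lemma continuous_crd1 : continuous (@crd1 R n).
Proof. exact: coord_continuous. Qed.

Lemma continuous_crd2 : continuous (@crd2 R n).
Proof. exact: coord_continuous. Qed.

Lemma is_derive_crd1 p v : is_derive p v (@crd1 R n) (crd1 v).
Proof. exact: is_derive_coord. Qed.

Lemma is_derive_crd2 p v : is_derive p v (@crd2 R n) (crd2 v).
Proof. exact: is_derive_coord. Qed.

Lemma open_offaxis : open offaxis.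
Proof.
pose F (p : E) : R := crd1 p * crd1 p + crd2 p * crd2 p.
have Fc : continuous F.
  move=> p; have c1 := continuous_crd1 p; have c2 := continuous_crd2 p.
  exact: (@cont_add _ E _ _ _ (@cont_mul _ E _ _ _ c1 c1) (@cont_mul _ E _ _ _ c2 c2)).
have -> : offaxis = F @^-1` [set x : R | 0 < x].
  by apply/seteqP; split=> p /=; rewrite /offaxis /F /= !expr2.
rewrite openE => p p0; apply: (Fc p [set x : R | 0 < x]).
by apply: open_nbhs_nbhs; split => //; exact: open_gt.
Qed.

Lemma near_offaxis p : offaxis p ->
  \forall q \near p, 0 < crd1 p * crd1 q + crd2 p * crd2 q.
Proof.
move=> p0; pose F (q : E) : R := crd1 p * crd1 q + crd2 p * crd2 q.
have Fc : {for p, continuous F}.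
  have c1 := continuous_crd1 p; have c2 := continuous_crd2 p.
  by apply: (@cont_add _ E); apply: (@cont_mul _ E) => //; exact: (@cont_cst _ E).
apply: (Fc [set x : R | 0 < x]); apply: open_nbhs_nbhs; split.
  exact: open_gt.
by rewrite /= /F -!expr2.
Qed.

(* A determination of the polar angle of q that is smooth for q near p. *)
Let locang p q : R := ang (crd1 p) (crd2 p) +
  atan ((crd1 p * crd2 q - crd2 p * crd1 q) / (crd1 p * crd1 q + crd2 p * crd2 q)).

Lemma near_angv K p : periodic K (pi *+ 2) -> offaxis p ->
  \forall q \near p, K (locang p q) = K (angv q).
Proof.
move=> Kp p0; near=> q; rewrite /locang /angv; apply/esym.
by apply: periodic_ang_local => //; near: q; exact: near_offaxis.
Unshelve. all: by end_near. Qed.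

(** Near p the composite equals K of the smooth determination [locang p]; the fraction is the
    differential of the polar angle, (x dy - y dx) / (x^2 + y^2). *)
Lemma is_derive_angv K K' p v : periodic K (pi *+ 2) ->
  (forall x : R, is_derive x 1 K (K' x)) -> offaxis p ->
  is_derive p v (fun q => K (angv q))
    (K' (angv p) * ((crd1 p * crd2 v - crd2 p * crd1 v) /
                    (crd1 p ^+ 2 + crd2 p ^+ 2))).
Proof.
move=> Kp KK' p0; apply: near_eq_is_derive (near_angv K p Kp p0) _.
have l0 : locang p p = angv p.
  by rewrite /locang [crd1 p * crd2 p]mulrC subrr mul0r atan0 addr0.
have X0 : crd1 p * crd1 p + crd2 p * crd2 p != 0 by rewrite -!expr2 gt_eqF.
rewrite -l0; apply: is_derive_comp1 (KK' _) _.
have Yd : is_derive p v (fun q => crd1 p * crd2 q - crd2 p * crd1 q)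
    (crd1 p * crd2 v - crd2 p * crd1 v).
  have := is_derive_sub _ _ _ _ _ _
    (is_derive_mul _ _ _ _ _ _ (is_derive_cst (crd1 p) p v) (is_derive_crd2 p v))
    (is_derive_mul _ _ _ _ _ _ (is_derive_cst (crd2 p) p v) (is_derive_crd1 p v)).
  by rewrite !mul0r !add0r.
have Xd : is_derive p v (fun q => crd1 p * crd1 q + crd2 p * crd2 q)
    (crd1 p * crd1 v + crd2 p * crd2 v).
  have := is_derive_add _ _ _ _ _ _
    (is_derive_mul _ _ _ _ _ _ (is_derive_cst (crd1 p) p v) (is_derive_crd1 p v))
    (is_derive_mul _ _ _ _ _ _ (is_derive_cst (crd2 p) p v) (is_derive_crd2 p v)).
  by rewrite !mul0r !add0r.
have XVd := is_derive_inv _ p v _ (X0 : (fun q => crd1 p * crd1 q + crd2 p * crd2 q) p != 0) Xd.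
have D := is_derive_add _ _ p v _ _ (is_derive_cst (ang (crd1 p) (crd2 p)) p v)
  (is_derive_comp1 (@atan R) _ p v _ _ (is_derive1_atan _)
    (is_derive_mul _ _ p v _ _ Yd XVd)).
apply: (is_derive_eq D).
rewrite [crd2 p * crd1 p]mulrC subrr !mul0r expr0n /= addr0 invr1.
by rewrite mul1r addr0 add0r -!expr2.
Qed.

Lemma continuous_angv K K' p : periodic K (pi *+ 2) ->
  (forall x : R, is_derive x 1 K (K' x)) -> offaxis p ->
  {for p, continuous (fun q => K (angv q))}.
Proof.
move=> Kp KK' p0; have l0 : locang p p = angv p.
  by rewrite /locang [crd1 p * crd2 p]mulrC subrr mul0r atan0 addr0.
have X0 : crd1 p * crd1 p + crd2 p * crd2 p != 0 by rewrite -!expr2 gt_eqF.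
rewrite /prop_for /continuous_at -l0.
apply: (cvg_trans (near_eq_cvg (near_angv K p Kp p0))).
apply: (@cont_comp _ E K (locang p)); first exact: is_derive_cont (KK' _).
apply: (@cont_add _ E); first exact: (@cont_cst _ E).
apply: (@cont_comp _ E (@atan R)); first exact: continuous_atan.
have c1 := continuous_crd1 p; have c2 := continuous_crd2 p.
apply: (@cont_mul _ E).
  by apply: (@cont_sub _ E); apply: (@cont_mul _ E) => //; exact: (@cont_cst _ E).
apply: (@cont_inv _ E) => //; apply: (@cont_add _ E); apply: (@cont_mul _ E) => //;
  exact: (@cont_cst _ E).
Qed.

End PuncturedPlane.

(** * Unit vectors *)

Section Sphere.
Context {R : realType} {d : nat}.
Implicit Types (y z u : 'rV[R]_d).

Lemma dotp_normalize u : u != 0 ->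
  dotp ((Num.sqrt (dotp u u))^-1 *: u) ((Num.sqrt (dotp u u))^-1 *: u) = 1.
Proof.
move=> u0; have uu : 0 < dotp u u.
  rewrite lt_neqAle dotp_ge0 andbT eq_sym.
  by apply: contra u0 => /eqP /dotp_eq0 ->.
by rewrite dotpZl dotpZr mulrA -invfM -expr2 sqr_sqrtr ?ltW // mulVf ?gt_eqF.
Qed.

Lemma dotp_delta y i : dotp y (delta_mx 0 i) = y 0 i.
Proof.
rewrite /dotp (bigD1 i) //= big1 => [|j ji]; rewrite mxE eqxx /=.
  by rewrite eqxx mulr1 addr0.
by rewrite (negbTE ji) mulr0.
Qed.

Lemma unit_neq0 y : dotp y y = 1 -> exists i, y 0 i != 0.
Proof.
move=> y1; apply/not_existsP => y0; have := y1; rewrite /dotp big1 => [/eqP|i _].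
  by rewrite eq_sym oner_eq0.
by have /negP := y0 i; rewrite negbK => /eqP ->; rewrite mul0r.
Qed.

Lemma orth_unit y : (1 < d)%N -> dotp y y = 1 ->
  exists z, dotp z z = 1 /\ dotp y z = 0.
Proof.
move=> d1 y1; have [i yi] := unit_neq0 _ y1.
have [j ji] : exists j : 'I_d, j != i.
  have [i0|i0] := eqVneq (val i) 0%N.
    by exists (Ordinal d1); rewrite -val_eqE /= i0.
  by exists (Ordinal (ltnW d1)); rewrite -val_eqE /= eq_sym.
pose u : 'rV[R]_d := delta_mx 0 j - (y 0 j / y 0 i) *: delta_mx 0 i.
have u0 : u != 0.
  apply/eqP => /rowP /(_ j); rewrite !mxE !eqxx (negbTE ji) /= mulr0 subr0.
  by move=> /eqP; rewrite oner_eq0.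
exists ((Num.sqrt (dotp u u))^-1 *: u); split; first exact: dotp_normalize.
have yu : dotp y u = 0.
  by rewrite /u dotpDr dotpNr dotpZr !dotp_delta divfK // subrr.
by rewrite dotpZr yu mulr0.
Qed.

(** Gram-Schmidt applied to y' with respect to y. When y' is a multiple of y nothing is left, and z
    is any unit vector orthogonal to y, which exists because d > 1. *)
Lemma great_circle y y' : (1 < d)%N -> dotp y y = 1 -> dotp y' y' = 1 ->
  exists (a : R) z, [/\ dotp z z = 1, dotp y z = 0 & y' = cos a *: y + sin a *: z].
Proof.
move=> d1 y1 y1'; pose c := dotp y y'; pose u := y' - c *: y.
have yu : dotp y u = 0 by rewrite /u dotpDr dotpNr dotpZr y1 mulr1 subrr.
have uu : dotp u u = 1 - c ^+ 2.
  rewrite {1}/u dotpDl dotpNl dotpZl yu mulr0 subr0 /u dotpDr dotpNr dotpZr y1'.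
  by rewrite [dotp y' y]dotpC.
have [u0|u0] := eqVneq u 0.
  have [z [z1 yz]] := orth_unit _ d1 y1.
  have c2 : c ^+ 2 + 0 ^+ 2 = 1.
    move: uu; rewrite u0 dotp0l => /eqP; rewrite eq_sym subr_eq0 => /eqP <-.
    by rewrite expr0n addr0.
  have [] := @angP R c 0; rewrite c2 // sqrtr1 !mul1r => cc cs.
  exists (ang c 0), z; split=> //; rewrite -cc -cs scale0r addr0.
  by apply/eqP; rewrite -subr_eq0 -/u u0.
set b := Num.sqrt (dotp u u).
have uu0 : 0 < dotp u u.
  rewrite lt_neqAle dotp_ge0 andbT eq_sym.
  by apply: contra u0 => /eqP /dotp_eq0 ->.
have b0 : b != 0 by rewrite gt_eqF // sqrtr_gt0.
have cb : c ^+ 2 + b ^+ 2 = 1 by rewrite sqr_sqrtr ?ltW // uu subrKC.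
have [] := @angP R c b; rewrite cb // sqrtr1 !mul1r => cc cs.
exists (ang c b), (b^-1 *: u); split.
- exact: dotp_normalize.
- by rewrite dotpZr yu mulr0.
- by rewrite -cc -cs scalerA divff // scale1r subrKC.
Qed.

Lemma continuous_dotp : continuous (fun y => dotp y y).
Proof.
move=> y; rewrite /dotp.
have cc i : {for y, continuous (fun y : 'rV[R]_d => y 0 i * y 0 i)}.
  by apply: cont_mul; exact: coord_continuous.
have -> : (fun u : 'rV[R]_d => \sum_(i < d) u 0 i * u 0 i) =
    \sum_(i < d) (fun u : 'rV[R]_d => u 0 i * u 0 i).
  by apply/funext => u; rewrite fct_sumE.
elim: (index_enum _) => [|i r IHr].
  by rewrite big_nil; exact: (@cont_cst R).
rewrite big_cons; exact: (@cont_add R _ _ _ y (cc i) IHr).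
Qed.

Lemma compact_unit_vectors : compact [set y : 'rV[R]_d | dotp y y = 1].
Proof.
apply: bounded_closed_compact.
  exists 1; split; first exact: num_real.
  move=> M M1 y /= y1; rewrite [leLHS]/Num.Def.normr /= mx_normrE.
  apply: bigmax_le => [|[i j] _]; first by rewrite ltW // (lt_trans ltr01).
  rewrite /= (ord1 i) (le_trans _ (ltW M1)) // -(@ler_sqr R) ?nnegrE //.
  rewrite expr1n -y1 real_normK ?num_real // /dotp (bigD1 j) //= -expr2 lerDl.
  by apply: sumr_ge0 => k _; rewrite -expr2 sqr_ge0.
have -> : [set y : 'rV[R]_d | dotp y y = 1] =
    (fun y => dotp y y) @^-1` [set 1] by [].
apply: closed_comp => [y _|]; first exact: continuous_dotp.
exact: closed_eq.
Qed.

End Sphere.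

Lemma connected_component_path {R : realType} {T : topologicalType} (M : set T)
    (c : R -> T) a b : continuous c -> (forall u, M (c u)) ->
  connected_component M (c a) (c b).
Proof.
move=> cc cM; exists (range c); last by exists b.
split; first by exists a.
  by move=> _ [u _ <-].
apply: connected_continuous_connected; last exact: continuous_subspaceT.
by apply/connected_intervalP.
Qed.

(** * Rotational hypersurfaces *)

Lemma smooth_on_curve {R : realType} {d e : nat} (A : set (R -> R)) (U : set R)
    (c : R -> 'M[R]_(d, e)) : open U ->
  (forall f, A f -> exists2 g, A g & forall x : R, is_derive x 1 f (g x)) ->
  (forall i j, A (fun x => c x i j)) -> smooth_on U c.
Proof.
move=> oU Ad Ac; apply: (ratfun_smooth_mx U A) => //.
- move=> b /Ad[g _ gb] x _; exact: is_derive_cont (gb x).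
- move=> b /Ad[g Ag gb] v; exists (fun x => g x * v).
    by apply: ratfun_mul; [exact: ratfun_base | exact: ratfun_cst].
  by move=> x _; exact: is_derive_dir.
- by move=> i j; exact: ratfun_base.
Qed.

Lemma is_derive_dotp {R : realType} {d : nat} (c e : R -> 'rV[R]_d) (x : R) dc de :
  is_derive x 1 c dc -> is_derive x 1 e de ->
  is_derive x 1 (fun u => dotp (c u) (e u)) (dotp dc (e x) + dotp (c x) de).
Proof.
have coord (h : R -> 'rV[R]_d) dh i : is_derive x 1 h dh ->
    is_derive x 1 (fun u => h u 0 i) (dh 0 i).
  move=> [hd <-]; split; first by move/derivable_mxP : hd; exact.
  by rewrite derive_mx // mxE.
move=> cd ed; rewrite /dotp -big_split /=.
have -> : (fun u => \sum_(i < d) c u 0 i * e u 0 i) =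
    \sum_(i < d) (fun u => c u 0 i * e u 0 i) by apply/funext => u; rewrite fct_sumE.
apply: is_derive_sum => i.
by apply: is_derive_mul; exact: coord.
Qed.

(** * Closed profile curves in polar parametrisation *)

Section Profile.
Context {R : realType}.

(* The derivative of the normal angle t in the polar angle. *)
Definition turn (n : nat) (lam w s r : R -> R) (x : R) : R :=
  (1 - r x ^+ 2) * n%:R / (lam x * r x ^+ 2 * s x ^+ 2 * w x).

(* A closed profile curve as a function of its polar angle: t is the normal
   angle, lam = tan tau where sin tau is the support function, w = (lam - H)^-1,
   sg = d tau / dt, s = 1 / cos tau, and r is the radius of the orbit.
   [profile_cos] and [profile_sin] say that x is the polar angle. *)
Record is_profile (n m : nat) (H : R) (t lam w sg s r : R -> R) : Prop := {
  profile_lam_gt0 : forall x, 0 < lam x;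
  profile_w_gt0 : forall x, 0 < w x;
  profile_s_gt0 : forall x, 0 < s x;
  profile_r_gt0 : forall x, 0 < r x;
  profile_r_lt1 : forall x, r x ^+ 2 < 1;
  profile_lamE : forall x, lam x = H + (w x)^-1;
  profile_sE : forall x, s x ^+ 2 = 1 + lam x ^+ 2;
  profile_rE : forall x, r x ^+ 2 * s x ^+ 2 = 1 - sg x ^+ 2;
  profile_dt : forall x : R, is_derive x 1 t (turn n lam w s r x);
  profile_dlam : forall x : R, is_derive x 1 lam
    (s x ^+ 2 * sg x * turn n lam w s r x);
  profile_dw : forall x : R, is_derive x 1 w
    (- (w x ^+ 2 * s x ^+ 2 * sg x * turn n lam w s r x));
  profile_dsg : forall x : R, is_derive x 1 sg
    (- (r x ^+ 2 * s x ^+ 2 * (lam x - s x ^+ 2 * w x / n%:R) *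
        turn n lam w s r x));
  profile_ds : forall x : R, is_derive x 1 s
    (s x * lam x * sg x * turn n lam w s r x);
  profile_dr : forall x : R, is_derive x 1 r
    (- (r x * s x ^+ 2 * sg x * w x / n%:R * turn n lam w s r x));
  profile_t_period : forall x, t (x + pi *+ 2 / m%:R) = t x + pi *+ 2 / m%:R;
  profile_lam_period : periodic lam (pi *+ 2 / m%:R);
  profile_w_period : periodic w (pi *+ 2 / m%:R);
  profile_sg_period : periodic sg (pi *+ 2 / m%:R);
  profile_s_period : periodic s (pi *+ 2 / m%:R);
  profile_r_period : periodic r (pi *+ 2 / m%:R);
  profile_cos : forall x, cos (t x) * lam x - sin (t x) * sg x =
    s x * Num.sqrt (1 - r x ^+ 2) * cos x;
  profile_sin : forall x, sin (t x) * lam x + cos (t x) * sg x =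
    s x * Num.sqrt (1 - r x ^+ 2) * sin x;
  profile_nonconstant : exists x y, lam x != lam y }.

End Profile.

(** * The hypersurface of a profile *)

Section Geometry.
Context {R : realType} (n m : nat) (H : R) (t lam w sg s r : R -> R).
Hypotheses (n_gt1 : (1 < n)%N) (m_gt1 : (1 < m)%N).
Hypothesis prof : is_profile n m H t lam w sg s r.

Local Notation E := 'rV[R]_(n.+2).
Local Notation om := (turn n lam w s r).
Local Notation step := (pi *+ 2 / m%:R : R).

Let n_neq0 : n%:R != 0 :> R. Proof. by rewrite pnatr_eq0 -lt0n ltnW. Qed.
Let m_neq0 : m%:R != 0 :> R. Proof. by rewrite pnatr_eq0 -lt0n ltnW. Qed.
Let lam_neq0 x : lam x != 0.
Proof. by rewrite gt_eqF // (profile_lam_gt0 _ _ _ _ _ _ _ _ _ prof). Qed.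
Let w_neq0 x : w x != 0.
Proof. by rewrite gt_eqF // (profile_w_gt0 _ _ _ _ _ _ _ _ _ prof). Qed.
Let s_neq0 x : s x != 0.
Proof. by rewrite gt_eqF // (profile_s_gt0 _ _ _ _ _ _ _ _ _ prof). Qed.
Let r_neq0 x : r x != 0.
Proof. by rewrite gt_eqF // (profile_r_gt0 _ _ _ _ _ _ _ _ _ prof). Qed.
Let rho2_gt0 x : 0 < 1 - r x ^+ 2.
Proof. by rewrite subr_gt0 (profile_r_lt1 _ _ _ _ _ _ _ _ _ prof). Qed.
Let rho2_neq0 x : 1 - r x ^+ 2 != 0. Proof. by rewrite gt_eqF. Qed.
Let s2E x := profile_sE _ _ _ _ _ _ _ _ _ prof x.
Let r2E x := profile_rE _ _ _ _ _ _ _ _ _ prof x.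
Let cs1 x : cos (t x) ^+ 2 + sin (t x) ^+ 2 = 1. Proof. exact: cos2Dsin2. Qed.

(** [t] enters only through its cosine and sine: it grows by 2 pi in one turn, and only periodic
    functions can be composed with the polar angle. *)
Definition profile_base : set (R -> R) := [set f | f = (fun x => cos (t x)) \/
  f = (fun x => sin (t x)) \/ f = lam \/ f = w \/ f = sg \/ f = s \/ f = r].

Definition profile_class : set (R -> R) := ratfun setT profile_base.

Lemma profile_class_cos : profile_class (fun x => cos (t x)).
Proof. by apply: ratfun_base; left. Qed.
Lemma profile_class_sin : profile_class (fun x => sin (t x)).
Proof. by apply: ratfun_base; right; left. Qed.
Lemma profile_class_lam : profile_class lam.
Proof. by apply: ratfun_base; do 2 right; left. Qed.
Lemma profile_class_w : profile_class w.
Proof. by apply: ratfun_base; do 3 right; left. Qed.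
Lemma profile_class_sg : profile_class sg.
Proof. by apply: ratfun_base; do 4 right; left. Qed.
Lemma profile_class_s : profile_class s.
Proof. by apply: ratfun_base; do 5 right; left. Qed.
Lemma profile_class_r : profile_class r.
Proof. by apply: ratfun_base; do 6 right. Qed.

Let pc_add f g (hf : profile_class f) (hg : profile_class g) :
  profile_class (fun x => f x + g x) := ratfun_add _ _ _ _ hf hg.
Let pc_mul f g (hf : profile_class f) (hg : profile_class g) :
  profile_class (fun x => f x * g x) := ratfun_mul _ _ _ _ hf hg.
Let pc_opp f (hf : profile_class f) :
  profile_class (fun x => - f x) := ratfun_opp _ _ _ hf.
Let pc_cst c : profile_class (fun=> c) := ratfun_cst _ _ c.
Let pc_inv f (f0 : forall x, f x != 0) (hf : profile_class f) :
  profile_class (fun x => (f x)^-1).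
Proof. by apply: ratfun_inv. Qed.
Let pc_sqr f (hf : profile_class f) : profile_class (fun x => f x ^+ 2).
Proof.
have -> : (fun x => f x ^+ 2) = (fun x => f x * f x) by apply/funext => x.
exact: pc_mul.
Qed.

Lemma profile_class_turn : profile_class om.
Proof.
have [[[cl cw] cs] cr] := (profile_class_lam, profile_class_w, profile_class_s,
  profile_class_r).
have -> : om = (fun x => (1 - r x ^+ 2) * n%:R *
    (lam x * r x ^+ 2 * s x ^+ 2 * w x)^-1) by [].
have [r2 s2] := (pc_sqr _ cr, pc_sqr _ cs).
have num : profile_class (fun x => (1 - r x ^+ 2) * n%:R).
  exact: (pc_mul _ _ (pc_add _ _ (pc_cst 1) (pc_opp _ r2)) (pc_cst n%:R)).
have den : profile_class (fun x => lam x * r x ^+ 2 * s x ^+ 2 * w x).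
  exact: (pc_mul _ _ (pc_mul _ _ (pc_mul _ _ cl r2) s2) cw).
apply: (pc_mul _ _ num (pc_inv _ _ den)) => x.
by rewrite !mulf_neq0 ?expf_neq0.
Qed.

Let dcos (x : R) : is_derive x 1 (fun x => cos (t x)) (- sin (t x) * om x).
Proof. by apply: is_derive_comp1; exact: (profile_dt _ _ _ _ _ _ _ _ _ prof). Qed.
Let dsin (x : R) : is_derive x 1 (fun x => sin (t x)) (cos (t x) * om x).
Proof. by apply: is_derive_comp1; exact: (profile_dt _ _ _ _ _ _ _ _ _ prof). Qed.

Lemma profile_class_derive f : profile_class f ->
  exists2 g, profile_class g & forall x : R, is_derive x 1 f (g x).
Proof.
move=> cf; have [[[cl cw] cs] cr] := (profile_class_lam, profile_class_w,
  profile_class_s, profile_class_r).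
have [[[cc csn] csg] co] := (profile_class_cos, profile_class_sin, profile_class_sg,
  profile_class_turn).
suff : forall b, profile_base b -> exists2 g, profile_class g &
    forall x : R, is_derive x 1 b (g x).
  move=> bd; have bdv b : profile_base b -> forall v, exists2 g,
      profile_class g & forall x : R, setT x -> is_derive x v b (g x).
    move=> /bd[g Bg bg] v; exists (fun x => g x * v); first exact: pc_mul.
    by move=> x _; exact: is_derive_dir.
  have [g Bg fg] := ratfun_derive setT profile_base bdv f cf 1.
  by exists g => // x; exact: fg.
move=> b [->|[->|[->|[->|[->|[->| ->]]]]]].
- by exists (fun x => - sin (t x) * om x) => //; apply: pc_mul => //; exact: pc_opp.
- by exists (fun x => cos (t x) * om x) => //; exact: pc_mul.
- exists (fun x => s x ^+ 2 * sg x * om x).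
    by do 2 apply: pc_mul => //; exact: pc_sqr.
  exact: (profile_dlam _ _ _ _ _ _ _ _ _ prof).
- exists (fun x => - (w x ^+ 2 * s x ^+ 2 * sg x * om x)).
    by apply: pc_opp; do 2 apply: pc_mul => //; apply: pc_mul; exact: pc_sqr.
  exact: (profile_dw _ _ _ _ _ _ _ _ _ prof).
- exists (fun x => - (r x ^+ 2 * s x ^+ 2 * (lam x - s x ^+ 2 * w x / n%:R) * om x)).
    apply: pc_opp; apply: pc_mul => //; apply: pc_mul; first by apply: pc_mul; exact: pc_sqr.
    apply: pc_add => //; apply: pc_opp; apply: pc_mul => //; apply: pc_mul => //.
    exact: pc_sqr.
  exact: (profile_dsg _ _ _ _ _ _ _ _ _ prof).
- exists (fun x => s x * lam x * sg x * om x).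
    by do 3 apply: pc_mul => //.
  exact: (profile_ds _ _ _ _ _ _ _ _ _ prof).
- exists (fun x => - (r x * s x ^+ 2 * sg x * w x / n%:R * om x)).
    apply: pc_opp; apply: pc_mul => //; apply: pc_mul => //.
    by do 3 apply: pc_mul => //; exact: pc_sqr.
  exact: (profile_dr _ _ _ _ _ _ _ _ _ prof).
Qed.

Lemma profile_class_period f : profile_class f -> periodic f (pi *+ 2).
Proof.
have stepE : pi *+ 2 = step *+ m :> R.
  by rewrite -[RHS]mulr_natr divfK.
have tk k x : t (x + step *+ k) = t x + step *+ k.
  elim: k => [|k IHk]; first by rewrite !mulr0n !addr0.
  by rewrite ![step *+ _.+1]mulrSr !addrA (profile_t_period _ _ _ _ _ _ _ _ _ prof) IHk.
have tp x : t (x + pi *+ 2) = t x + pi *+ 2 by rewrite stepE tk.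
have per g : periodic g step -> periodic g (pi *+ 2).
  by move=> gp x; rewrite stepE (periodicn gp).
elim=> {f} [b|c|f g _ IHf _ IHg|f g _ IHf _ IHg|f f0 _ IHf] //; last first.
- by move=> x; rewrite IHf.
- by move=> x; rewrite IHf IHg.
- by move=> x; rewrite IHf IHg.
move=> [->|[->|[->|[->|[->|[->| ->]]]]]].
- by move=> x; rewrite tp cosD2pi.
- by move=> x; rewrite tp sinD2pi.
- exact/per/(profile_lam_period _ _ _ _ _ _ _ _ _ prof).
- exact/per/(profile_w_period _ _ _ _ _ _ _ _ _ prof).
- exact/per/(profile_sg_period _ _ _ _ _ _ _ _ _ prof).
- exact/per/(profile_s_period _ _ _ _ _ _ _ _ _ prof).
- exact/per/(profile_r_period _ _ _ _ _ _ _ _ _ prof).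
Qed.

(** The coordinates are there because the differential of the polar angle is rational in the first
    two of them. *)
Definition ambient_base : set (E -> R) := [set f |
  (exists j, f = (fun p : E => p 0 j)) \/
  (exists2 K, profile_class K & f = (fun p : E => K (angv p)))].

Definition ambient_class : set (E -> R) := ratfun offaxis ambient_base.

Lemma ambient_base_cont b : ambient_base b -> forall p, offaxis p ->
  {for p, continuous b}.
Proof.
move=> [[j ->]|[K cK ->]] p p0; first exact: coord_continuous.
have [K' _ KK'] := profile_class_derive _ cK.
exact: continuous_angv _ _ _ (profile_class_period _ cK) KK' p0.
Qed.

Lemma ambient_base_derive b : ambient_base b -> forall v,
  exists2 g, ambient_class g & forall p, offaxis p -> is_derive p v b (g p).
Proof.
move=> [[j ->]|[K cK ->]] v.
  exists (fun=> v 0 j); first exact: ratfun_cst.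
  by move=> p _; exact: is_derive_coord.
have [K' cK' KK'] := profile_class_derive _ cK.
exists (fun p => K' (angv p) * ((crd1 p * crd2 v - crd2 p * crd1 v) /
                    (crd1 p ^+ 2 + crd2 p ^+ 2))); last first.
  by move=> p p0; exact: is_derive_angv _ _ _ _ (profile_class_period _ cK) KK' p0.
have c1 : ambient_class crd1 by apply: ratfun_base; left; exists ord0.
have c2 : ambient_class crd2 by apply: ratfun_base; left; exists (lift ord0 ord0).
apply: ratfun_mul; first by apply: ratfun_base; right; exists K'.
apply: ratfun_mul; last first.
  by apply: ratfun_inv; [move=> p p0; rewrite gt_eqF | apply: ratfun_add; exact: ratfun_mul].
apply: ratfun_add; last apply: ratfun_opp; apply: ratfun_mul => //; exact: ratfun_cst.
Qed.

Lemma ambient_class_smooth f : ambient_class f -> smooth_on offaxis f.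
Proof.
apply: ratfun_smooth; [exact: open_offaxis|exact: ambient_base_cont|].
exact: ambient_base_derive.
Qed.

Lemma ambient_class_smooth_mx {d e : nat} (f : E -> 'M[R]_(d, e)) :
  (forall i j, ambient_class (fun p => f p i j)) -> smooth_on offaxis f.
Proof.
apply: ratfun_smooth_mx; [exact: open_offaxis|exact: ambient_base_cont|].
exact: ambient_base_derive.
Qed.

(** With h = sin tau = lam / s and h' = dh/dt = sg cos tau = sg / s, the curve is z = h e^{it} + h'
    i e^{it}, the usual parametrisation by the support function; [zx] and [zy] are its
    coordinates. *)
Definition zx x : R := (cos (t x) * lam x - sin (t x) * sg x) / s x.
Definition zy x : R := (sin (t x) * lam x + cos (t x) * sg x) / s x.
(** The speed of z along i e^{it}: the polar angle advances at unit rate exactly when [vel] times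
    <z, e^{it}> = lam / s equals |z|^2 = 1 - r^2. *)
Definition vel x : R := (1 - r x ^+ 2) * s x / lam x.
(** Obtained by differentiating r^2 = 1 - |z|^2, the component of z along i e^{it} being sg / s. *)
Definition dr x : R := - ((1 - r x ^+ 2) * sg x / (lam x * r x)).

Lemma profile_class_zx : profile_class zx.
Proof.
apply: pc_mul; last exact: (pc_inv _ _ profile_class_s).
apply: pc_add; last apply: pc_opp; apply: pc_mul.
- exact: profile_class_cos.
- exact: profile_class_lam.
- exact: profile_class_sin.
- exact: profile_class_sg.
Qed.

Lemma profile_class_zy : profile_class zy.
Proof.
apply: pc_mul; last exact: (pc_inv _ _ profile_class_s).
apply: pc_add; apply: pc_mul.
- exact: profile_class_sin.
- exact: profile_class_lam.
- exact: profile_class_cos.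
- exact: profile_class_sg.
Qed.

Let lam2E x : lam x ^+ 2 = s x ^+ 2 - 1. Proof. by rewrite s2E addrC addKr. Qed.
Let sg2E x : sg x ^+ 2 = 1 - r x ^+ 2 * s x ^+ 2.
Proof. by rewrite r2E subKr. Qed.

Lemma zx2Dzy2 x : zx x ^+ 2 + zy x ^+ 2 = 1 - r x ^+ 2.
Proof.
transitivity ((cos (t x) ^+ 2 + sin (t x) ^+ 2) * (lam x ^+ 2 + sg x ^+ 2) / s x ^+ 2).
  by rewrite /zx /zy; field.
by rewrite cs1 lam2E sg2E; field.
Qed.

Lemma zx_polar x : zx x = Num.sqrt (1 - r x ^+ 2) * cos x.
Proof.
by rewrite /zx (profile_cos _ _ _ _ _ _ _ _ _ prof); field.
Qed.

Lemma zy_polar x : zy x = Num.sqrt (1 - r x ^+ 2) * sin x.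
Proof.
by rewrite /zy (profile_sin _ _ _ _ _ _ _ _ _ prof); field.
Qed.

Lemma zx_normal x : zx x * cos (t x) + zy x * sin (t x) = lam x / s x.
Proof.
transitivity ((cos (t x) ^+ 2 + sin (t x) ^+ 2) * lam x / s x).
  by rewrite /zx /zy; field.
by rewrite cs1 mul1r.
Qed.

Lemma zx_tangent x : zy x * cos (t x) - zx x * sin (t x) = sg x / s x.
Proof.
transitivity ((cos (t x) ^+ 2 + sin (t x) ^+ 2) * sg x / s x).
  by rewrite /zx /zy; field.
by rewrite cs1 mul1r.
Qed.

Let dlam (x : R) := profile_dlam _ _ _ _ _ _ _ _ _ prof x.
Let dsg (x : R) := profile_dsg _ _ _ _ _ _ _ _ _ prof x.
Let ds (x : R) := profile_ds _ _ _ _ _ _ _ _ _ prof x.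

Lemma is_derive_zx (x : R) : is_derive x 1 zx (- sin (t x) * vel x).
Proof.
have D := is_derive_mul _ _ x 1 _ _ (is_derive_sub _ _ x 1 _ _
  (is_derive_mul _ _ x 1 _ _ (dcos x) (dlam x))
  (is_derive_mul _ _ x 1 _ _ (dsin x) (dsg x)))
  (is_derive_inv _ x 1 _ (s_neq0 x) (ds x)).
apply: (is_derive_eq D).
(* The cosine term vanishes by s^2 = 1 + lam^2, and the [lam] part of the sine term by r^2 s^2 +
   sg^2 = 1: as for any envelope, z moves along i e^{it} only. *)
transitivity ((om x / s x) * (cos (t x) * sg x * (s x ^+ 2 - 1 - lam x ^+ 2) +
  sin (t x) * (lam x * (r x ^+ 2 * s x ^+ 2 - 1 + sg x ^+ 2) -
               r x ^+ 2 * s x ^+ 4 * w x / n%:R))).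
  by field; rewrite s_neq0 n_neq0.
rewrite lam2E sg2E /vel /turn; field.
by rewrite n_neq0 w_neq0 s_neq0 r_neq0 lam_neq0.
Qed.

Lemma is_derive_zy (x : R) : is_derive x 1 zy (cos (t x) * vel x).
Proof.
have D := is_derive_mul _ _ x 1 _ _ (is_derive_add _ _ x 1 _ _
  (is_derive_mul _ _ x 1 _ _ (dsin x) (dlam x))
  (is_derive_mul _ _ x 1 _ _ (dcos x) (dsg x)))
  (is_derive_inv _ x 1 _ (s_neq0 x) (ds x)).
apply: (is_derive_eq D).
transitivity ((om x / s x) * (sin (t x) * sg x * (s x ^+ 2 - 1 - lam x ^+ 2) -
  cos (t x) * (lam x * (r x ^+ 2 * s x ^+ 2 - 1 + sg x ^+ 2) -
               r x ^+ 2 * s x ^+ 4 * w x / n%:R))).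
  by field; rewrite s_neq0 n_neq0.
rewrite lam2E sg2E /vel /turn; field.
by rewrite n_neq0 w_neq0 s_neq0 r_neq0 lam_neq0.
Qed.

Lemma is_derive_r (x : R) : is_derive x 1 r (dr x).
Proof.
apply: (is_derive_eq (profile_dr _ _ _ _ _ _ _ _ _ prof x)).
rewrite /dr /turn; field.
by rewrite n_neq0 w_neq0 s_neq0 r_neq0 lam_neq0.
Qed.

Definition ppt x (y : 'rV[R]_n) : E := mkv (zx x) (zy x) (r x *: y).
Definition dppt x (y : 'rV[R]_n) : E :=
  mkv (- sin (t x) * vel x) (cos (t x) * vel x) (dr x *: y).
Definition surface : set E := [set p | exists x y, dotp y y = 1 /\ p = ppt x y].

Lemma angv_ppt K x y : profile_class K -> K (angv (ppt x y)) = K x.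
Proof.
move=> cK; rewrite /angv !crdE.
apply: (periodic_ang _ _ _ _ (Num.sqrt (1 - r x ^+ 2))).
- exact: profile_class_period.
- by rewrite sqrtr_gt0.
- exact: zx_polar.
- exact: zy_polar.
Qed.

(** [zx], [zy] and [r] have period 2 pi, so the parameter can be normalised to the polar angle of
    the point; the pointwise computations below start from this form. *)
Lemma surface_angv p : surface p ->
  exists2 y, dotp y y = 1 & p = ppt (angv p) y.
Proof.
move=> [x [y [y1 ->]]]; exists y => //.
set a := angv (ppt x y).
have hx : zx a = zx x by exact: angv_ppt profile_class_zx.
have hy : zy a = zy x by exact: angv_ppt profile_class_zy.
have hr : r a = r x by exact: angv_ppt profile_class_r.
by rewrite /ppt hx hy hr.
Qed.

Lemma ppt_offaxis x y : offaxis (ppt x y).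
Proof. by rewrite /offaxis /= !crdE zx2Dzy2. Qed.

Lemma surface_offaxis : surface `<=` offaxis.
Proof. by move=> p [x [y [_ ->]]]; exact: ppt_offaxis. Qed.

Lemma surface_sphere : surface `<=` unit_sphere (n := n).
Proof.
move=> p [x [y [y1 ->]]]; rewrite /unit_sphere /= dotp_mkv !crdE dotpZl dotpZr y1.
by rewrite -!expr2 zx2Dzy2 mulr1 -expr2 subrK.
Qed.

(** The defect of p in the equation <p, e^{it}> = h(t) of the umbilic sphere tangent along the orbit
    that has the polar angle of p. *)
Definition height (p : E) : R :=
  crd1 p * cos (t (angv p)) + crd2 p * sin (t (angv p)) -
  lam (angv p) / s (angv p).

(** At a given polar angle, t and h are fixed and [height] is affine in the planar radius q, with
    slope a positive multiple of lam / s. It therefore vanishes only at the radius of the profile,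
    and the equation of the unit sphere then fixes the norm of the tail. *)
Lemma surfaceE : surface = [set p | [/\ unit_sphere p, offaxis p & height p = 0]].
Proof.
apply/seteqP; split=> p.
  move=> sp; split; [exact: surface_sphere|exact: surface_offaxis|].
  have [y y1 pE] := surface_angv _ sp.
  by rewrite /height {1 3}pE !crdE zx_normal subrr.
move=> [p1 p0 hp]; have [] := angP _ _ p0; rewrite -/(angv p).
set q := Num.sqrt _ => cE sE; set x := angv p in hp cE sE.
have q0 : 0 < q by rewrite sqrtr_gt0.
have q2 : q ^+ 2 = crd1 p ^+ 2 + crd2 p ^+ 2 by rewrite sqr_sqrtr // ltW.
set rho := Num.sqrt (1 - r x ^+ 2).
have rho0 : 0 < rho by rewrite sqrtr_gt0.
have rho2 : rho ^+ 2 = 1 - r x ^+ 2 by rewrite sqr_sqrtr // ltW.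
have c1 : crd1 p = q / rho * zx x.
  by rewrite zx_polar -/rho [LHS]cE; field; rewrite gt_eqF.
have c2 : crd2 p = q / rho * zy x.
  by rewrite zy_polar -/rho [LHS]sE; field; rewrite gt_eqF.
have qr : q = rho.
  have : (q / rho - 1) * (lam x / s x) = 0.
    have -> : (q / rho - 1) * (lam x / s x) =
        q / rho * zx x * cos (t x) + q / rho * zy x * sin (t x) - lam x / s x.
      by rewrite mulrBl mul1r -{1}zx_normal; ring.
    by rewrite -c1 -c2.
  move/eqP; rewrite mulf_eq0 (negbTE (mulf_neq0 _ _)) ?invr_eq0 // orbF subr_eq0.
  by move=> /eqP /(canRL (mulfVK _)) ->; rewrite ?mul1r // gt_eqF.
exists x, ((r x)^-1 *: tailv p); split.
  rewrite dotpZl dotpZr mulrA -expr2 exprVn.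
  have : dotp p p = 1 by exact: p1.
  rewrite dotp_mkv -!expr2 -q2 qr rho2 => h.
  have -> : dotp (tailv p) (tailv p) = r x ^+ 2 by move: h; lra.
  by rewrite mulVf // expf_neq0.
apply: mkv_eq; rewrite !crdE.
- by rewrite c1 qr divff ?mul1r // gt_eqF.
- by rewrite c2 qr divff ?mul1r // gt_eqF.
- by rewrite scalerA divff // scale1r.
Qed.

(* The derivative in direction v of the polar angle of p. *)
Definition swing (p v : E) : R :=
  (crd1 p * crd2 v - crd2 p * crd1 v) / (crd1 p ^+ 2 + crd2 p ^+ 2).

Lemma is_derive_profile K K' (p v : E) : profile_class K ->
  (forall x : R, is_derive x 1 K (K' x)) -> offaxis p ->
  is_derive p v (fun q => K (angv q)) (K' (angv p) * swing p v).
Proof. by move=> cK KK' p0; apply: is_derive_angv => //; exact: profile_class_period. Qed.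

Lemma is_derive_ls (x : R) :
  is_derive x 1 (fun x => lam x / s x) (om x * sg x / s x).
Proof.
have D := is_derive_mul _ _ x 1 _ _ (dlam x) (is_derive_inv _ x 1 _ (s_neq0 x) (ds x)).
apply: (is_derive_eq D).
transitivity (om x * sg x / s x * (s x ^+ 2 - lam x ^+ 2)).
  by field.
by rewrite s2E addrK mulr1.
Qed.

(** On an envelope the derivative in the parameter vanishes, here by [zx_tangent], so only the
    differential at frozen t survives. *)
Lemma is_derive_height p v : surface p ->
  is_derive p v height (crd1 v * cos (t (angv p)) + crd2 v * sin (t (angv p))).
Proof.
move=> sp; have p0 := surface_offaxis _ sp.
have cls : profile_class (fun x => lam x / s x).
  exact: (pc_mul _ _ profile_class_lam (pc_inv _ _ profile_class_s)).
have Dc := is_derive_profile _ _ _ v profile_class_cos dcos p0.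
have Ds := is_derive_profile _ _ _ v profile_class_sin dsin p0.
have Dl := is_derive_profile _ _ _ v cls is_derive_ls p0.
have D := is_derive_sub _ _ p v _ _ (is_derive_add _ _ p v _ _
  (is_derive_mul _ _ p v _ _ (is_derive_crd1 p v) Dc)
  (is_derive_mul _ _ p v _ _ (is_derive_crd2 p v) Ds)) Dl.
apply: (is_derive_eq D).
have [y _ pE] := surface_angv _ sp.
have c1 : crd1 p = zx (angv p) by rewrite {1}pE !crdE.
have c2 : crd2 p = zy (angv p) by rewrite {1}pE !crdE.
rewrite c1 c2; set x := angv p.
transitivity (crd1 v * cos (t x) + crd2 v * sin (t x) +
  om x * swing p v * (zy x * cos (t x) - zx x * sin (t x) - sg x / s x)).
  by ring.
by rewrite zx_tangent subrr mulr0 addr0.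
Qed.

Lemma ambient_class_profile K : profile_class K ->
  ambient_class (fun p => K (angv p)).
Proof. by move=> cK; apply: ratfun_base; right; exists K. Qed.

Lemma ambient_class_coord j : ambient_class (fun p => p 0 j).
Proof. by apply: ratfun_base; left; exists j. Qed.

Lemma height_smooth : smooth_on offaxis height.
Proof.
apply: ambient_class_smooth; apply: ratfun_add.
  apply: ratfun_add; apply: ratfun_mul.
  - exact: ambient_class_coord ord0.
  - exact: (ambient_class_profile _ profile_class_cos).
  - exact: ambient_class_coord (lift ord0 ord0).
  - exact: (ambient_class_profile _ profile_class_sin).
apply: ratfun_opp; apply: (ambient_class_profile (fun x => lam x / s x)).
exact: (pc_mul _ _ profile_class_lam (pc_inv _ _ profile_class_s)).
Qed.

Lemma surface_embedded : embedded_hypersurface surface.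
Proof.
split; first exact: surface_sphere.
move=> p sp; exists offaxis, height.
have p0 := surface_offaxis _ sp.
split=> //.
- exact: open_offaxis.
- exact: height_smooth.
- rewrite [in LHS]surfaceE; apply/seteqP; split=> q.
    by move=> [[q1 q0 hq] _]; split.
  by move=> [q1 q0 hq]; split=> //; split.
- have [y y1 pE] := surface_angv _ sp.
  set x := angv p in pE.
  (* The component of (e^{it}, 0) tangent to the unit sphere at p; [height] has derivative 1 - h^2 =
     s^-2 along it. *)
  pose v : E := mkv (cos (t x)) (sin (t x)) 0 - (lam x / s x) *: p.
  have vp : crd1 p * cos (t x) + crd2 p * sin (t x) = lam x / s x.
    by rewrite {1 2}pE !crdE zx_normal.
  exists v; split.
    rewrite dotpDl dotpNl dotpZl (surface_sphere _ sp) mulr1 dotp_mkv !crdE dotp0l.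
    by rewrite addr0 -vp; ring.
  have [_ ->] := is_derive_height p v sp; rewrite !crdE -/x.
  have -> : (cos (t x) - lam x / s x * crd1 p) * cos (t x) +
      (sin (t x) - lam x / s x * crd2 p) * sin (t x) = (s x ^+ 2)^-1.
    transitivity (cos (t x) ^+ 2 + sin (t x) ^+ 2 - lam x / s x *
      (crd1 p * cos (t x) + crd2 p * sin (t x))); first by ring.
    rewrite cs1 vp; transitivity ((s x ^+ 2 - lam x ^+ 2) / s x ^+ 2).
      by field.
    by rewrite s2E addrK mul1r.
  by rewrite invr_eq0 expf_neq0.
Qed.

(** On the surface this is ((e^{it}, 0) - sin tau p) / cos tau, the normalised tangential component
    of the centre of the umbilic sphere. *)
Definition gauss (p : E) : E :=
  mkv (s (angv p) * cos (t (angv p))) (s (angv p) * sin (t (angv p))) 0 -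
  lam (angv p) *: p.

Lemma gauss_smooth : smooth_on offaxis gauss.
Proof.
apply: ambient_class_smooth_mx => i j.
have acK := ambient_class_profile.
have -> : (fun p => gauss p i j) = (fun p =>
    mkv (s (angv p) * cos (t (angv p))) (s (angv p) * sin (t (angv p))) 0 0 j +
    - (lam (angv p) * p 0 j)).
  by apply/funext => p; rewrite (ord1 i) /gauss mxE [X in _ + X]mxE [X in _ - X]mxE.
apply: ratfun_add; last first.
  apply: ratfun_opp; apply: ratfun_mul; last exact: ambient_class_coord.
  exact: (acK _ profile_class_lam).
apply: mkv_coord.
- apply: ratfun_mul; first exact: (acK _ profile_class_s).
  exact: (acK (fun x => cos (t x)) profile_class_cos).
- apply: ratfun_mul; first exact: (acK _ profile_class_s).
  exact: (acK (fun x => sin (t x)) profile_class_sin).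
- move=> k; have -> : (fun u : E => (0 : 'rV[R]_n) 0 k) = fun=> 0.
    by apply/funext => p; rewrite mxE.
  exact: ratfun_cst.
Qed.

(** * Tangent vectors and principal curvatures *)

Lemma tangent_is_derive (M : set E) p v : tangent M p v ->
  exists (e : R) (c : R -> E), [/\ 0 < e, forall u : R, `|u| < e -> M (c u),
    c 0 = p & is_derive (0 : R) 1 c v].
Proof.
move=> [e [c [e0 cs cM c0 cv]]]; exists e, c; split=> //.
have [_ cd] := cs 1%N; have [cd1 _] := cd 1.
split; first by apply: cd1; rewrite /= normr0.
by rewrite -derive1E.
Qed.

Let near0 (e : R) : 0 < e -> \forall u \near (0 : R), `|u| < e.
Proof. by move=> e0; exact: nbhs0_lt. Qed.

(** Both relations differentiate a function that is constant along a curve drawn on the surface: the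
    squared norm, then [height]. *)
Lemma tangent_orth p v : surface p -> tangent surface p v ->
  dotp p v = 0 /\ crd1 v * cos (t (angv p)) + crd2 v * sin (t (angv p)) = 0.
Proof.
move=> sp /tangent_is_derive[e [c [e0 cM c0 cv]]].
have const0 (f : R -> R) (k df : R) : (forall u : R, `|u| < e -> f u = k) ->
    is_derive (0 : R) 1 f df -> df = 0.
  move=> fk [_ <-].
  have -> : 'D_1 f 0 = 'D_1 (fun=> k) (0 : R).
    by apply: near_eq_derive; near=> u; apply: fk; near: u; exact: near0.
  by rewrite derive_cst.
split.
  have := const0 _ 1 _ _ (is_derive_dotp _ _ _ _ _ cv cv).
  rewrite c0 (dotpC v) => h; have : dotp p v + dotp p v = 0.
    by apply: h => u ue; apply: surface_sphere; exact: cM.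
  lra.
have [_ <-] := is_derive_height p v sp.
apply: (const0 (height \o c) 0).
  by move=> u /cM; rewrite surfaceE => -[].
rewrite -c0; apply: (is_derive_comp_C1 offaxis) => //.
- exact: open_offaxis.
- by rewrite c0; exact: surface_offaxis.
- exact: height_smooth.
Unshelve. all: by end_near. Qed.

Let dw_ratio x : om x * r x ^+ 2 * s x ^+ 3 = n%:R / w x * vel x.
Proof.
by rewrite /vel /turn; field; rewrite w_neq0 s_neq0 r_neq0 lam_neq0.
Qed.

(** As n / w = n (lam - H), vectors with zero [swing] are multiplied by - lam, while the meridian
    direction [dppt] is multiplied by n (lam - H) - lam, the opposite of n H - (n - 1) lam. *)
Lemma is_derive_gauss p v y : surface p -> p = ppt (angv p) y ->
  is_derive p v gauss
    ((swing p v * (n%:R / w (angv p))) *: dppt (angv p) y - lam (angv p) *: v).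
Proof.
move=> sp pE; have p0 := surface_offaxis _ sp.
have Dc := is_derive_profile _ _ _ v profile_class_cos dcos p0.
have Ds := is_derive_profile _ _ _ v profile_class_sin dsin p0.
have Dsec := is_derive_profile _ _ _ v profile_class_s ds p0.
have Dl := is_derive_profile _ _ _ v profile_class_lam dlam p0.
have D1 := is_derive_mul _ _ p v _ _ Dsec Dc.
have D2 := is_derive_mul _ _ p v _ _ Dsec Ds.
have D0 i : is_derive p v (fun _ : E => (0 : 'rV[R]_n) 0 i) ((0 : 'rV[R]_n) 0 i).
  rewrite mxE; exact: is_derive_cst.
have := is_derive_mkv _ _ (fun _ : E => 0) p v _ _ 0 D1 D2 D0.
set x := angv p in pE Dc Ds Dsec Dl D1 D2 *.
set d3 := mkv _ _ 0 => D3.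
have D : is_derive p v gauss (d3 - (s x ^+ 2 * sg x * om x * swing p v *: p + lam x *: v)).
  apply: is_derive_mx => i j.
  have -> : (fun q => gauss q i j) = (fun q => mkv (s (angv q) * cos (t (angv q)))
      (s (angv q) * sin (t (angv q))) 0 i j - lam (angv q) * q i j).
    by apply/funext => q; rewrite /gauss mxE [X in _ + X]mxE [X in _ - X]mxE.
  rewrite mxE [X in _ + X]mxE [X in _ - X]mxE [X in _ - (X + _)]mxE [X in _ - (_ + X)]mxE.
  apply: is_derive_sub; last by apply: is_derive_mul => //; exact: is_derive_coord.
  case: D3 => dd <-; rewrite derive_mx // mxE; apply/derivableP.
  by move/derivable_mxP : dd; exact.
apply: (is_derive_eq D).
have c1 : crd1 p = zx x by rewrite {1}pE !crdE.
have c2 : crd2 p = zy x by rewrite {1}pE !crdE.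
have c3 : tailv p = r x *: y by rewrite {1}pE !crdE.
apply: mkv_eq; rewrite /dppt /d3 !crdE.
- rewrite c1.
  have g1 : s x * lam x * sg x * om x * cos (t x) - s x * sin (t x) * om x -
      s x ^+ 2 * sg x * om x * zx x = - (n%:R / w x * vel x * sin (t x)).
    transitivity (- (om x * s x * sin (t x) * (1 - sg x ^+ 2))).
      by rewrite /zx; field.
    by rewrite -r2E -dw_ratio; ring.
  transitivity (swing p v * (s x * lam x * sg x * om x * cos (t x) -
    s x * sin (t x) * om x - s x ^+ 2 * sg x * om x * zx x) - lam x * crd1 v).
    by ring.
  by rewrite g1; ring.
- rewrite c2.
  have g2 : s x * lam x * sg x * om x * sin (t x) + s x * cos (t x) * om x -
      s x ^+ 2 * sg x * om x * zy x = n%:R / w x * vel x * cos (t x).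
    transitivity (om x * s x * cos (t x) * (1 - sg x ^+ 2)).
      by rewrite /zy; field.
    by rewrite -r2E -dw_ratio; ring.
  transitivity (swing p v * (s x * lam x * sg x * om x * sin (t x) +
    s x * cos (t x) * om x - s x ^+ 2 * sg x * om x * zy x) - lam x * crd2 v).
    by ring.
  by rewrite g2; ring.
- rewrite c3 sub0r opprD !scalerA -scaleNr; congr (_ *: _ - _).
  rewrite /dr /turn; field.
  by rewrite w_neq0 r_neq0 lam_neq0 s_neq0.
Qed.

Lemma swing_dppt p y : surface p -> p = ppt (angv p) y ->
  swing p (dppt (angv p) y) = 1.
Proof.
move=> sp pE; rewrite /swing.
have c1 : crd1 p = zx (angv p) by rewrite {1}pE !crdE.
have c2 : crd2 p = zy (angv p) by rewrite {1}pE !crdE.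
rewrite c1 c2 zx2Dzy2 !crdE; set x := angv p.
transitivity (vel x * (zx x * cos (t x) + zy x * sin (t x)) / (1 - r x ^+ 2)).
  by field.
by rewrite zx_normal /vel; field; rewrite rho2_neq0 s_neq0 lam_neq0.
Qed.

Lemma ppt_surface x y : dotp y y = 1 -> surface (ppt x y).
Proof. by move=> y1; exists x, y. Qed.

Lemma open_normlt (e : R) : open [set u : R | `|u| < e].
Proof.
rewrite (_ : [set u | _] = ball (0 : R) e); first exact: ball_open.
by apply/seteqP; split=> u; rewrite /ball /= sub0r normrN.
Qed.

Lemma dppt_tangent x y : dotp y y = 1 -> tangent surface (ppt x y) (dppt x y).
Proof.
move=> y1; exists 1, (fun u => ppt (x + u) y).
have shift K (K' : R -> R) (u : R) : (forall x : R, is_derive x 1 K (K' x)) ->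
    is_derive u 1 (fun u => K (x + u)) (K' (x + u)).
  move=> KK'; rewrite -[X in is_derive _ _ _ X]mulr1; apply: is_derive_comp1 => //.
  have := is_derive_add (fun=> x) id u 1 0 1 (is_derive_cst x u 1) (is_derive_id u 1).
  by rewrite add0r.
have cD : is_derive (0 : R) 1 (fun u => ppt (x + u) y) (dppt x y).
  have D1 := shift _ _ 0 is_derive_zx.
  have D2 := shift _ _ 0 is_derive_zy.
  have D3 := shift _ _ 0 is_derive_r.
  rewrite addr0 in D1 D2 D3.
  apply: is_derive_mkv => // i.
  have -> : (fun u : R => (r (x + u) *: y) 0 i) = (fun u => r (x + u) * y 0 i).
    by apply/funext => u; rewrite mxE.
  by rewrite mxE; exact: (is_derive_mulc _ (y 0 i) _ _ _ D3).
split => //.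
- apply: (smooth_on_curve [set f | exists2 K, profile_class K & f = (fun u => K (x + u))]).
  + exact: open_normlt.
  + move=> f [K cK ->]; have [K' cK' KK'] := profile_class_derive _ cK.
    by exists (fun u => K' (x + u)); [exists K' | move=> u; exact: shift].
  + apply: mkv_coord.
    * by exists zx => //; exact: profile_class_zx.
    * by exists zy => //; exact: profile_class_zy.
    * move=> i; exists (fun x => r x * y 0 i).
        by apply: pc_mul => //; exact: profile_class_r.
      by apply/funext => u; rewrite mxE.
- by move=> u _; exact: ppt_surface.
- by rewrite addr0.
- by rewrite derive1E; case: cD.
Qed.

Lemma rotation_tangent x y z (a : R) : dotp y y = 1 -> dotp z z = 1 ->
  dotp y z = 0 -> tangent surface (ppt x y) (mkv 0 0 (a *: z)).
Proof.
(* The angular frequency that produces the speed a on an orbit of radius [r x]. *)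
move=> y1 z1 yz; pose k := a / r x.
pose c u := ppt x (cos (k * u) *: y + sin (k * u) *: z).
have dk (u : R) : is_derive u 1 (fun u => k * u) k.
  by have := is_derive_cmul id k u 1 1 (is_derive_id u 1); rewrite mulr1.
have dc (u : R) : is_derive u 1 (fun u => cos (k * u)) (- sin (k * u) * k).
  exact: is_derive_comp1.
have dsn (u : R) : is_derive u 1 (fun u => sin (k * u)) (cos (k * u) * k).
  exact: is_derive_comp1.
have dcc A B (u : R) : is_derive u 1 (fun u => A * cos (k * u) + B * sin (k * u))
    ((B * k) * cos (k * u) + (- (A * k)) * sin (k * u)).
  have := is_derive_add _ _ u 1 _ _ (is_derive_cmul _ A u 1 _ (dc u))
    (is_derive_cmul _ B u 1 _ (dsn u)).
  by move=> D; apply: (is_derive_eq D); ring.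
have tailE i : (fun u => (r x *: (cos (k * u) *: y + sin (k * u) *: z)) 0 i) =
    (fun u => r x * y 0 i * cos (k * u) + r x * z 0 i * sin (k * u)).
  by apply/funext => u; rewrite !mxE; ring.
exists 1, c; split=> //.
- apply: (smooth_on_curve [set f | exists A B C,
    f = (fun u => C + (A * cos (k * u) + B * sin (k * u)))]).
  + exact: open_normlt.
  + move=> f [A [B [C ->]]].
    exists (fun u => 0 + ((B * k) * cos (k * u) + (- (A * k)) * sin (k * u))).
      by exists (B * k), (- (A * k)), 0.
    by move=> u; exact: (is_derive_add _ _ u 1 _ _ (is_derive_cst C u 1) (dcc A B u)).
  + apply: mkv_coord.
    * by exists 0, 0, (zx x); apply/funext => u; rewrite !mul0r !addr0.
    * by exists 0, 0, (zy x); apply/funext => u; rewrite !mul0r !addr0.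
    * move=> i; rewrite tailE; exists (r x * y 0 i), (r x * z 0 i), 0.
      by apply/funext => u; rewrite add0r.
- move=> u _; apply: ppt_surface; rewrite !dotpE y1 z1 (dotpC z) yz.
  by rewrite !mulr0 !mulr1 addr0 add0r -!expr2 cos2Dsin2.
- by rewrite /c mulr0 cos0 sin0 scale1r scale0r addr0.
- have cD : is_derive (0 : R) 1 c (mkv 0 0 (a *: z)).
    apply: is_derive_mkv => i.
    rewrite tailE; apply: (is_derive_eq (dcc _ _ 0)).
    by rewrite mulr0 cos0 sin0 !mxE /k; field.
  by rewrite derive1E; case: cD.
Qed.

Lemma dotp_gauss p v : dotp (gauss p) v =
  s (angv p) * (crd1 v * cos (t (angv p)) + crd2 v * sin (t (angv p))) -
  lam (angv p) * dotp p v.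
Proof.
rewrite /gauss dotpDl dotpNl dotpZl dotp_mkv !crdE dotp0l.
by congr (_ - _); ring.
Qed.

Lemma surface_normal p : surface p ->
  crd1 p * cos (t (angv p)) + crd2 p * sin (t (angv p)) =
  lam (angv p) / s (angv p).
Proof.
move=> /surface_angv[y _ pE].
by rewrite {1 3}pE !crdE zx_normal.
Qed.

Lemma gauss_unit_normal : unit_normal_field surface gauss.
Proof.
split; first by exists offaxis; split;
  [exact: open_offaxis|exact: surface_offaxis|exact: gauss_smooth].
move=> p sp; have np := surface_normal p sp.
have pp : dotp p p = 1 by exact: surface_sphere.
have gp : dotp (gauss p) p = 0.
  by rewrite dotp_gauss np pp; field.
split=> // [|v /(tangent_orth _ _ sp)[pv nv]]; last first.
  by rewrite dotp_gauss pv nv !mulr0 subrr.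
rewrite dotp_gauss [dotp p _]dotpC gp mulr0 subr0 /gauss !crdE.
set x := angv p in np *.
transitivity (s x ^+ 2 * (cos (t x) ^+ 2 + sin (t x) ^+ 2) - s x * lam x *
  (crd1 p * cos (t x) + crd2 p * sin (t x))); first by ring.
by rewrite np cs1 s2E; field.
Qed.

Lemma shape_gauss p v y : surface p -> p = ppt (angv p) y -> dotp y y = 1 ->
  dotp p v = 0 -> shape_operator gauss p v =
  lam (angv p) *: v - (swing p v * (n%:R / w (angv p))) *: dppt (angv p) y.
Proof.
move=> sp pE y1 pv; rewrite /shape_operator /sphere_connection.
have [_ ->] := is_derive_gauss p v y sp pE.
have qT : tangent surface p (dppt (angv p) y).
  by rewrite {1}pE; exact: dppt_tangent.
have [pq _] := tangent_orth p _ sp qT.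
rewrite dotpDl dotpNl !dotpZl (dotpC _ p) pq (dotpC _ p) pv !mulr0 subrr scale0r.
by rewrite subr0 opprB.
Qed.

Lemma gauss_principal_curvatures p : surface p ->
  exists kappa, principal_curvatures surface gauss p kappa /\
    mean_curvature kappa = H.
Proof.
move=> sp; have [y y1 pE] := surface_angv _ sp.
have [i0 yi0] := unit_neq0 _ y1.
set x := angv p in pE.
(* For i distinct from i0 these vectors form a basis of the orthogonal complement of y; the index
   i0, where [z i0] is zero, is reserved for the meridian direction. *)
pose z i : 'rV[R]_n := delta_mx 0 i - (y 0 i / y 0 i0) *: delta_mx 0 i0.
pose b i : E := if i == i0 then dppt x y else mkv 0 0 (z i).
have yz i : dotp y (z i) = 0.
  by rewrite /z dotpDr dotpNr dotpZr !dotp_delta divfK // subrr.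
have zi i j : j != i0 -> z i 0 j = (i == j)%:R.
  by move=> ji0; rewrite !mxE /= (negbTE ji0) mulr0 subr0 eq_sym.
have bT i : tangent surface p (b i).
  rewrite /b; case: eqP => [_|/eqP ii0]; first by rewrite pE; exact: dppt_tangent.
  have zi0 : z i != 0.
    apply/eqP => /rowP /(_ i); rewrite zi // eqxx mxE => /eqP.
    by rewrite oner_eq0.
  set a := Num.sqrt (dotp (z i) (z i)).
  have a0 : a != 0.
    apply: contra (zi0) => /eqP a0; have := dotp_normalize _ zi0.
    by rewrite -/a a0 invr0 scale0r dotp0l => /eqP; rewrite eq_sym oner_eq0.
  have -> : z i = a *: (a^-1 *: z i) by rewrite scalerA divff // scale1r.
  rewrite pE; apply: rotation_tangent => //; last by rewrite dotpZr yz mulr0.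
  exact: dotp_normalize.
exists (fun i => lam x - (i == i0)%:R * (n%:R / w x)); split; last first.
  (* The trace is n lam - n / w, and lam - 1 / w = H. *)
  rewrite /mean_curvature big_split /= sumr_const card_ord sumrN -mulr_suml.
  rewrite (bigD1 i0) //= eqxx big1 => [|i /negbTE ->] //.
  rewrite addr0 mul1r (profile_lamE _ _ _ _ _ _ _ _ _ prof) -mulr_natl.
  by field; rewrite n_neq0 w_neq0.
exists (\matrix_i b i); split; last first.
  move=> i; rewrite rowK; split=> //.
  have [pb _] := tangent_orth p _ sp (bT i).
  rewrite (shape_gauss p _ y sp pE y1 pb) -/x scalerBl; congr (_ - _).
  rewrite /b; case: eqP => [_|_].
    by rewrite swing_dppt // mul1r.
  by rewrite /swing !crdE !mulr0 subrr !mul0r !scale0r.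
apply: inj_row_free => a aB.
have aj j : \sum_i a 0 i * b i 0 j = 0.
  have := congr1 (fun A : 'rV_(n.+2) => A 0 j) aB; rewrite !mxE => h; rewrite -[RHS]h.
  by apply: eq_bigr => i _; rewrite mxE.
have vel0 : vel x != 0 by rewrite /vel !mulf_neq0 // invr_neq0.
(* Only the meridian vector has a planar part, of length [vel x], so its coefficient is eliminated
   first; coordinate j of the tail then isolates the coefficient j. *)
have ai0 : a 0 i0 = 0.
  have h1 : a 0 i0 * (- sin (t x) * vel x) = 0.
    have := aj ord0; rewrite (bigD1 i0) //= big1 => [|i ii0].
      by rewrite /b eqxx addr0 [dppt _ _ _ _]crd1_mkv.
    by rewrite /b (negbTE ii0) [mkv _ _ _ _ _]crd1_mkv mulr0.
  have h2 : a 0 i0 * (cos (t x) * vel x) = 0.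
    have := aj (lift ord0 ord0); rewrite (bigD1 i0) //= big1 => [|i ii0].
      by rewrite /b eqxx addr0 [dppt _ _ _ _]crd2_mkv.
    by rewrite /b (negbTE ii0) [mkv _ _ _ _ _]crd2_mkv mulr0.
  apply: (mulIf vel0); rewrite mul0r.
  transitivity (a 0 i0 * vel x * (cos (t x) ^+ 2 + sin (t x) ^+ 2)).
    by rewrite cs1 mulr1.
  transitivity ((a 0 i0 * (cos (t x) * vel x)) * cos (t x) -
    (a 0 i0 * (- sin (t x) * vel x)) * sin (t x)); first by ring.
  by rewrite h1 h2 !mul0r subrr.
apply/rowP => j; rewrite mxE.
have [->|ji0] := eqVneq j i0; first exact: ai0.
have := aj (lift ord0 (lift ord0 j)); rewrite (bigD1 j) //= big1 => [|i ij].
  rewrite /b (negbTE ji0) addr0.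
  have -> : mkv 0 0 (z j) 0 (lift ord0 (lift ord0 j)) = z j 0 j by rewrite mxE !liftK.
  by rewrite zi // eqxx mulr1.
rewrite /b; case: eqP => [->|_]; first by rewrite ai0 mul0r.
have -> : mkv 0 0 (z i) 0 (lift ord0 (lift ord0 j)) = z i 0 j by rewrite mxE !liftK.
by rewrite zi // (negbTE ij) mulr0.
Qed.

Lemma surface_cmc : constant_mean_curvature surface H.
Proof.
exists gauss; split; first exact: gauss_unit_normal.
exact: gauss_principal_curvatures.
Qed.

(** * Arbitrary unit normal fields *)

Lemma normal_unique nu p : unit_normal_field surface nu -> surface p ->
  exists2 e : R, e ^+ 2 = 1 & nu p = e *: gauss p.
Proof.
move=> [_ nuN] sp; have [nu1 nup nuT] := nuN p sp.
have [y y1 pE] := surface_angv _ sp; set x := angv p in pE.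
set a := nu p in nu1 nup nuT *; pose al := dotp (tailv a) y.
(* Orthogonality to the orbit leaves the tail no component other than along y; orthogonality to p
   and to the meridian then expresses the planar part in terms of [al]. *)
have aT : tailv a = al *: y.
  pose z := tailv a - al *: y.
  have yz : dotp y z = 0.
    by rewrite /z dotpDr dotpNr dotpZr y1 mulr1 /al dotpC subrr.
  have zz : dotp (tailv a) z = dotp z z.
    by rewrite {2}/z dotpDl dotpNl dotpZl yz mulr0 subr0.
  suff /dotp_eq0 z0 : dotp z z = 0 by apply/eqP; rewrite -subr_eq0 -/z z0.
  apply/eqP/negPn/negP => zz0; have zz1 : 0 < dotp z z by rewrite lt_neqAle eq_sym zz0 dotp_ge0.
  set b := Num.sqrt (dotp z z).
  have b0 : 0 < b by rewrite sqrtr_gt0.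
  have : dotp a (mkv 0 0 (b *: (b^-1 *: z))) = 0.
    apply: nuT; rewrite pE; apply: rotation_tangent => //.
      by rewrite dotpZl dotpZr mulrA -invfM -expr2 sqr_sqrtr ?ltW // mulVf.
    by rewrite dotpZr yz mulr0.
  rewrite dotp_mkv !crdE !mulr0 !add0r scalerA divff ?gt_eqF // scale1r zz.
  by move=> zz2; rewrite zz2 eqxx in zz0.
have h1 : crd1 a * zx x + crd2 a * zy x + al * r x = 0.
  by move: nup; rewrite {1}pE dotp_mkv !crdE aT dotpZl dotpZr y1 mulr1.
have h2 : (crd2 a * cos (t x) - crd1 a * sin (t x)) * vel x + al * dr x = 0.
  have : dotp a (dppt x y) = 0 by apply: nuT; rewrite pE; exact: dppt_tangent.
  by rewrite dotp_mkv !crdE aT dotpZl dotpZr y1 mulr1 => <-; ring.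
have vel0 : vel x != 0 by rewrite /vel !mulf_neq0 // invr_neq0.
have h3 : crd2 a * cos (t x) - crd1 a * sin (t x) = al * sg x / (r x * s x).
  apply: (mulIf vel0); move/eqP: h2; rewrite addr_eq0 => /eqP ->.
  by rewrite /dr /vel; field; rewrite s_neq0 r_neq0 lam_neq0.
have h4 : crd1 a * cos (t x) + crd2 a * sin (t x) = - al / (lam x * r x * s x).
  have ls : lam x / s x != 0 by rewrite mulf_neq0 ?invr_neq0.
  apply: (mulIf ls).
  have -> : (crd1 a * cos (t x) + crd2 a * sin (t x)) * (lam x / s x) =
     crd1 a * zx x + crd2 a * zy x -
     (crd2 a * cos (t x) - crd1 a * sin (t x)) * (sg x / s x).
    by rewrite /zx /zy; field.
  have -> : crd1 a * zx x + crd2 a * zy x = - (al * r x).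
    by apply/eqP; rewrite -addr_eq0 h1.
  rewrite h3; transitivity (- al * (r x ^+ 2 * s x ^+ 2 + sg x ^+ 2) / (r x * s x ^+ 2)).
    by field; rewrite s_neq0 r_neq0.
  by rewrite r2E subrK; field; rewrite s_neq0 r_neq0 lam_neq0.
(* Imposed by the tails, since the tail of [gauss p] is - lam r y. *)
pose e := - al / (lam x * r x).
have aE : a = e *: gauss p.
  apply: mkv_eq; rewrite /gauss -/x !crdE.
  - have -> : crd1 p = zx x by rewrite {1}pE !crdE.
    transitivity ((cos (t x) ^+ 2 + sin (t x) ^+ 2) * crd1 a); first by rewrite cs1 mul1r.
    transitivity ((crd1 a * cos (t x) + crd2 a * sin (t x)) * cos (t x) -
      (crd2 a * cos (t x) - crd1 a * sin (t x)) * sin (t x)); first by ring.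
    rewrite h3 h4.
    have -> : s x * cos (t x) - lam x * zx x =
      ((s x ^+ 2 - lam x ^+ 2) * cos (t x) + lam x * sg x * sin (t x)) / s x.
      by rewrite /zx; field.
    by rewrite s2E addrK /e; field; rewrite s_neq0 r_neq0 lam_neq0.
  - have -> : crd2 p = zy x by rewrite {1}pE !crdE.
    transitivity ((cos (t x) ^+ 2 + sin (t x) ^+ 2) * crd2 a); first by rewrite cs1 mul1r.
    transitivity ((crd1 a * cos (t x) + crd2 a * sin (t x)) * sin (t x) +
      (crd2 a * cos (t x) - crd1 a * sin (t x)) * cos (t x)); first by ring.
    rewrite h3 h4.
    have -> : s x * sin (t x) - lam x * zy x =
      ((s x ^+ 2 - lam x ^+ 2) * sin (t x) - lam x * sg x * cos (t x)) / s x.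
      by rewrite /zy; field.
    by rewrite s2E addrK /e; field; rewrite s_neq0 r_neq0 lam_neq0.
  - have -> : tailv p = r x *: y by rewrite {1}pE !crdE.
    rewrite aT sub0r -scaleNr !scalerA /e; congr (_ *: _).
    by field; rewrite r_neq0 lam_neq0.
exists e => //.
have [_ gN] := gauss_unit_normal; have [g1 _ _] := gN p sp.
by move: nu1; rewrite aE dotpZl dotpZr g1 mulr1 expr2.
Qed.

Lemma is_derive_smooth_curve {d e : nat} (U : set 'rV[R]_d) (f : 'rV[R]_d -> 'rV[R]_e) c v :
  open U -> U (c 0) -> smooth_on U f -> is_derive (0 : R) 1 c v ->
  is_derive (0 : R) 1 (f \o c) ('D_v f (c 0)).
Proof.
move=> oU Uc fs cv.
have dv : derivable f (c 0) v.
  by have [_ /(_ v)[+ _]] := fs 1%N; exact.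
apply: is_derive_mx => i j; rewrite derive_mx // mxE.
apply: (is_derive_comp_C1 U (fun q => f q i j)) => //.
exact: is_Ck_coord.
Qed.

(** Along a curve, k = <nu, gauss> satisfies k^2 = 1, hence k k' = 0 and k' = 0: the sign does not
    contribute to the derivative. Signs at different points need not be compared. *)
Lemma derive_normal nu p v : unit_normal_field surface nu -> surface p ->
  tangent surface p v ->
  exists2 e : R, e ^+ 2 = 1 & nu p = e *: gauss p /\ 'D_v nu p = e *: 'D_v gauss p.
Proof.
move=> nuN sp /tangent_is_derive[e [c [e0 cM c0 cv]]].
have [[U [oU sU nus]] _] := nuN.
have Dnu : is_derive (0 : R) 1 (nu \o c) ('D_v nu p).
  by rewrite -c0; apply: (is_derive_smooth_curve U) => //; rewrite c0; exact: sU.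
have Dg : is_derive (0 : R) 1 (gauss \o c) ('D_v gauss p).
  rewrite -c0; apply: (is_derive_smooth_curve offaxis) => //.
  - exact: open_offaxis.
  - by rewrite c0; exact: surface_offaxis.
  - exact: gauss_smooth.
have nuE u : `|u| < e -> nu (c u) = dotp (nu (c u)) (gauss (c u)) *: gauss (c u) /\
    dotp (nu (c u)) (gauss (c u)) ^+ 2 = 1.
  move=> /cM sc; have [k k1 kE] := normal_unique _ _ nuN sc.
  have [_ gN] := gauss_unit_normal; have [g1 _ _] := gN _ sc.
  by rewrite kE dotpZl g1 mulr1.
pose k u := dotp (nu (c u)) (gauss (c u)).
have [dk kD] : exists dk, is_derive (0 : R) 1 k dk.
  by eexists; exact: is_derive_dotp Dnu Dg.
have n00 : `|0 : R| < e by rewrite normr0.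
have [nu0 k0] := nuE 0 n00; rewrite -/(k 0) in nu0 k0.
have dk0 : dk = 0.
  have [_] := is_derive_mul _ _ _ _ _ _ kD kD.
  have -> : 'D_1 (fun y : R => k y * k y) (0 : R) = 'D_1 (fun=> 1 : R) (0 : R).
    apply: near_eq_derive; near=> u.
    by rewrite -expr2; apply: (nuE u _).2; near: u; exact: near0.
  rewrite derive_cst => dkk.
  have kk : k 0 != 0 by rewrite -sqrf_eq0 k0 oner_eq0.
  have : dk * k 0 = 0 by lra.
  by move/eqP; rewrite mulf_eq0 (negbTE kk) orbF => /eqP.
exists (k 0) => //; rewrite c0 in nu0; split=> //.
have coord (h : R -> E) dh j : is_derive (0 : R) 1 h dh ->
    is_derive (0 : R) 1 (fun u => h u 0 j) (dh 0 j).
  move=> [hd <-]; split; first by move/derivable_mxP : hd; exact.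
  by rewrite derive_mx // mxE.
apply/rowP => j; rewrite [RHS]mxE.
have [_ <-] := coord _ _ j Dnu.
have [_ <-] : is_derive (0 : R) 1 (fun u => k u * (gauss \o c) u 0 j)
    (k 0 * 'D_v gauss p 0 j).
  apply: (is_derive_eq (is_derive_mul _ _ _ _ _ _ kD (coord _ _ j Dg))).
  by rewrite dk0 mul0r add0r.
apply: near_eq_derive; near=> u.
have [h _] : nu (c u) = k u *: gauss (c u) /\ k u ^+ 2 = 1.
  by apply: nuE; near: u; exact: near0.
by change (nu (c u) 0 j = k u * gauss (c u) 0 j); rewrite h mxE.
Unshelve. all: by end_near. Qed.

(** The squares absorb the unknown sign of [nu]. The linear form [swing p] is applied to the
    eigenvector equation: either it kills v, and the curvature is +- lam, or its value cancels, and
    the curvature is +- (lam - n / w). *)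
Lemma principal_curvature_eq nu p kappa : unit_normal_field surface nu ->
  surface p -> principal_curvatures surface nu p kappa -> forall i,
  (kappa i ^+ 2 - lam (angv p) ^+ 2) *
  (kappa i ^+ 2 - (lam (angv p) - n%:R / w (angv p)) ^+ 2) = 0.
Proof.
move=> nuN sp [B [Bfree BP]] i; have [vT vE] := BP i.
set v := row i B in vT vE; set k := kappa i in vE *.
have v0 : v != 0.
  apply/eqP => v0; have : delta_mx 0 i *m B = 0 :> 'rV_(n.+2).
    by rewrite -rowE.
  rewrite -(mul0mx 1 B) => /(row_free_inj Bfree) /matrixP /(_ 0 i).
  by rewrite !mxE !eqxx /= => /eqP; rewrite oner_eq0.
have [y y1 pE] := surface_angv _ sp; set x := angv p in pE *.
have [pv _] := tangent_orth p v sp vT.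
have [e e2 [_ De]] := derive_normal nu p v nuN sp vT.
have : k *: v = e *: (lam x *: v - (swing p v * (n%:R / w x)) *: dppt x y).
  rewrite -(shape_gauss p v y sp pE y1 pv) -vE /shape_operator /sphere_connection De.
  by rewrite dotpZl -scalerA -scalerBr scalerN.
set q := dppt x y => kE.
have sq : swing p q = 1 by exact: swing_dppt.
have swZ a u : swing p (a *: u) = a * swing p u.
  by rewrite /swing !crdE; field; rewrite gt_eqF // surface_offaxis.
have swB u u' : swing p (u - u') = swing p u - swing p u'.
  by rewrite /swing !crdE; field; rewrite gt_eqF // surface_offaxis.
have := congr1 (swing p) kE; rewrite swZ swZ swB !swZ sq mulr1.
have [A0|A0] := eqVneq (swing p v) 0 => kA.
  move: kE; rewrite A0 mul0r scale0r subr0 scalerA => /eqP.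
  rewrite -subr_eq0 -scalerBl scaler_eq0 (negbTE v0) orbF subr_eq0 => /eqP ->.
  by rewrite exprMn e2 mul1r subrr mul0r.
have -> : k = e * (lam x - n%:R / w x).
  by apply: (mulIf A0); rewrite kA; ring.
by rewrite exprMn e2 mul1r subrr mulr0.
Qed.

(* A constant principal curvature k would satisfy k = +- lam or
   k = +- (n H - (n - 1) lam) at every point, whence only four values for lam. *)
Lemma surface_not_isoparametric : ~ isoparametric surface.
Proof.
move=> [nu [nuN [kappa kP]]].
have i : 'I_n by exact: (Ordinal (ltnW n_gt1)).
pose k := kappa i; pose y : 'rV[R]_n := delta_mx 0 i.
have y1 : dotp y y = 1 by rewrite dotp_delta mxE !eqxx.
have lamP x : (k ^+ 2 - lam x ^+ 2) *
    (k ^+ 2 - (lam x - n%:R * (lam x - H)) ^+ 2) = 0.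
  have sp := ppt_surface x y y1.
  have := principal_curvature_eq nu _ kappa nuN sp (kP _ sp) i.
  rewrite (angv_ppt lam _ _ profile_class_lam) (angv_ppt w _ _ profile_class_w).
  have -> // : (w x)^-1 = lam x - H.
  by rewrite (profile_lamE _ _ _ _ _ _ _ _ _ prof) addrAC subrr add0r.
have n1 : n%:R - 1 != 0 :> R.
  by rewrite subr_eq0 -[1]/(1%:R) eqr_nat gtn_eqF.
pose l4 := [:: k; - k; (n%:R * H - k) / (n%:R - 1); (n%:R * H + k) / (n%:R - 1)].
have lam4 x : lam x \in l4.
  move/eqP: (lamP x); rewrite mulf_eq0 !subr_sqr !mulf_eq0 !inE.
  move=> /orP[/orP[|]|/orP[|]].
  - by rewrite subr_eq0 => /eqP ->; rewrite eqxx.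
  - by rewrite addrC addr_eq0 => ->; rewrite orbT.
  - move=> h; apply/orP; right; apply/orP; right; apply/orP; left.
    apply/eqP/(mulIf n1); rewrite divfK //; move/eqP: h; lra.
  - move=> h; do 3 (apply/orP; right).
    apply/eqP/(mulIf n1); rewrite divfK //; move/eqP: h; lra.
have lamc : continuous lam.
  by move=> x; exact: is_derive_cont (dlam x).
have [x1 [x2 x12]] := profile_nonconstant _ _ _ _ _ _ _ _ _ prof.
wlog lt12 : x1 x2 x12 / lam x1 < lam x2.
  move=> W; have [|//|] := ltgtP (lam x1) (lam x2); first exact: W.
    by apply: W; rewrite eq_sym.
  by move=> h; rewrite h eqxx in x12.
(* For j from 0 to 4 these are five distinct values, all taken by [lam] and hence all in the list
   [l4] of length 4. *)
pose v (j : nat) := lam x1 + (lam x2 - lam x1) * (j%:R / 4).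
have vl4 j : (j <= 4)%N -> v j \in l4.
  move=> j4; suff [x <-] : exists x, lam x = v j by exact: lam4.
  have j0 : (0 : R) <= j%:R / 4 by rewrite divr_ge0.
  have j1 : j%:R / 4 <= (1 : R) by rewrite ler_pdivrMr // mul1r ler_nat.
  have vj : Num.min (lam x1) (lam x2) <= v j <= Num.max (lam x1) (lam x2).
    rewrite /v min_l ?max_r ?(ltW lt12) //; move: j0 j1; set q := _ / 4 => q0 q1.
    by apply/andP; split; nra.
  have [x12'|x21] := leP x1 x2.
    have [||c _ <-] := @IVT R lam x1 x2 (v j) x12' => //; last by exists c.
    exact: continuous_subspaceT.
  have [||c _ <-] := @IVT R lam x2 x1 (v j) (ltW x21) => //; last by exists c.
    exact: continuous_subspaceT.
  by rewrite minC maxC.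
have : (size (map v (iota 0 5)) <= size l4)%N.
  apply: uniq_leq_size.
    rewrite map_inj_in_uniq ?iota_uniq // => a b _ _ /addrI.
    have d0 : lam x2 - lam x1 != 0 by rewrite subr_eq0 eq_sym.
    move=> /(mulfI d0) h; apply/eqP; rewrite -(eqr_nat R); apply/eqP.
    by move: h; lra.
  by move=> z /mapP[j]; rewrite mem_iota => /andP[_ j5] ->; exact: vl4.
by rewrite size_map size_iota.
Qed.

(** * Compactness and connectedness *)

Lemma zx_cont : continuous zx.
Proof. by move=> x; exact: is_derive_cont (is_derive_zx x). Qed.
Lemma zy_cont : continuous zy.
Proof. by move=> x; exact: is_derive_cont (is_derive_zy x). Qed.
Lemma r_cont : continuous r.
Proof. by move=> x; exact: is_derive_cont (is_derive_r x). Qed.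

Lemma ppt_cont (q : R * 'rV[R]_n) :
  {for q, continuous (fun q : R * 'rV[R]_n => ppt q.1 q.2)}.
Proof.
have c1 : {for q, continuous (@fst R 'rV[R]_n)} by exact: cvg_fst.
have c2 : {for q, continuous (@snd R 'rV[R]_n)} by exact: cvg_snd.
apply: continuous_mx; apply: mkv_coord.
- by apply: cont_comp => //; exact: zx_cont.
- by apply: cont_comp => //; exact: zy_cont.
- move=> i; have -> : (fun q : R * 'rV[R]_n => (r q.1 *: q.2) 0 i) =
      (fun q => r q.1 * q.2 0 i) by apply/funext => u; rewrite mxE.
  apply: cont_mul; first by apply: cont_comp => //; exact: r_cont.
  apply: (@continuous_comp _ _ _ (@snd R 'rV[R]_n) (fun A : 'rV[R]_n => A 0 i)) => //.
  exact: coord_continuous.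
Qed.

Lemma surface_compact : compact surface.
Proof.
pose K : set (R * 'rV[R]_n) := `[- pi, pi]%classic `*` [set y | dotp y y = 1].
have -> : surface = (fun q : R * 'rV[R]_n => ppt q.1 q.2) @` K.
  apply/seteqP; split=> [p sp|_ [[x y] [/= _ y1] <-]]; last by exists x, y.
  have [y y1 pE] := surface_angv _ sp; exists (angv p, y) => //=; split=> //=.
  by rewrite in_itv; exact: ang_bound.
apply: continuous_compact.
  by apply: continuous_subspaceT => q; exact: ppt_cont.
apply: compact_setX; first exact: segment_compact.
exact: compact_unit_vectors.
Qed.

(** Two moves join the base point to any other: along a great circle in the orbit x = 0, then along
    a meridian. *)
Lemma surface_connected : connected surface.
Proof.
pose y0 : 'rV[R]_n := delta_mx 0 (Ordinal (ltnW n_gt1)).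
have y01 : dotp y0 y0 = 1 by rewrite dotp_delta mxE !eqxx.
have -> : surface = connected_component surface (ppt 0 y0); last first.
  exact: component_connected.
apply/seteqP; split=> [_ [x [y [y1 ->]]]|]; last exact: connected_component_sub.
apply: (@connected_component_trans _ _ (ppt 0 y)).
  have [a [z [z1 yz ->]]] := great_circle y0 y n_gt1 y01 y1.
  pose c (u : R) := ppt 0 (cos u *: y0 + sin u *: z).
  have cM u : surface (c u).
    apply: ppt_surface; rewrite !dotpE y01 z1 (dotpC z) yz.
    by rewrite !mulr0 !mulr1 addr0 add0r -!expr2 cos2Dsin2.
  have cc : continuous c.
    move=> u; apply: (@continuous_comp _ _ _ (fun u : R => (0 : R, cos u *: y0 + sin u *: z))
       (fun q : R * 'rV[R]_n => ppt q.1 q.2)); last exact: ppt_cont.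
    have h1 : {for u, continuous (fun _ : R => 0 : R)} by exact: cont_cst.
    have h2 : {for u, continuous (fun u : R => cos u *: y0 + sin u *: z)}.
      apply: continuous_mx => i j.
      have -> : (fun u : R => (cos u *: y0 + sin u *: z) i j) =
        (fun u => cos u * y0 i j + sin u * z i j) by apply/funext => v; rewrite !mxE.
      apply: cont_add; apply: cont_mul; try exact: cont_cst.
        exact: continuous_cos.
      exact: continuous_sin.
    exact: (cvg_pair h1 h2).
  have := connected_component_path _ _ 0 a cc cM.
  by rewrite {1}/c cos0 sin0 scale1r scale0r addr0.
apply: (connected_component_path surface (fun u => ppt u y) 0 x).
  move=> u; apply: (@continuous_comp _ _ _ (fun u : R => (u, y))
       (fun q : R * 'rV[R]_n => ppt q.1 q.2)); last exact: ppt_cont.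
  have h1 : {for u, continuous (@id R)} by exact: cvg_id.
  have h2 : {for u, continuous (fun _ : R => y)} by exact: cvg_cst.
  exact: (cvg_pair h1 h2).
by move=> u; exact: ppt_surface.
Qed.

Lemma surface_compact_embedded : compact_embedded_hypersurface surface.
Proof.
split; [|exact: surface_connected|exact: surface_compact|exact: surface_embedded].
pose y0 : 'rV[R]_n := delta_mx 0 (Ordinal (ltnW n_gt1)).
by exists (ppt 0 y0); apply: ppt_surface; rewrite dotp_delta mxE !eqxx.
Qed.

(** * The action of O(n) and Z_m by isometries *)

Definition rotate (A : 'M[R]_n) (a : R) (p : E) : E :=
  mkv (cos a * crd1 p - sin a * crd2 p) (sin a * crd1 p + cos a * crd2 p)
      (tailv p *m A^T).

Lemma rotate_smooth A a : smooth_on offaxis (rotate A a).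
Proof.
apply: ambient_class_smooth_mx; apply: mkv_coord.
- apply: ratfun_add; last apply: ratfun_opp; apply: ratfun_mul; try exact: ratfun_cst.
    exact: ambient_class_coord ord0.
  exact: ambient_class_coord (lift ord0 ord0).
- apply: ratfun_add; apply: ratfun_mul; try exact: ratfun_cst.
    exact: ambient_class_coord ord0.
  exact: ambient_class_coord (lift ord0 ord0).
- move=> i; have -> : (fun p : E => (tailv p *m A^T) 0 i) = (fun p : E =>
      \sum_(j <- index_enum 'I_n) p 0 (lift ord0 (lift ord0 j)) * A i j).
    by apply/funext => p; rewrite mxE; apply: eq_bigr => j _; rewrite !mxE.
  apply: ratfun_sum => j; apply: ratfun_mul; last exact: ratfun_cst.
  exact: ambient_class_coord.
Qed.

Lemma is_derive_rotate A a p v : is_derive p v (rotate A a) (rotate A a v).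
Proof.
have d1 := is_derive_crd1 p v; have d2 := is_derive_crd2 p v.
apply: is_derive_mkv => i.
have -> : (fun p : E => (tailv p *m A^T) 0 i) =
      \sum_j (fun p : E => p 0 (lift ord0 (lift ord0 j)) * A i j).
    by apply/funext => q; rewrite mxE fct_sumE; apply: eq_bigr => j _; rewrite !mxE.
  have -> : (tailv v *m A^T) 0 i = \sum_j v 0 (lift ord0 (lift ord0 j)) * A i j.
    by rewrite mxE; apply: eq_bigr => j _; rewrite !mxE.
  by apply: is_derive_sum => j; apply: is_derive_mulc; exact: is_derive_coord.
Qed.

(** The transpose in [rotate] makes a left action on row vectors, with the order of composition that
    [isometries_contain_OnZm] asks for. *)
Lemma rotateM A B a b p : rotate (A *m B) (a + b) p = rotate A a (rotate B b p).
Proof.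
apply: mkv_eq; rewrite /rotate !crdE ?cosD ?sinD; try by ring.
by rewrite trmx_mul mulmxA.
Qed.

Lemma rotate1 p : rotate 1%:M 0 p = p.
Proof.
apply: mkv_eq; rewrite /rotate !crdE ?cos0 ?sin0; try by ring.
by rewrite trmx1 mulmx1.
Qed.

Lemma dotp_mulmx {d : nat} (u v : 'rV[R]_d) : dotp u v = (u *m v^T) 0 0.
Proof. by rewrite mxE; apply: eq_bigr => i _; rewrite mxE. Qed.

Lemma dotp_orthogonal (A : 'M[R]_n) u v : orthogonal_matrix A ->
  dotp (u *m A^T) (v *m A^T) = dotp u v.
Proof.
move=> AA; rewrite !dotp_mulmx trmx_mul trmxK mulmxA -(mulmxA u).
by rewrite (mulmx1C AA) mulmx1.
Qed.

Lemma dotp_rotate A a p q : orthogonal_matrix A ->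
  dotp (rotate A a p) (rotate A a q) = dotp p q.
Proof.
move=> AA; rewrite !dotp_mkv !crdE dotp_orthogonal //; congr (_ + _).
transitivity ((cos a ^+ 2 + sin a ^+ 2) * (crd1 p * crd1 q + crd2 p * crd2 q)).
  by ring.
by rewrite cos2Dsin2 mul1r.
Qed.

(** The m-fold symmetry: shifting the polar angle by a multiple of the period of [r] rotates z by
    that angle. *)
Lemma rotate_ppt A k x y :
  rotate A (step *+ k) (ppt x y) = ppt (x + step *+ k) (y *m A^T).
Proof.
have rp : r (x + step *+ k) = r x.
  exact: (periodicn (profile_r_period _ _ _ _ _ _ _ _ _ prof)).
apply: mkv_eq; rewrite /rotate !crdE.
- by rewrite !zx_polar zy_polar rp cosD; ring.
- by rewrite !zy_polar zx_polar rp sinD; ring.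
- by rewrite rp scalemxAl.
Qed.

Lemma rotate_surface A k : orthogonal_matrix A ->
  forall p, surface p -> surface (rotate A (step *+ k) p).
Proof.
move=> AA p [x [y [y1 ->]]]; rewrite rotate_ppt; apply: ppt_surface.
by rewrite dotp_orthogonal.
Qed.

Lemma rotate_mod A k p :
  rotate A (step *+ (k %% m)) p = rotate A (step *+ k) p.
Proof.
have -> : step *+ k = step *+ (k %% m) + (pi *+ 2) *+ (k %/ m).
  rewrite [in LHS](divn_eq k m) [LHS]mulrnDr addrC mulnC [step *+ (m * _)]mulrnA.
  by rewrite -(mulr_natr step m) divfK.
by rewrite /rotate (periodicn (@cosD2pi R)) (periodicn (@sinD2pi R)).
Qed.

Let m_trunc : (Zp_trunc m).+2 = m. Proof. by rewrite Zp_cast. Qed.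

Lemma surface_isometries : isometries_contain_OnZm m surface.
Proof.
exists (fun A (k : 'Z_m) => rotate A (step *+ k)).
have compE A B (k l : 'Z_m) p : rotate (A *m B) (step *+ (k + l)%R) p =
    rotate A (step *+ k) (rotate B (step *+ l) p).
  have modE j : (j %% (Zp_trunc m).+2 = j %% m)%N by rewrite m_trunc.
  have -> : ((k + l)%R : nat) = ((k + l) %% m)%N by exact: modE.
  by rewrite rotate_mod mulrnDr rotateM.
have inv A (k : 'Z_m) : orthogonal_matrix A -> forall p,
    rotate A^T (step *+ (- k)%R) (rotate A (step *+ k) p) = p.
  move=> AA p; rewrite -compE addNr (mulmx1C AA) [step *+ _]mulr0n.
  exact: rotate1.
have orthT (A : 'M[R]_n) : orthogonal_matrix A -> orthogonal_matrix A^T.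
  by move=> AA; rewrite /orthogonal_matrix trmxK (mulmx1C AA).
split.
- move=> A k AA; split.
  + exists offaxis; split; [exact: open_offaxis|exact: surface_offaxis|].
    exact: rotate_smooth.
  + split.
    * by move=> p sp; exact: rotate_surface.
    * by move=> p q _ _ pq; rewrite -(inv A k AA p) pq inv.
    * move=> p sp; exists (rotate A^T (step *+ (- k)%R) p).
        by apply: rotate_surface => //; exact: orthT.
      by have := inv A^T (- k) (orthT _ AA) p; rewrite trmxK opprK.
  + move=> p sp v w' _ _.
    have [_ ->] := is_derive_rotate A (step *+ k) p v.
    have [_ ->] := is_derive_rotate A (step *+ k) p w'.
    exact: dotp_rotate.
- by move=> A B k l _ _ p _; exact: compE.
- move=> A B k l AA BB AB.
  (* These points suffice: after the action their tails are [r 0] times the columns of the matrix,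
     and their nonzero planar part determines the angle modulo 2 pi. *)
  have AB' i : rotate A (step *+ k) (ppt 0 (delta_mx 0 i)) =
      rotate B (step *+ l) (ppt 0 (delta_mx 0 i)).
    by apply/AB/ppt_surface; rewrite dotp_delta mxE !eqxx.
  split.
    apply: trmx_inj; apply/row_matrixP => i; rewrite !rowE.
    have := congr1 tailv (AB' i); rewrite /rotate !crdE -!scalemxAl.
    by move=> /(congr1 ( *:%R (r 0)^-1)); rewrite !scalerA mulVf // !scale1r.
  have i : 'I_n by exact: Ordinal (ltnW n_gt1).
  have h1 := congr1 crd1 (AB' i); have h2 := congr1 crd2 (AB' i).
  rewrite /rotate !crdE !zx_polar !zy_polar cos0 sin0 !mulr0 mulr1 in h1 h2.
  rewrite !subr0 !addr0 in h1 h2.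
  have rho0 : Num.sqrt (1 - r 0 ^+ 2) != 0 by rewrite gt_eqF // sqrtr_gt0.
  have [j kl] := eq_angle _ _ (mulIf rho0 h1) (mulIf rho0 h2).
  have step0 : step != 0.
    by rewrite mulf_neq0 ?invr_neq0 // mulrn_eq0 /= gt_eqF // pi_gt0.
  (* A full turn is m steps, so k and l agree modulo m, and both are below m. *)
  have : (k%:Z = l%:Z + m%:Z * j)%R.
    apply/eqP; rewrite -(eqr_int R) rmorphD rmorphM /=; apply/eqP.
    apply: (mulfI step0); rewrite mulrDr mulrA -[step * m%:~R]/(step * m%:R).
    by rewrite divfK // !mulr_natr kl mulrzr.
  move=> /(congr1 (fun z => (z %% m)%Z)); rewrite addrC mulrC modzMDl.
  have ltm (k' : 'Z_m) : (k' < m)%N by rewrite -[X in (_ < X)%N]m_trunc ltn_ord.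
  rewrite !modz_small ?lez_nat ?ltz_nat ?ltm //.
  by move=> [] /val_inj.
Qed.

End Geometry.

(** * Morse coordinates on the half-line *)

Section RealCalculus.
Context {R : realType}.
Implicit Types (f df : R -> R) (a b x y : R).

Lemma continuous_antiderivative f : continuous f ->
  exists F : R -> R, forall x, is_derive x 1 F (f x).
Proof.
move=> fc; pose mu := @lebesgue_measure R.
have fint a b : mu.-integrable `[a, b]%classic (EFin \o f).
  apply: continuous_compact_integrable; first exact: segment_compact.
  exact: continuous_subspaceT.
pose F a x := (\int[mu]_(t in `[a, x]) f t)%R.
have FB a b x : a <= b -> b <= x -> F a x = F a b + F b x.
  move=> ab bx; suff <- : F a x - F a b = F b x by rewrite subrKC.
  rewrite /F -[RHS]Rintegral_itv_obnd_cbnd; last first.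
    by apply: integrableS (fint b x) => //; exact: subset_itv_oc_cc.
  by apply: Rintegral_itvB => //; rewrite bnd_simp.
(* The base point moves with x so as to stay on the left of both x and 0; by additivity of the
   integral the difference does not depend on it, and near a given x it can be frozen. *)
pose G x := F (- (`|x| + 1)) x - F (- (`|x| + 1)) 0.
exists G => x; pose a : R := - (`|x| + 2).
have [ax dF] : derivable (F a) x 1 /\ ((F a)^`())%classic x = f x.
  apply: (@continuous_FTC1_closed R f a x (x + 1)); rewrite ?ltrDl //.
    by rewrite /a; have := ler_norm (- x); rewrite normrN; lra.
  exact: fc.
have D : is_derive x 1 (fun y => F a y - F a 0) (f x).
  have Fd : is_derive x 1 (F a) (f x) by apply: (DeriveDef ax); rewrite -derive1E.
  by have := is_derive_sub _ _ _ _ _ _ Fd (is_derive_cst (F a 0) x 1); rewrite subr0.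
apply: near_eq_is_derive D; near=> y.
have yx : `|y| <= `|x| + 1.
  have : `|x - y| < 1 by near: y; apply: cvgr_dist_lt => //; exact: cvg_id.
  have := ler_normB (x - y) x; rewrite addrAC subrr add0r normrN; lra.
have ya : a <= - (`|y| + 1) by rewrite /a; lra.
have y0 : - (`|y| + 1) <= 0 by have := normr_ge0 y; lra.
have yy : - (`|y| + 1) <= y.
  by have := ler_norm (- y); rewrite normrN; lra.
rewrite /G; move: ya y0 yy; set b := - (`|y| + 1) => ya y0 yy.
by rewrite (FB a b y) // (FB a b 0) // opprD addrACA subrr add0r.
Unshelve. all: by end_near. Qed.

Lemma mean_value f df a b : (forall x, is_derive x 1 f (df x)) -> a <= b ->
  exists2 c, a <= c <= b & f b - f a = df c * (b - a).
Proof.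
move=> fd ab.
have fc : {within `[a, b], continuous f}.
  by apply: continuous_subspaceT => x; exact: is_derive_cont (fd x).
have [c cab ->] := MVT_segment ab (fun x _ => fd x) fc.
by exists c => //; move: cab; rewrite in_itv.
Qed.

(* The sign of [g - g0] in front of [D] makes [h] a Morse coordinate:
   [V = V g0 + ((g - g0) * h g) ^+ 2]. *)
Lemma morse_coordinate (V D : R -> R) (g0 : R) : 0 < g0 ->
  (forall g : R, 0 < g -> is_derive g 1 V ((g - g0) * D g)) ->
  (forall g : R, 0 < g -> {for g, continuous D}) ->
  (forall g : R, 0 < g -> 0 < D g) ->
  exists h : R -> R, [/\ forall g : R, 0 < g -> 0 < h g,
    forall g : R, 0 < g -> {for g, continuous h},
    h g0 ^+ 2 = D g0 / 2,
    forall g : R, 0 < g -> V g = V g0 + ((g - g0) * h g) ^+ 2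
    & forall g : R, 0 < g -> is_derive g 1 (fun g : R => (g - g0) * h g) (D g / (2 * h g))].
Proof.
move=> g00 dV cD D0.
have cV (g : R) : 0 < g -> {for g, continuous V} by move=> /dV /is_derive_cont.
(* The mean value theorem between g0 and g, on whichever side g lies; the sign condition keeps c on
   that side. *)
have mvt (g : R) (U dU : R -> R) : 0 < g ->
    (forall x : R, 0 < x -> is_derive x 1 U (dU x)) ->
    exists2 c, 0 < c /\ `|c - g0| <= `|g - g0| /\ 0 <= (c - g0) * (g - g0) /\
      (g != g0 -> c != g0) & U g - U g0 = dU c * (g - g0).
  move=> g1 Ud; have cU (x : R) : 0 < x -> {for x, continuous U} by move=> /Ud /is_derive_cont.
  have wc (a b : R) : 0 < a -> {within `[a, b], continuous U}.
    move=> a0; apply: derivable_within_continuous => x; rewrite in_itv /= => /andP[ax _].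
    by case: (Ud x (lt_le_trans a0 ax)).
  have [lt_g|gt_g|->] := ltgtP g g0.
  - have Ui (x : R) : x \in `]g, g0[ -> is_derive x 1 U (dU x).
      by rewrite in_itv /= => /andP[gx _]; apply: Ud; exact: lt_trans gx.
    have [c /[!in_itv] /= /andP[c1 c2] cE] := MVT lt_g Ui (wc _ _ g1).
    exists c; last by apply: oppr_inj; rewrite opprB cE; ring.
    split; first exact: lt_trans c1.
    split; first by rewrite !ltr0_norm ?subr_lt0 //; lra.
    split; first by apply: mulr_le0; lra.
    by rewrite lt_eqF.
  - have Ui (x : R) : x \in `]g0, g[ -> is_derive x 1 U (dU x).
      by rewrite in_itv /= => /andP[gx _]; apply: Ud; exact: lt_trans gx.
    have [c /[!in_itv] /= /andP[c1 c2] cE] := MVT gt_g Ui (wc _ _ g00).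
    exists c => //; split; first exact: lt_trans c1.
    split; first by rewrite !gtr0_norm ?subr_gt0 //; lra.
    split; first by apply: mulr_ge0; lra.
    by rewrite gt_eqF.
  - by exists g0; rewrite ?subrr ?mulr0 ?eqxx.
(* The square of h. As V' = (g - g0) D, the quotient tends to D g0 / 2 at g0. *)
pose q (g : R) := if g == g0 then D g0 / 2 else (V g - V g0) / (g - g0) ^+ 2.
have q0 (g : R) : 0 < g -> 0 < q g.
  move=> g1; rewrite /q; case: eqP => [_|/eqP gg0]; first by rewrite divr_gt0 ?D0.
  have [c [c0 [_ [cg /(_ gg0) cg0]]] ->] := mvt g V _ g1 dV.
  rewrite divr_gt0 ?exprn_even_gt0 ?subr_eq0 //= mulrAC pmulr_rgt0 ?D0 // lt_neqAle cg andbT.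
  by rewrite eq_sym mulf_neq0 // subr_eq0.
have qV g : V g = V g0 + (g - g0) ^+ 2 * q g.
  rewrite /q; case: eqP => [->|/eqP gg0]; first by rewrite subrr expr0n mul0r addr0.
  by rewrite mulrC divfK ?subrKC // expf_neq0 // subr_eq0.
have neq_near (g : R) : g != g0 -> \forall x \near g, x != g0.
  move=> gg0; near=> x; apply: contraTneq isT => xg0.
  have : `|g - x| < `|g - g0|.
    by near: x; apply: cvgr_dist_lt; [exact: cvg_id|rewrite normr_gt0 subr_eq0].
  by rewrite xg0 ltxx.
have cq (g : R) : 0 < g -> {for g, continuous q}.
  move=> g1; have [->|gg0] := eqVneq g g0; last first.
    have : {for g, continuous (fun g => (V g - V g0) / (g - g0) ^+ 2)}.
      apply: cont_mul; first by apply: cont_sub; [exact: cV|exact: cont_cst].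
      apply: cont_inv; first by rewrite expf_neq0 // subr_eq0.
      have e : {for g, continuous (fun g => g - g0)}.
        by apply: cont_sub; [exact: cvg_id|exact: cont_cst].
      exact: (cont_mul _ _ _ e e).
    rewrite /prop_for /continuous_at {2}/q (negbTE gg0); apply: cvg_trans.
    apply: near_eq_cvg; near=> x; rewrite /q ifF //; apply/negbTE.
    by near: x; exact: neq_near.
  apply/cvgrPdist_le => e e0; have := cD g0 g00; move=> /cvgrPdist_le /(_ e e0).
  move=> /nbhs_ballP[d /= d0 dD]; near=> x.
  have xd : `|x - g0| < d.
    by rewrite distrC; near: x; apply: cvgr_dist_lt => //; exact: cvg_id.
  have x0 : 0 < x.
    have : `|g0 - x| < g0 by near: x; apply: cvgr_dist_lt => //; exact: cvg_id.
    by have := ler_norm (g0 - x); lra.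
  rewrite /q eqxx; case: eqP => [_|/eqP xg0]; first by rewrite subrr normr0 ltW.
  (* Once the quadratic part is removed, the derivative is (y - g0) (D y - D g0), so that the mean
     value theorem bounds the error by |D c - D g0| with c no farther from g0 than x. *)
  pose U (g : R) := V g - D g0 / 2 * ((g - g0) * (g - g0)).
  have dU (y : R) : 0 < y -> is_derive y 1 U ((y - g0) * (D y - D g0)).
    move=> y0; have dy : is_derive y 1 (fun g => g - g0) 1.
      have := is_derive_sub id _ _ _ _ _ (is_derive_id y 1) (is_derive_cst g0 y 1).
      by rewrite subr0.
    apply: (is_derive_eq (is_derive_sub _ _ _ _ _ _ (dV y y0)
       (is_derive_cmul _ (D g0 / 2) _ _ _ (is_derive_mul _ _ _ _ _ _ dy dy)))).
    by field.
  have [c [c0 [cx [_ _]]] cE] := mvt x U _ x0 dU.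
  have xx : (x - g0) ^+ 2 != 0 by rewrite expf_neq0 // subr_eq0.
  have -> : D g0 / 2 - (V x - V g0) / (x - g0) ^+ 2 =
      - ((U x - U g0) / (x - g0) ^+ 2).
    by rewrite /U; field; rewrite subr_eq0.
  rewrite normrN cE normrM normfV normrX !normrM.
  have x0' : 0 < `|x - g0| by rewrite normr_gt0 subr_eq0.
  have Dc : `|D c - D g0| <= e.
    rewrite distrC; apply: dD; rewrite /ball /= distrC; exact: le_lt_trans xd.
  rewrite ler_pdivrMr ?exprn_gt0 // expr2 mulrA ler_pM2r // [e * _]mulrC.
  by rewrite ler_pM.
exists (fun g => Num.sqrt (q g)); split.
- by move=> g /q0; rewrite sqrtr_gt0.
- by move=> g g1; apply: cont_comp; [exact: sqrt_continuous | exact: cq].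
- by rewrite sqr_sqrtr ?ltW ?q0 // /q eqxx.
- by move=> g g1; rewrite exprMn sqr_sqrtr ?ltW ?q0 // -qV.
- move=> g g1; have [->|gg0] := eqVneq g g0.
    (* At g0 the difference quotient of (g - g0) h g is h itself, so continuity of h is all that is
       needed. *)
    apply/is_derive1_caratheodory; exists (fun g => Num.sqrt (q g)); split.
    + by move=> z; rewrite subrr mul0r subr0 mulrC.
    + by apply: cont_comp; [exact: sqrt_continuous | exact: cq].
    + have -> : D g0 = 2 * Num.sqrt (q g0) ^+ 2.
        by rewrite sqr_sqrtr ?ltW ?q0 // /q eqxx mulrC divfK.
      by field; rewrite gt_eqF // sqrtr_gt0 q0.
  have dy : is_derive g 1 (fun g => g - g0) 1.
    by have := is_derive_sub id _ _ _ _ _ (is_derive_id g 1) (is_derive_cst g0 g 1); rewrite subr0.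
  have gg1 : (g - g0) * (g - g0) != 0 by rewrite mulf_neq0 // subr_eq0.
  have dq : is_derive g 1 q (((g - g0) * D g) / (g - g0) ^+ 2 - 2 * q g / (g - g0)).
    have nq : \near g, (V g - V g0) / ((g - g0) * (g - g0)) = q g.
      near=> x; rewrite /q ifF ?expr2 //; apply/negbTE.
      by near: x; exact: neq_near.
    apply: (near_eq_is_derive nq); have gg := neq_near g gg0.
    have dV0 : is_derive g 1 (fun g => V g - V g0) ((g - g0) * D g).
      by have := is_derive_sub _ _ _ _ _ _ (dV g g1) (is_derive_cst (V g0) g 1); rewrite subr0.
    apply: (is_derive_eq (is_derive_mul _ _ _ _ _ _ dV0
      (is_derive_inv (fun g => (g - g0) * (g - g0)) g 1 _ gg1
        (is_derive_mul _ _ _ _ _ _ dy dy)))).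
    by rewrite /q (negbTE gg0); field; rewrite subr_eq0.
  have dsq := is_derive_comp1 (@Num.sqrt R) q g 1 _ _ (is_derive1_sqrt (q0 g g1)) dq.
  apply: (is_derive_eq (is_derive_mul _ _ _ _ _ _ dy dsq)).
  have s0 : 0 < Num.sqrt (q g) by rewrite sqrtr_gt0 q0.
  have -> : q g = Num.sqrt (q g) ^+ 2 by rewrite sqr_sqrtr ?ltW ?q0.
  by rewrite sqrtr_sqr gtr0_norm //; field; rewrite subr_eq0 gg0 gt_eqF.
Unshelve. all: by end_near. Qed.

(** The Morse coordinate p has the positive derivative D / (2 h), and p^2 = V - V g0 is unbounded on
    both sides of g0; hence p maps the half-line bijectively onto the line, and P is its inverse. *)
Lemma morse_chart (V D : R -> R) (g0 : R) : 0 < g0 ->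
  (forall g : R, 0 < g -> is_derive g 1 V ((g - g0) * D g)) ->
  (forall g : R, 0 < g -> {for g, continuous D}) ->
  (forall g : R, 0 < g -> 0 < D g) ->
  (forall M, exists g, 0 < g < g0 /\ M <= V g) ->
  (forall M, exists g, g0 < g /\ M <= V g) ->
  exists P P' : R -> R,
    [/\ forall y, 0 < P y, forall y, V (P y) = V g0 + y ^+ 2,
        forall y : R, is_derive y 1 P (P' y), continuous P'
      & forall y, 0 < P' y] /\
    [/\ P 0 = g0, P' 0 ^+ 2 = 2 / D g0 & forall g, 0 < g -> exists y, P y = g].
Proof.
move=> g00 dV cD D0 lo hi.
have [h [h0 ch hg0 Vh dp]] := morse_coordinate V D g0 g00 dV cD D0.
pose p (g : R) := (g - g0) * h g.
have cp (g : R) : 0 < g -> {for g, continuous p}.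
  by move=> g1; exact: is_derive_cont (dp g g1).
have p_inc a b : 0 < a -> a < b -> p a < p b.
  move=> a0 ab.
  have pi x : x \in `]a, b[ -> is_derive x 1 p (D x / (2 * h x)).
    by rewrite in_itv /= => /andP[ax _]; apply: dp; exact: lt_trans ax.
  have pc : {within `[a, b], continuous p}.
    apply: derivable_within_continuous => x; rewrite in_itv /= => /andP[ax _].
    by case: (dp x (lt_le_trans a0 ax)).
  have [c /[!in_itv] /= /andP[ac _] pE] := MVT ab pi pc.
  have c0 := lt_trans a0 ac.
  rewrite -subr_gt0 pE mulr_gt0 ?subr_gt0 // divr_gt0 ?D0 // mulr_gt0 //; exact: h0.
have p_inj a b : 0 < a -> 0 < b -> p a = p b -> a = b.
  move=> a0 b0 pab; have [ab|ab|//] := ltgtP a b.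
    by have := p_inc _ _ a0 ab; rewrite pab ltxx.
  by have := p_inc _ _ b0 ab; rewrite pab ltxx.
have p_surj y : exists g, 0 < g /\ p g = y.
  have [g1 [/andP[g10 g1g] Vg1]] := lo (V g0 + y ^+ 2).
  have [g2 [g2g Vg2]] := hi (V g0 + y ^+ 2).
  have g20 : 0 < g2 := lt_trans g00 g2g.
  have sq z : V g0 + y ^+ 2 <= V z -> 0 < z -> `|y| <= `|p z|.
    move=> Vz z0; rewrite -ler_sqr ?nnegrE // !real_normK ?num_real //.
    by move: Vz; rewrite (Vh z z0) lerD2l.
  have pn : p g1 < 0 by rewrite /p nmulr_rlt0 ?h0 // subr_lt0.
  have pp : 0 < p g2 by rewrite /p mulr_gt0 ?h0 // subr_gt0.
  have p1 : p g1 <= - `|y|.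
    by have := sq _ Vg1 g10; rewrite (ltr0_norm pn) => yp; rewrite -[p g1]opprK lerN2.
  have p2 : `|y| <= p g2 by have := sq _ Vg2 g20; rewrite (gtr0_norm pp).
  have g12 : g1 <= g2 by rewrite ltW // (lt_trans g1g).
  have pc : {within `[g1, g2], continuous p}.
    apply: derivable_within_continuous => x; rewrite in_itv /= => /andP[ax _].
    by case: (dp x (lt_le_trans g10 ax)).
  have y1 := ler_norm y; have y2 := ler_norm (- y); rewrite normrN in y2.
  have yb : Num.min (p g1) (p g2) <= y <= Num.max (p g1) (p g2).
    have p12 : p g1 <= p g2 by lra.
    by rewrite min_l ?max_r //; apply/andP; split; lra.
  have [c /[!in_itv] /= /andP[c1 _] cE] := IVT g12 pc yb.
  by exists c; split => //; exact: lt_le_trans c1.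
have [P PP] := choice p_surj.
have P0 y : 0 < P y by case: (PP y).
have pP y : p (P y) = y by case: (PP y).
have Pp g : 0 < g -> P (p g) = g by move=> g1; apply: p_inj => //; rewrite pP.
pose P' y := 2 * h (P y) / D (P y).
have dP (y : R) : is_derive y 1 P (P' y).
  have nP : \forall g \near P y, 0 < g.
    near=> g; have : `|P y - g| < P y.
      by near: g; apply: cvgr_dist_lt => //; exact: cvg_id.
    by have := ler_norm (P y - g); lra.
  have -> : P' y = (D (P y) / (2 * h (P y)))^-1.
    by rewrite /P' invf_div.
  rewrite -[in X in is_derive X _ _ _](pP y); apply: (@is_derive_inverse R p P).
  - by near=> g; apply: Pp; near: g.
  - by near=> g; apply: cp; near: g.
  - exact: dp.
  - by rewrite mulf_neq0 ?invr_neq0 ?mulf_neq0 ?gt_eqF ?D0 ?h0.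
have P00 : P 0 = g0 by apply: p_inj => //; rewrite pP /p subrr mul0r.
exists P, P'; split; split.
- exact: P0.
- by move=> y; rewrite Vh // -/(p _) pP.
- exact: dP.
- move=> y; have cP : {for y, continuous P} by exact: is_derive_cont (dP y).
  have chP : {for y, continuous (fun y => h (P y))} by apply: cont_comp => //; exact: ch.
  have cDP : {for y, continuous (fun y => D (P y))} by apply: cont_comp => //; exact: cD.
  have DP0 : D (P y) != 0 by rewrite gt_eqF ?D0.
  exact: (cont_mul _ _ y (cont_mul _ _ y (cont_cst 2 y) chP)
    (cont_inv (fun y => D (P y)) y DP0 cDP)).
- by move=> y; rewrite /P' divr_gt0 ?mulr_gt0 ?h0 ?D0.
- exact: P00.
- by rewrite /P' P00 expr_div_n exprMn hg0; field; rewrite gt_eqF ?D0.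
- by move=> g g1; exists (p g); exact: Pp.
Unshelve. all: by end_near. Qed.

End RealCalculus.

(** * The profile equation and its period *)

Section Oscillator.
Context {R : realType} (n : nat) (H : R).
Hypotheses (n_gt1 : (1 < n)%N) (H_gt0 : 0 < H).
Implicit Types (g y e : R).

Let N : R := n%:R.
Let N1 : 1 < N. Proof. by rewrite /N ltr1n. Qed.
Let N2 : 2 <= N. Proof. by rewrite /N -[2]/(2%:R) ler_nat. Qed.
Let N_neq0 : N != 0. Proof. by rewrite gt_eqF // (lt_trans ltr01). Qed.

Definition lamg g : R := H + (g ^+ n)^-1.
(* Up to the factor 1 - sg ^+ 2, the first integral of the profile equation. *)
Definition potential g : R := g ^+ 2 * (1 + lamg g ^+ 2).
(* The positive root of (N - 1) l - l^-1 = N H, which is the value of lamg at the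
   critical point g0 of the potential. *)
Definition lam0 : R := (N * H + Num.sqrt ((N * H) ^+ 2 + 4 * (N - 1))) / (2 * (N - 1)).

Lemma lam0_root : (N - 1) * lam0 ^+ 2 - N * H * lam0 - 1 = 0.
Proof.
have N10 : N - 1 != 0 by rewrite subr_eq0 gt_eqF.
have d0 : 0 <= (N * H) ^+ 2 + 4 * (N - 1).
  by rewrite addr_ge0 ?sqr_ge0 // mulr_ge0 // subr_ge0 ltW.
have := sqr_sqrtr d0; rewrite /lam0; set q := Num.sqrt _ => q2.
transitivity ((q ^+ 2 - ((N * H) ^+ 2 + 4 * (N - 1))) / (4 * (N - 1))).
  by field.
by rewrite q2 subrr mul0r.
Qed.

Lemma lam0_gt0 : 0 < lam0.
Proof.
rewrite divr_gt0 // ?mulr_gt0 ?subr_gt0 // ltr_pwDl ?sqrtr_ge0 //.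
by rewrite mulr_gt0 // (lt_trans ltr01).
Qed.

(** The quadratic equals (N - 1) l (l - H) - H l - 1, which is negative for 0 < l <= H. This makes
    g0 = (lam0 - H)^(-1/n) meaningful. *)
Lemma lam0_gtH : H < lam0.
Proof.
have l0 := lam0_gt0; have root := lam0_root.
rewrite ltNge; apply/negP => lH.
suff : (N - 1) * lam0 ^+ 2 - N * H * lam0 - 1 < 0 by rewrite root ltxx.
have h1 : 0 <= (N - 1) * (lam0 * (H - lam0)).
  by apply: mulr_ge0; [|apply: mulr_ge0]; have := N1; lra.
have h2 : 0 < H * lam0 by rewrite mulr_gt0.
by move: h1 h2; rewrite expr2; lra.
Qed.

Lemma root_exists (a : R) : 0 < a -> exists g, 0 < g /\ g ^+ n = a.
Proof.
move=> a0; exists (a `^ n%:R^-1); split; first exact: powR_gt0.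
by rewrite -powR_mulrn ?powR_ge0 // -powRrM mulVf // powRr1 // ltW.
Qed.

Lemma exists_g0 : exists g, 0 < g /\ g ^+ n = (lam0 - H)^-1.
Proof. by apply: root_exists; rewrite invr_gt0 subr_gt0 lam0_gtH. Qed.

Definition g0 : R := sval (cid exists_g0).
Lemma g0_gt0 : 0 < g0. Proof. by rewrite /g0; case: cid => g []. Qed.
Lemma g0E : lamg g0 = lam0.
Proof.
have : g0 ^+ n = (lam0 - H)^-1 by rewrite /g0; case: cid => g [].
by rewrite /lamg => ->; rewrite invrK subrKC.
Qed.

Lemma is_derive_exprn (k : nat) g : is_derive g 1 (fun g => g ^+ k.+1) (k.+1%:R * g ^+ k).
Proof.
elim: k => [|k IHk].
  by rewrite expr0 mulr1; exact: is_derive_id.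
have -> : (fun g => g ^+ k.+2) = (fun g => g * g ^+ k.+1) by apply/funext => x; rewrite exprS.
apply: (is_derive_eq (is_derive_mul _ _ _ _ _ _ (is_derive_id g 1) IHk)).
by rewrite !exprS -[k.+2%:R]natr1 -[k.+1%:R]natr1; ring.
Qed.

Lemma is_derive_lamg g : 0 < g -> is_derive g 1 lamg (- (N / (g * g ^+ n))).
Proof.
move=> gp; have gn : g ^+ n != 0 by rewrite expf_neq0 // gt_eqF.
have nE : n = n.-1.+1 by rewrite prednK // ltnW.
have dn : is_derive g 1 (fun g => g ^+ n) (N * g ^+ n.-1).
  by rewrite /N nE; exact: is_derive_exprn.
apply: (is_derive_eq (is_derive_add _ _ _ _ _ _ (is_derive_cst H g 1)
  (is_derive_inv (fun g => g ^+ n) g 1 _ gn dn))).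
have gE : g ^+ n = g * g ^+ n.-1 by rewrite [in LHS]nE exprS.
rewrite add0r gE; field.
by rewrite expf_neq0 gt_eqF.
Qed.

(** The quotient V' / (g - g0) in closed form: lam0 - lamg g has numerator g^n - g0^n, and the
    geometric sum is the quotient of this by g - g0. It is thus continuous and positive at g0 too,
    as the Morse coordinate requires. *)
Definition stiffness g : R := 2 * g * ((N - 1) * lamg g + lam0^-1) *
  (\sum_(i < n) g ^+ (n.-1 - i) * g0 ^+ i) / (g ^+ n * g0 ^+ n).

Lemma lamgB g : 0 < g -> (g - g0) * stiffness g =
  2 * g * ((N - 1) * lamg g + lam0^-1) * (lam0 - lamg g).
Proof.
move=> gp; have g0p := g0_gt0.
have hn : g ^+ n - g0 ^+ n = (g - g0) * \sum_(i < n) g ^+ (n.-1 - i) * g0 ^+ i.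
  exact: subrXX.
rewrite /stiffness -g0E.
transitivity (2 * g * ((N - 1) * lamg g + (lamg g0)^-1) * (g ^+ n - g0 ^+ n) / (g ^+ n * g0 ^+ n)).
  by rewrite hn; ring.
have gn0 : g0 ^+ n != 0 by rewrite expf_neq0 // gt_eqF.
have gn : g ^+ n != 0 by rewrite expf_neq0 // gt_eqF.
have l0 : lamg g0 != 0 by rewrite g0E gt_eqF // lam0_gt0.
have -> : lamg g0 - lamg g = (g ^+ n - g0 ^+ n) / (g ^+ n * g0 ^+ n).
  by rewrite /lamg; field; rewrite gn gn0.
by rewrite mulrA.
Qed.

Lemma quadratic_factor (l : R) : (N - 1) * l ^+ 2 - N * H * l - 1 =
  (l - lam0) * ((N - 1) * l + lam0^-1).
Proof.
have l0 : lam0 != 0 by rewrite gt_eqF // lam0_gt0.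
have : N * H = ((N - 1) * lam0 ^+ 2 - 1) / lam0.
  apply: (mulIf l0); rewrite divfK //; have := lam0_root; lra.
by move=> ->; field.
Qed.

(** The derivative of [lamg] is - N (lam - H) / g, so V' = - 2 g ((N - 1) lam^2 - N H lam - 1),
    which factors through the root lam0. *)
Lemma is_derive_potential g : 0 < g ->
  is_derive g 1 potential ((g - g0) * stiffness g).
Proof.
move=> gp; have gn : g ^+ n != 0 by rewrite expf_neq0 // gt_eqF.
have dl := is_derive_lamg g gp.
have di := is_derive_id g (1 : R).
have d1 := is_derive_add _ _ _ _ _ _ (is_derive_cst (1 : R) g 1)
  (is_derive_mul _ _ _ _ _ _ dl dl).
have -> : potential = (fun g => (g * g) * (1 + lamg g * lamg g)).
  by apply/funext => x; rewrite /potential !expr2.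
apply: (is_derive_eq (is_derive_mul _ _ _ _ _ _ (is_derive_mul _ _ _ _ _ _ di di) d1)).
rewrite lamgB //.
transitivity (- (2 * g * ((N - 1) * lamg g ^+ 2 - N * H * lamg g - 1))); last first.
  by rewrite quadratic_factor; ring.
have -> : H = lamg g - (g ^+ n)^-1 by rewrite /lamg addrK.
by rewrite /cst; field; rewrite gn gt_eqF.
Qed.

Lemma lamg_gtH g : 0 < g -> H < lamg g.
Proof. by move=> gp; rewrite ltrDl invr_gt0 exprn_gt0. Qed.

Lemma lamg_gt0 g : 0 < g -> 0 < lamg g.
Proof. by move=> gp; exact: lt_trans H_gt0 (lamg_gtH _ gp). Qed.

Lemma lamg_decr g g' : 0 < g -> g < g' -> lamg g' < lamg g.
Proof.
move=> gp gg'; have gp' := lt_trans gp gg'.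
rewrite ltrD2l ltf_pV2 ?posrE ?exprn_gt0 //.
by rewrite ltrXn2r ?(ltW gp) // -lt0n ltnW.
Qed.

Lemma stiffness_gt0 g : 0 < g -> 0 < stiffness g.
Proof.
move=> gp; have g0p := g0_gt0; have l0 := lam0_gt0.
rewrite /stiffness divr_gt0 ?mulr_gt0 ?exprn_gt0 //.
  by rewrite addr_gt0 ?invr_gt0 // mulr_gt0 ?subr_gt0 // lamg_gt0.
rewrite (bigD1 (Ordinal (ltnW n_gt1))) //= ltr_pwDl //.
  by rewrite mulr_gt0 ?exprn_gt0.
by apply: sumr_ge0 => i _; rewrite mulr_ge0 ?exprn_ge0 // ltW.
Qed.

Lemma exprn_cont (k : nat) g : {for g, continuous (fun g => g ^+ k)}.
Proof. exact: exprn_continuous. Qed.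

Lemma lamg_cont g : 0 < g -> {for g, continuous lamg}.
Proof. by move=> gp; exact: is_derive_cont (is_derive_lamg g gp). Qed.

Lemma stiffness_cont g : 0 < g -> {for g, continuous stiffness}.
Proof.
move=> gp; have g0p := g0_gt0.
have cS : {for g, continuous (fun g => \sum_(i < n) g ^+ (n.-1 - i) * g0 ^+ i)}.
  have ci (i : 'I_n) : {for g, continuous (fun g => g ^+ (n.-1 - i) * g0 ^+ i)}.
    by apply: cont_mul; [exact: exprn_cont | exact: cont_cst].
  have -> : (fun g => \sum_(i < n) g ^+ (n.-1 - i) * g0 ^+ i) =
      \sum_(i < n) (fun g => g ^+ (n.-1 - i) * g0 ^+ i).
    by apply/funext => u; rewrite fct_sumE.
  elim: (index_enum _) => [|i q IHq].
    by rewrite big_nil; exact: (@cont_cst R).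
  by rewrite big_cons; exact: (@cont_add R _ _ _ g (ci i) IHq).
have c2 : {for g, continuous (fun g => 2 * g)}.
  by apply: cont_mul; [exact: cont_cst | exact: cvg_id].
have cl : {for g, continuous (fun g => (N - 1) * lamg g + lam0^-1)}.
  apply: cont_add; last exact: cont_cst.
  by apply: cont_mul; [exact: cont_cst | exact: lamg_cont].
have cd : {for g, continuous (fun g => (g ^+ n * g0 ^+ n)^-1)}.
  apply: cont_inv; first by rewrite mulf_neq0 ?expf_neq0 // gt_eqF.
  by apply: cont_mul; [exact: exprn_cont | exact: cont_cst].
exact: (cont_mul _ _ g (cont_mul _ _ g (cont_mul _ _ g c2 cl) cS) cd).
Qed.

Lemma potential_lo (M : R) : exists g, 0 < g < g0 /\ M <= potential g.
Proof.
have g0p := g0_gt0; have ig0 : 0 < g0^-1 by rewrite invr_gt0.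
set q := `|M| + 1 + g0^-1.
have q1 : 1 <= q by rewrite /q -addrA addrCA lerDl addr_ge0 ?invr_ge0 // ltW.
have q0 : 0 < q := lt_le_trans ltr01 q1.
pose g := (2 * q)^-1; have gp : 0 < g by rewrite invr_gt0 mulr_gt0.
exists g; split.
  rewrite gp /= /g invf_plt ?posrE ?mulr_gt0 //.
  have : g0^-1 <= q by rewrite /q lerDr addr_ge0.
  by lra.
have g1 : g <= 1 by rewrite /g invf_le1 ?mulr_gt0 //; lra.
(* Here n >= 2 enters: it gives lam >= g^-2, so that V >= g^2 lam^2 >= g^-2 = 4 q^2. *)
have gn : g ^+ n <= g ^+ 2 by rewrite ler_wiXn2l // ltW.
have l2 : (g ^+ 2)^-1 <= lamg g.
  have : (g ^+ 2)^-1 <= (g ^+ n)^-1 by rewrite lef_pV2 ?posrE ?exprn_gt0.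
  by move=> h; apply: (le_trans h); rewrite /lamg lerDr ltW.
have g20 : 0 < g ^+ 2 by rewrite exprn_gt0.
have h : (g ^+ 2)^-1 <= potential g.
  rewrite /potential; have -> : (g ^+ 2)^-1 = g ^+ 2 * ((g ^+ 2)^-1) ^+ 2.
    by field; rewrite gt_eqF.
  rewrite ler_pM2l //; have : ((g ^+ 2)^-1) ^+ 2 <= lamg g ^+ 2.
    by rewrite ler_sqr ?nnegrE ?invr_ge0 ?(ltW g20) // (ltW (lamg_gt0 _ gp)).
  by move=> h; apply: (le_trans h); rewrite lerDr.
apply: le_trans h; rewrite /g exprVn invrK.
have : M <= q by rewrite /q; have := ler_norm M; lra.
have : q * 1 <= q * q by rewrite ler_pM2l.
by rewrite exprMn expr2; lra.
Qed.

Lemma potential_hi (M : R) : exists g, g0 < g /\ M <= potential g.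
Proof.
have g0p := g0_gt0; exists (`|M| + 1 + g0).
have q1 : 1 <= `|M| + 1 + g0 by rewrite -addrA addrCA lerDl addr_ge0 // ltW.
split; first by rewrite ltrDr ltr_wpDl.
set q := _ + g0 in q1 *; have q0 : 0 < q := lt_le_trans ltr01 q1.
have Mq : M <= q by rewrite /q; have := ler_norm M; lra.
have q2 : q <= q ^+ 2 by rewrite expr2 ler_pMl.
have h : 0 <= q ^+ 2 * lamg q ^+ 2 by rewrite mulr_ge0 ?sqr_ge0.
by rewrite /potential mulrDr mulr1 (le_trans Mq) // (le_trans q2) // lerDl.
Qed.

(* P is the inverse of the Morse coordinate +- sqrt (V g - V g0). *)
Section Chart.
Variables (P P' : R -> R).
Hypothesis P_gt0 : forall y, 0 < P y.
Hypothesis P_eq : forall y, potential (P y) = potential g0 + y ^+ 2.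
Hypothesis dP : forall y : R, is_derive y 1 P (P' y).
Hypothesis cP' : continuous P'.
Hypothesis P'_gt0 : forall y, 0 < P' y.
Hypothesis P_0 : P 0 = g0.
Hypothesis P'_0 : P' 0 ^+ 2 = 2 / stiffness g0.
Hypothesis P_surj : forall g, 0 < g -> exists y, P y = g.

Let lp y : R := lamg (P y).
Let V0 : R := potential g0.

Let lp_gt0 y : 0 < lp y. Proof. exact: lamg_gt0. Qed.
Let lp2_gt0 y : 0 < 1 + lp y ^+ 2. Proof. by rewrite ltr_pwDl ?sqr_ge0. Qed.
Let P_neq0 y : P y != 0. Proof. by rewrite gt_eqF. Qed.
Let V0_gt0 : 0 < V0.
Proof.
by rewrite /V0 /potential mulr_gt0 ?exprn_gt0 ?g0_gt0 // ltr_pwDl ?sqr_ge0.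
Qed.

Lemma chart_incr y z : y < z -> P y < P z.
Proof.
move=> yz; have [c _ cE] := mean_value P P' y z dP (ltW yz).
by rewrite -subr_gt0 cE mulr_gt0 ?subr_gt0.
Qed.

Lemma lp_decr y z : y < z -> lp z < lp y.
Proof. by move=> yz; apply: lamg_decr => //; exact: chart_incr. Qed.

(** Half the derivative of [P_eq]; it trades P' for y in the estimates of [dens]. *)
Lemma chart_speed y :
  y = P y * ((N - 1) * lp y + lam0^-1) * (lam0 - lp y) * P' y.
Proof.
have d1 : is_derive y 1 (fun y => potential (P y))
    ((P y - g0) * stiffness (P y) * P' y).
  exact: (is_derive_comp1 potential P y 1 _ _ (is_derive_potential (P y) (P_gt0 y)) (dP y)).
have d2 : is_derive y 1 (fun y => potential g0 + y * y) (0 + (1 * y + y * 1)).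
  exact: (is_derive_add _ _ _ _ _ _ (is_derive_cst (potential g0) y 1)
    (is_derive_mul _ _ _ _ _ _ (is_derive_id y 1) (is_derive_id y 1))).
have e12 : (fun y => potential (P y)) = (fun y => potential g0 + y * y).
  by apply/funext => z; rewrite P_eq expr2.
move: d1; rewrite e12 lamgB // => -[_ d1]; case: d2 => _; rewrite d1.
by rewrite -/(lp y); lra.
Qed.

(* Minus the derivative of [tilt]; up to the factor [amp e], also the speed of
   the normal angle along the orbit y = e sin phi. *)
Definition dens y : R := N * P' y / (P y * P y ^+ n * (1 + lp y ^+ 2)).
Definition tilt y : R := atan (lp y).

Lemma dens_gt0 y : 0 < dens y.
Proof.
rewrite /dens divr_gt0 ?mulr_gt0 ?exprn_gt0 //; exact: lt_trans ltr01 N1.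
Qed.

Lemma is_derive_lp (y : R) : is_derive y 1 lp (- (N * P' y / (P y * P y ^+ n))).
Proof.
have d := is_derive_comp1 lamg P y 1 _ _ (is_derive_lamg (P y) (P_gt0 y)) (dP y).
by apply: (is_derive_eq d); field; rewrite expf_neq0 //= P_neq0.
Qed.

Lemma is_derive_tilt (y : R) : is_derive y 1 tilt (- dens y).
Proof.
have d := is_derive_comp1 (@atan R) lp y 1 _ _ (is_derive1_atan _) (is_derive_lp y).
apply: (is_derive_eq d); rewrite /dens; field.
by rewrite expf_neq0 ?P_neq0 //= gt_eqF.
Qed.

Lemma dens_cont : continuous dens.
Proof.
move=> y; have cP : {for y, continuous P} by exact: is_derive_cont (dP y).
have cl : {for y, continuous lp} by exact: is_derive_cont (is_derive_lp y).
have cn : {for y, continuous (fun y => P y ^+ n)}.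
  by apply: (@cont_comp _ _ (fun x => x ^+ n)) => //; exact: exprn_cont.
have c1 : {for y, continuous (fun y => 1 + lp y ^+ 2)}.
  by apply: cont_add; [exact: cont_cst | exact: cont_mul].
have d0 : P y * P y ^+ n * (1 + lp y ^+ 2) != 0.
  by rewrite !mulf_neq0 ?expf_neq0 // gt_eqF.
exact: (cont_mul _ _ y (cont_mul _ _ y (cont_cst N y) (@cP' y))
  (cont_inv (fun y => P y * P y ^+ n * (1 + lp y ^+ 2)) y d0
    (cont_mul _ _ y (cont_mul _ _ y cP cn) c1))).
Qed.

(** Eliminating P' by [chart_speed] brings in a factor |y|. Then y^2 <= P^2 (1 + lp^2), read off
    from [P_eq], both absorbs y^2 and gives |y| <= P (1 + lp). *)
Lemma dens_decay y : y != 0 -> y ^+ 2 * dens y <=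
  N * (P y / P y ^+ n * (1 + lp y)) / (((N - 1) * lp y + lam0^-1) * `|lam0 - lp y|).
Proof.
move=> y0; have lpy := lp_gt0 y; have py := P_gt0 y; have l0 := lam0_gt0.
set Q := (N - 1) * lp y + lam0^-1.
have Q0 : 0 < Q.
  by rewrite addr_gt0 ?invr_gt0 // mulr_gt0 // subr_gt0.
have yE := chart_speed y; rewrite -/Q in yE.
have A0 : 0 < `|lam0 - lp y|.
  rewrite normr_gt0; apply: contra y0 => /eqP A0.
  by rewrite yE A0 mulr0 mul0r.
have nyE : `|y| = P y * Q * `|lam0 - lp y| * P' y.
  by rewrite {1}yE !normrM !(gtr0_norm (P_gt0 _)) (gtr0_norm Q0) (gtr0_norm (P'_gt0 _)).
have P'E : P' y = `|y| / (P y * Q * `|lam0 - lp y|).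
  have PQA : P y * Q * `|lam0 - lp y| != 0 by rewrite !mulf_neq0 // gt_eqF.
  by apply: (mulIf PQA); rewrite divfK // mulrC -nyE.
have y2 : y ^+ 2 <= P y ^+ 2 * (1 + lp y ^+ 2).
  by have := P_eq y; rewrite {1}/potential => ->; rewrite lerDr ltW.
have y1 : `|y| <= P y * (1 + lp y).
  have b0 : 0 <= P y * (1 + lp y) by apply: mulr_ge0; lra.
  rewrite -ler_sqr ?nnegrE // real_normK ?num_real //.
  apply: (le_trans y2); rewrite exprMn ler_pM2l ?exprn_gt0 //.
  by lra.
rewrite /dens P'E.
have -> : y ^+ 2 * (N * (`|y| / (P y * Q * `|lam0 - lp y|)) /
    (P y * P y ^+ n * (1 + lp y ^+ 2))) =
    (y ^+ 2 / (P y ^+ 2 * (1 + lp y ^+ 2))) *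
    (N * (`|y| / P y ^+ n) / (Q * `|lam0 - lp y|)).
  field; rewrite expf_neq0 ?P_neq0 //= (gt_eqF Q0) (gt_eqF A0) /= gt_eqF //.
have f1 : y ^+ 2 / (P y ^+ 2 * (1 + lp y ^+ 2)) <= 1.
  by rewrite ler_pdivrMr ?mul1r // mulr_gt0 ?exprn_gt0.
have N0 : 0 <= N by have := N1; lra.
have pn0 : 0 < P y ^+ n by rewrite exprn_gt0.
have QA0 : 0 < Q * `|lam0 - lp y| by rewrite mulr_gt0.
have f2 : 0 <= N * (`|y| / P y ^+ n) / (Q * `|lam0 - lp y|).
  by apply: divr_ge0 (ltW QA0); apply: mulr_ge0 => //; apply: divr_ge0 (ltW pn0).
apply: (le_trans (ler_wpM2r f2 f1)); rewrite mul1r.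
rewrite ler_pM2r ?invr_gt0 //; apply: ler_wpM2l => //.
by rewrite mulrAC ler_pM2r ?invr_gt0.
Qed.

Lemma dens_bound : exists2 K, 0 < K & forall y, y ^+ 2 * dens y <= K.
Proof.
have l0 := lam0_gt0; have N0 : 0 < N := lt_trans ltr01 N1.
have g0p := g0_gt0.
have m11 : (- 1 : R) <= 1 by lra.
have dw : {within `[(- 1 : R), 1], continuous dens}.
  by apply: continuous_subspaceT => x; exact: dens_cont.
have [c _ cM] := EVT_max m11 dw.
(* [K1] serves |y| <= 1. [K2] serves y > 1, where P > g0 bounds the numerator. [K3] serves y < -1,
   where the numerator is at most, and the denominator at least, a constant times lp^2. *)
pose K1 := dens c.
have lp0 : lp 0 = lam0 by rewrite /lp P_0 g0E.
have l1 : lp 1 < lam0 by rewrite -lp0 lp_decr.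
have l2 : lam0 < lp (- 1) by rewrite -lp0 lp_decr // ltrN10.
pose K2 := N * ((g0 ^+ n.-1)^-1 * (1 + lam0)) / (lam0^-1 * (lam0 - lp 1)).
pose K3 := N * g0 * (1 + lam0^-1) / (1 - lam0 / lp (- 1)).
have K10 : 0 < K1 by exact: dens_gt0.
have K20 : 0 < K2.
  by rewrite /K2 divr_gt0 ?mulr_gt0 ?invr_gt0 ?exprn_gt0 ?subr_gt0 // addr_gt0.
have k3 : 0 < 1 - lam0 / lp (- 1).
  by rewrite subr_gt0 ltr_pdivrMr ?mul1r.
have K30 : 0 < K3.
  by rewrite /K3 divr_gt0 // !mulr_gt0 // addr_gt0 ?invr_gt0.
exists (K1 + K2 + K3); first by rewrite !addr_gt0.
move=> y; have [y1|y1] := leP `|y| 1.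
  have : y ^+ 2 * dens y <= 1 * dens y.
    rewrite ler_pM2r ?dens_gt0 // -real_normK ?num_real //.
    by rewrite exprn_ile1.
  have := cM y; rewrite in_itv /= -ler_norml y1 => /(_ isT); rewrite -/K1; lra.
have y0 : y != 0 by apply: contraTneq y1 => ->; rewrite normr0 ltr10.
apply: (le_trans (dens_decay y y0)).
have lpy := lp_gt0 y; have py := P_gt0 y; have n1 := N1; have n2 := N2.
have il0 : 0 < lam0^-1 by rewrite invr_gt0.
have pn0 : 0 < P y ^+ n by rewrite exprn_gt0.
have A0 : 0 <= P y / P y ^+ n by apply: divr_ge0; exact: ltW.
have L0 : 0 <= 1 + lp y by lra.
set Q := (N - 1) * lp y + lam0^-1.
have frac (a b c' d : R) : 0 <= a -> 0 < d -> a <= b -> d <= c' ->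
    N * a / c' <= N * b / d.
  move=> a0 d0 ab dc; have c0 := lt_le_trans d0 dc.
  rewrite ler_pdivrMr // mulrAC ler_pdivlMr // -!mulrA; apply: ler_wpM2l; first by lra.
  by apply: ler_pM => //; exact: ltW.
have num0 : 0 <= P y / P y ^+ n * (1 + lp y) by exact: mulr_ge0.
have [yp|yn] := leP 0 y.
  rewrite ger0_norm // in y1.
  have ly : lp y < lp 1 by exact: lp_decr.
  have gy : g0 < P y by rewrite -P_0; apply: chart_incr; lra.
  have Qb : lam0^-1 <= Q by rewrite /Q lerDr; apply: mulr_ge0; lra.
  have Ab : lam0 - lp 1 <= `|lam0 - lp y| by rewrite gtr0_norm; lra.
  have num : P y / P y ^+ n * (1 + lp y) <= (g0 ^+ n.-1)^-1 * (1 + lam0).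
    apply: ler_pM => //; last by lra.
    have -> : P y / P y ^+ n = (P y ^+ n.-1)^-1.
      rewrite -[in X in P y ^+ X](prednK (ltnW n_gt1)) exprS; field.
      by rewrite expf_neq0 ?P_neq0.
    rewrite lef_pV2 ?posrE ?exprn_gt0 //.
    by apply: lerXn2r; rewrite ?nnegrE ltW.
  suff : N * (P y / P y ^+ n * (1 + lp y)) / (Q * `|lam0 - lp y|) <= K2 by lra.
  apply: frac => //; first by apply: mulr_gt0; lra.
  by apply: ler_pM => //; lra.
rewrite ltr0_norm // in y1.
have ly : lp (- 1) < lp y by apply: lp_decr; lra.
have gy : P y < g0 by rewrite -P_0; apply: chart_incr; lra.
(* This uses N - 1 >= 1. *)
have Qb : lp y <= Q.
  have : 0 <= (N - 2) * lp y by apply: mulr_ge0; lra.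
  by rewrite /Q; lra.
have Ab : lp y * (1 - lam0 / lp (- 1)) <= `|lam0 - lp y|.
  rewrite distrC gtr0_norm; last by lra.
  have -> : lp y - lam0 = lp y * (1 - lam0 / lp y) by field; rewrite gt_eqF.
  rewrite ler_pM2l // lerD2l lerN2 ler_pM2l // lef_pV2 ?posrE //; exact: ltW.
have PnE : (P y ^+ n)^-1 <= lp y by rewrite /lp /lamg lerDr ltW.
have num : P y / P y ^+ n * (1 + lp y) <= g0 * (1 + lam0^-1) * (lp y * lp y).
  have -> : g0 * (1 + lam0^-1) * (lp y * lp y) =
      g0 * lp y * (lp y * (1 + lam0^-1)) by ring.
  apply: ler_pM => //.
    by apply: ler_pM => //; rewrite ?invr_ge0; exact: ltW.
  have : 1 <= lp y / lam0 by rewrite ler_pdivlMr // mul1r; lra.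
  by rewrite mulrDr mulr1; lra.
suff : N * (P y / P y ^+ n * (1 + lp y)) / (Q * `|lam0 - lp y|) <= K3 by lra.
have lm1 := lp_gt0 (- 1).
have -> : K3 = N * (g0 * (1 + lam0^-1) * (lp y * lp y)) /
    (lp y * (lp y * (1 - lam0 / lp (- 1)))).
  rewrite /K3; field; rewrite !gt_eqF //=; lra.
apply: frac => //; first by rewrite !mulr_gt0.
apply: ler_pM => //; first exact: ltW.
by apply: mulr_ge0; exact: ltW.
Qed.

(** * The period as a function of the amplitude *)

Definition amp e : R := Num.sqrt (V0 + e ^+ 2).
Definition speed e (x : R) : R := amp e * dens (e * sin x).

Let amp2_gt0 e : 0 < V0 + e ^+ 2. Proof. by rewrite ltr_pwDl ?sqr_ge0. Qed.
Let amp_gt0 e : 0 < amp e. Proof. by rewrite sqrtr_gt0. Qed.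
Let amp2E e : amp e ^+ 2 = V0 + e ^+ 2. Proof. by rewrite sqr_sqrtr // ltW. Qed.

Lemma speed_gt0 e x : 0 < speed e x.
Proof. by rewrite mulr_gt0 ?dens_gt0. Qed.

Lemma is_derive_esin e (x : R) :
  is_derive x 1 (fun x => e * sin x) (e * cos x).
Proof. exact: (is_derive_cmul _ e _ _ _ (is_derive_sin x)). Qed.

Lemma speed_cont e : continuous (speed e).
Proof.
move=> x; have c : {for x, continuous (fun x => e * sin x)}.
  exact: is_derive_cont (is_derive_esin e x).
exact: (cont_mul _ _ x (cont_cst (amp e) x)
  (cont_comp dens (fun x => e * sin x) x (@dens_cont (e * sin x)) c)).
Qed.

Lemma prim_exists e : exists B : R -> R,
  (forall x : R, is_derive x 1 B (speed e x)) /\ B 0 = 0.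
Proof.
have [B dB] := continuous_antiderivative (speed e) (speed_cont e).
exists (fun x => B x - B 0); split; last by rewrite subrr.
move=> x; have := is_derive_sub _ _ _ _ _ _ (dB x) (is_derive_cst (B 0) x 1).
by rewrite subr0.
Qed.

(** The normal angle swept from phase 0 to phase x on the orbit of amplitude e; [per e] is the time
    of a full oscillation. *)
Definition prim e : R -> R := sval (cid (prim_exists e)).
Lemma is_derive_prim e (x : R) : is_derive x 1 (prim e) (speed e x).
Proof. exact: ((svalP (cid (prim_exists e))).1 x). Qed.
Lemma prim0 e : prim e 0 = 0.
Proof. exact: ((svalP (cid (prim_exists e))).2). Qed.

Definition per e : R := prim e (pi *+ 2).

Let is_derive_shift1 (a x : R) : is_derive x 1 (fun x => x + a) 1.
Proof.
have := is_derive_add id _ x 1 _ _ (is_derive_id x 1) (is_derive_cst a x 1).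
by rewrite addr0.
Qed.

Lemma prim_shift e (x : R) : prim e (x + pi *+ 2) = prim e x + per e.
Proof.
have D y : is_derive y 1 (fun x => prim e (x + pi *+ 2) - prim e x) 0.
  have d1 := is_derive_comp1 (prim e) (fun x => x + pi *+ 2) y 1 _ _
    (is_derive_prim e (y + pi *+ 2)) (is_derive_shift1 (pi *+ 2) y).
  apply: (is_derive_eq (is_derive_sub _ _ _ _ _ _ d1 (is_derive_prim e y))).
  by rewrite /speed sinD2pi mulr1 subrr.
have := @is_derive_0_is_cst R _ x 0 D; rewrite add0r prim0 subr0 /per; lra.
Qed.

Lemma per_half e : per e = 2 * (prim e (pi / 2) - prim e (- (pi / 2))).
Proof.
have D y : is_derive y 1 (fun x => prim e (pi - x) + prim e x) 0.
  have d0 : is_derive y 1 (fun x : R => pi - x) (0 - 1).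
    exact: (is_derive_sub _ id _ _ _ _ (is_derive_cst pi y 1) (is_derive_id y 1)).
  have d1 := is_derive_comp1 (prim e) (fun x => pi - x) y 1 _ _
    (is_derive_prim e (pi - y)) d0.
  apply: (is_derive_eq (is_derive_add _ _ _ _ _ _ d1 (is_derive_prim e y))).
  rewrite /speed; have -> : sin (pi - y) = sin y.
    by rewrite sinB sinpi cospi; ring.
  by ring.
have := @is_derive_0_is_cst R _ (pi / 2) (- (pi / 2)) D.
have -> : pi - pi / 2 = pi / 2 :> R by field.
have -> : pi - - (pi / 2) = - (pi / 2) + pi *+ 2 :> R by field.
rewrite prim_shift; lra.
Qed.

(* [prim] would increase like [- amp e / e * tilt (e sin phi)] if the speed carried
   a factor cos phi; the defect 1 - cos phi is at most sin phi ^+ 2 on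
   [-pi/2, pi/2], where dens decays like y ^- 2. *)
Lemma per_estimate K e : 0 < e -> (forall y, y ^+ 2 * dens y <= K) ->
  0 <= per e / 2 - amp e / e * (tilt (- e) - tilt e) <= amp e * K / e ^+ 2 * pi.
Proof.
move=> e0 yK; have a0 := amp_gt0 e; have pi0 := pi_gt0 R.
pose F (x : R) := prim e x + amp e / e * tilt (e * sin x).
have dF (x : R) : is_derive x 1 F (speed e x * (1 - cos x)).
  have d1 := is_derive_comp1 tilt (fun x => e * sin x) x 1 _ _
    (is_derive_tilt _) (is_derive_esin e x).
  apply: (is_derive_eq (is_derive_add _ _ _ _ _ _ (is_derive_prim e x)
    (is_derive_cmul _ (amp e / e) _ _ _ d1))).
  by rewrite /speed; field; rewrite gt_eqF.
have pp : - (pi / 2) <= pi / 2 :> R by lra.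
have [c cpi cE] := mean_value F _ _ _ dF pp.
have FE : F (pi / 2) - F (- (pi / 2)) =
    per e / 2 - amp e / e * (tilt (- e) - tilt e).
  by rewrite /F sinN sin_pihalf mulrN1 mulr1 per_half; field; rewrite gt_eqF.
have pE : pi / 2 - - (pi / 2) = pi :> R by field.
rewrite -FE cE pE; have c0 := cos_ge0_pihalf cpi; have c1 := cos_le1 c.
have s0 := speed_gt0 e c.
apply/andP; split; first by apply: mulr_ge0; [apply: mulr_ge0|]; lra.
rewrite ler_pM2r //.
have cs : 1 - cos c <= sin c ^+ 2.
  rewrite sin2cos2; have : 0 <= cos c * (1 - cos c) by apply: mulr_ge0; lra.
  by lra.
apply: (@le_trans _ _ (speed e c * sin c ^+ 2)); first by rewrite ler_pM2l.
have -> : speed e c * sin c ^+ 2 =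
    amp e / e ^+ 2 * ((e * sin c) ^+ 2 * dens (e * sin c)).
  by rewrite /speed; field; rewrite gt_eqF.
rewrite [amp e * K / _]mulrAC ler_pM2l ?yK // divr_gt0 ?exprn_gt0 //.
Qed.

(** For e = 0 the speed is constant. Since P' 0 is known through its square, the comparison is made
    between squares; it ends with the equation of lam0 in the form N (lam0 - H) lam0 = 1 +
    lam0^2. *)
Lemma per_0 : per 0 = pi *+ 2 / Num.sqrt ((N - 1) * lam0 ^+ 2 + 1).
Proof.
have pi0 : 0 <= pi *+ 2 :> R by rewrite mulrn_wge0 // pi_ge0.
have [c _] := mean_value _ _ _ _ (is_derive_prim 0) pi0.
rewrite prim0 !subr0 /speed mul0r => cE.
rewrite /per cE mulrC; congr (_ * _).
have l0 := lam0_gt0; have n1 := N1; have g0p := g0_gt0.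
have sq0 : 0 < (N - 1) * lam0 ^+ 2 + 1.
  have h : 0 <= (N - 1) * lam0 ^+ 2 by apply: mulr_ge0; [lra|exact: sqr_ge0].
  by lra.
have x0 : 0 < amp 0 * dens 0 by rewrite mulr_gt0 ?dens_gt0.
rewrite -[LHS]gtr0_norm // -sqrtr_sqr -sqrtrV; last exact: ltW.
congr Num.sqrt; rewrite exprMn amp2E expr0n addr0.
have lE : lp 0 = lam0 by rewrite /lp P_0 g0E.
have gn : (g0 ^+ n)^-1 = lam0 - H by rewrite -g0E /lamg addrC addKr.
have gn0 : g0 ^+ n != 0 by rewrite expf_neq0 // gt_eqF.
have gnE : g0 ^+ n = (lam0 - H)^-1 by rewrite -gn invrK.
have lH := lam0_gtH.
have stE : stiffness g0 = 2 * N * ((N - 1) * lam0 + lam0^-1) / g0 ^+ n.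
  rewrite /stiffness g0E.
  have -> : \sum_(i < n) g0 ^+ (n.-1 - i) * g0 ^+ i = N * g0 ^+ n.-1.
    rewrite (eq_bigr (fun=> g0 ^+ n.-1)) => [|i _].
      by rewrite sumr_const card_ord mulr_natl.
    by rewrite -exprD subnK // -ltnS prednK // ltnW.
  have -> : g0 ^+ n = g0 * g0 ^+ n.-1.
    by rewrite -[in LHS](prednK (ltnW n_gt1)) exprS.
  by field; rewrite expf_neq0 ?gt_eqF.
rewrite /dens expr_div_n exprMn P'_0 stE lE P_0 /V0 /potential g0E.
have root : N * (lam0 - H) * lam0 = 1 + lam0 ^+ 2.
  by have := lam0_root; lra.
have Q0 : (N - 1) * lam0 ^+ 2 + 1 != 0 by rewrite gt_eqF.
have lsq : 1 + lam0 ^+ 2 != 0 by rewrite gt_eqF // ltr_pwDl ?sqr_ge0.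
transitivity (N * (g0 ^+ n)^-1 * lam0 / (1 + lam0 ^+ 2) / ((N - 1) * lam0 ^+ 2 + 1)).
  by field; rewrite lsq gn0 Q0 N_neq0 !gt_eqF.
by rewrite gn root divff // mul1r.
Qed.

(** The speed depends on x only through u = sin x, which stays in the compact [-1, 1]; so it varies
    uniformly little with e, and the mean value theorem over one turn carries this over to the
    period. *)
Lemma per_cont : continuous per.
Proof.
move=> e0; apply/cvgrPdist_le => eps eps0.
have pi2 : 0 < pi *+ 2 :> R by rewrite mulrn_wgt0 // pi_gt0.
pose eps' := eps / (pi *+ 2).
have e'0 : 0 < eps' / 2 by rewrite !divr_gt0.
pose G (q : R * R) := amp q.2 * dens (q.2 * q.1).
have cG (q : R * R) : {for q, continuous G}.
  have c1 : {for q, continuous (@fst R R)} by exact: cvg_fst.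
  have c2 : {for q, continuous (@snd R R)} by exact: cvg_snd.
  apply: cont_mul.
    apply: (cont_comp (@Num.sqrt R)); first exact: sqrt_continuous.
    apply: cont_add; first exact: cont_cst.
    exact: (cont_mul _ _ _ c2 c2).
  apply: (cont_comp dens); first exact: dens_cont.
  exact: cont_mul.
have /compact_near_coveringP cov : compact `[(- 1 : R), 1]%classic.
  exact: segment_compact.
have near1 : \forall e \near e0,
    `[(- 1 : R), 1]%classic `<=` [set u | `|G (u, e0) - G (u, e)| <= eps'].
  apply: (cov R (nbhs e0) (fun e u => `|G (u, e0) - G (u, e)| <= eps') _) => u _.
  have h : \forall q \near (u, e0), `|G (u, e0) - G q| <= eps' / 2.
    by move/cvgrPdist_le : (cG (u, e0)); exact.
  have h0 : \forall v \near u, `|G (u, e0) - G (v, e0)| <= eps' / 2.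
    have cu : {for u, continuous (fun v => G (v, e0))}.
      apply: (@continuous_comp _ _ _ (fun v : R => (v, e0)) G); last exact: cG.
      have i1 : {for u, continuous (@id R)} by exact: cvg_id.
      have i2 : {for u, continuous (fun _ : R => e0)} by exact: cvg_cst.
      exact: (cvg_pair i1 i2).
    by move/cvgrPdist_le : cu; exact.
  case: h => -[A B] /= [Au Be] AB.
  exists (A `&` [set v | `|G (u, e0) - G (v, e0)| <= eps' / 2], B) => /=.
    by split => //; exact: filterI.
  move=> [v e] /= [[Av hv] Bve].
  have := AB (v, e) (conj Av Bve) => /= he.
  have -> : G (v, e0) - G (v, e) = (G (u, e0) - G (v, e)) - (G (u, e0) - G (v, e0)) by ring.
  by apply: (le_trans (ler_normB _ _)); lra.
near=> e.
have D (x : R) : is_derive x 1 (fun x => prim e0 x - prim e x) (speed e0 x - speed e x).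
  exact: (is_derive_sub _ _ _ _ _ _ (is_derive_prim e0 x) (is_derive_prim e x)).
have [c _] := mean_value _ _ _ _ D (ltW pi2).
rewrite !prim0 !subr0 -/(per e0) -/(per e) => ->.
rewrite normrM [`|pi *+ 2|]gtr0_norm // -ler_pdivlMr //.
have sub : `[(- 1 : R), 1]%classic `<=` [set u | `|G (u, e0) - G (u, e)| <= eps'].
  by near: e.
by apply: (sub (sin c)); rewrite /= in_itv /= sin_geN1 sin_le1.
Unshelve. all: by end_near. Qed.

(** * The period for large amplitudes *)

Lemma tilt_bounds y : atan H < tilt y < pi / 2.
Proof. by rewrite atan_ltpi2 andbT; apply: lt_atan; exact: lamg_gtH. Qed.

Lemma tilt_decr y z : y <= z -> tilt z <= tilt y.
Proof.
rewrite le_eqVlt => /predU1P[->|yz]; first exact: lexx.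
by rewrite ltW //; apply: lt_atan; exact: lp_decr.
Qed.

Lemma amp_bounds e : 0 < e -> e <= amp e <= e + V0 / e.
Proof.
move=> e0; have v0 := V0_gt0; have q0 : 0 < V0 / e by rewrite divr_gt0.
have a0 := amp_gt0 e; have a2 := amp2E e.
apply/andP; split; rewrite -ler_sqr ?nnegrE ?(ltW a0) ?(ltW e0) //; try lra.
rewrite a2; have -> : (e + V0 / e) ^+ 2 = V0 + e ^+ 2 + V0 + (V0 / e) ^+ 2.
  by field; rewrite gt_eqF.
by have := sqr_ge0 (V0 / e); lra.
Qed.

(** The total variation of [tilt], hence half the limit of the period. *)
Let L : R := pi / 2 - atan H.
Let L_gt0 : 0 < L. Proof. by rewrite subr_gt0 atan_ltpi2. Qed.

Lemma per_lt (tau : R) : 2 * L < tau -> exists2 e, 0 < e & per e < tau.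
Proof.
move=> Ltau; have [K K0 yK] := dens_bound; have v0 := V0_gt0; have l0 := L_gt0.
have pi0 := pi_gt0 R.
(* With amp e / e <= 1 + V0 / e and e >= 1, the upper estimate of per e / 2 is L + A / e; the choice
   of e makes A / e < d. *)
pose A := V0 * L + (1 + V0) * K * pi.
pose d := tau / 2 - L; have d0 : 0 < d by rewrite /d; lra.
have A0 : 0 < A.
  have v1 : 0 < 1 + V0 by lra.
  by rewrite /A addr_gt0 // mulr_gt0 // mulr_gt0.
have q0 : 0 < A / d by rewrite divr_gt0.
pose e := 1 + A / d; have e0 : 0 < e by rewrite /e; lra.
have e1 : 1 <= e by rewrite /e; lra.
exists e => //.
have /andP[_ up] := per_estimate K e e0 yK.
have /andP[am1 am2] := amp_bounds e e0.
have ie : 0 < e^-1 by rewrite invr_gt0.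
have ie1 : e^-1 <= 1 by rewrite invf_le1.
have ae : amp e / e <= 1 + V0 / e.
  rewrite ler_pdivrMr // (le_trans am2) //.
  have -> : (1 + V0 / e) * e = e + V0 by field; rewrite gt_eqF.
  by rewrite lerD2l ger_pMr.
have ae0 : 0 < amp e / e by rewrite divr_gt0.
have Ve : V0 / e <= V0 by rewrite ger_pMr.
have t1 : amp e / e * (tilt (- e) - tilt e) <= (1 + V0 / e) * L.
  have /andP[b1 b2] := tilt_bounds (- e); have /andP[b3 b4] := tilt_bounds e.
  have tl : tilt (- e) - tilt e <= L by rewrite /L; lra.
  have tp : 0 <= tilt (- e) - tilt e.
    by rewrite subr_ge0; apply: tilt_decr; lra.
  by apply: ler_pM => //; exact: ltW.
have t2 : amp e * K / e ^+ 2 * pi <= (1 + V0) * K * pi / e.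
  have -> : amp e * K / e ^+ 2 * pi = (amp e / e) * (K * pi / e).
    by field; rewrite gt_eqF.
  have -> : (1 + V0) * K * pi / e = (1 + V0) * (K * pi / e) by field; rewrite gt_eqF.
  by rewrite ler_pM2r ?divr_gt0 ?mulr_gt0 //; lra.
have AE : (1 + V0 / e) * L + (1 + V0) * K * pi / e = L + A / e.
  by rewrite /A; field; rewrite gt_eqF.
have Ad : A / e < d.
  rewrite ltr_pdivrMr //; have -> : d * e = d + A by rewrite /e; field; rewrite gt_eqF.
  by lra.
by have : per e / 2 < L + d; [lra | rewrite /d; lra].
Qed.

Lemma per_gt (tau : R) : 0 < tau -> tau < 2 * L -> exists2 e, 0 < e & tau < per e.
Proof.
move=> tau0 tauL; have [K K0 yK] := dens_bound; have l0 := L_gt0.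
(* Once [tilt y1] and [tilt y2] are within eps of its two limits, their difference exceeds L - 2 eps
   = tau / 2. *)
pose eps := (L - tau / 2) / 2; have eps0 : 0 < eps by rewrite /eps; lra.
have aH : 0 < atan H by rewrite -atan0; apply: lt_atan.
have pi0 := pi_gt0 R.
have epsL : eps < pi / 2 by rewrite /eps /L; lra.
have [y1 y1E] : exists y, pi / 2 - eps < tilt y.
  pose z := pi / 2 - eps; pose M := `|tan z| + 1.
  have M0 : 0 < M by rewrite /M ltr_wpDl.
  have [g [g1 gE]] : exists g, 0 < g /\ g ^+ n = M^-1.
    by apply: root_exists; rewrite invr_gt0.
  have [y yE] := P_surj g g1; exists y.
  have zE : atan (tan z) = z.
    by apply: tanK; rewrite in_itv /= /z; apply/andP; split; have := pi_gt0 R; lra.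
  rewrite -/z -zE; apply: lt_atan; rewrite /lp yE /lamg gE invrK.
  by rewrite (le_lt_trans (ler_norm (tan z))) // /M addrCA ltrDl addr_gt0.
have [y2 y2E] : exists y, tilt y < atan H + eps.
  have ca : {for H, continuous (@atan R)} by exact: continuous_atan.
  move/cvgrPdist_lt : ca => /(_ eps eps0).
  move=> /nbhs_ballP[d /= d0 dA]; pose z := d / 2.
  have z0 : 0 < z by rewrite /z; lra.
  have [g [g1 gE]] : exists g, 0 < g /\ g ^+ n = z^-1.
    by apply: root_exists; rewrite invr_gt0.
  have [y yE] := P_surj g g1; exists y.
  rewrite /tilt /lp yE /lamg gE invrK.
  have : ball H d (H + z).
    by rewrite /ball /= opprD addrA subrr add0r normrN gtr0_norm // /z; lra.
  by move=> /dA /=; have := ler_norm (- (atan H - atan (H + z))); rewrite normrN; lra.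
pose e := `|y1| + `|y2| + 1.
have n1 := normr_ge0 y1; have n2 := normr_ge0 y2.
have e0 : 0 < e by rewrite /e; lra.
exists e => //.
have /andP[lowb _] := per_estimate K e e0 yK.
have h1 : tilt y1 <= tilt (- e).
  apply: tilt_decr; have := ler_norm (- y1); rewrite normrN /e; lra.
have h2 : tilt e <= tilt y2.
  by apply: tilt_decr; have := ler_norm y2; rewrite /e; lra.
have /andP[am1 _] := amp_bounds e e0.
have ae : 1 <= amp e / e by rewrite ler_pdivlMr // mul1r.
have df : tau / 2 < tilt (- e) - tilt e by move: y1E y2E; rewrite /eps /L; lra.
have df0 : 0 <= tilt (- e) - tilt e by lra.
have := ler_wpM2r df0 ae; rewrite mul1r; lra.
Qed.

Lemma per_value (tau : R) : 0 < tau ->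
  per 0 < tau < 2 * L \/ 2 * L < tau < per 0 -> exists2 e, 0 < e & per e = tau.
Proof.
move=> tau0 cases.
have perw a b : {within `[a, b], continuous per}.
  by apply: continuous_subspaceT => x; exact: per_cont.
have [e e0 et] : exists2 e, 0 < e &
    Num.min (per 0) (per e) <= tau <= Num.max (per 0) (per e).
  case: cases => /andP[h1 h2].
    have [e e0 he] := per_gt tau tau0 h2; exists e => //.
    by rewrite min_l ?max_r ?(ltW h1) ?(ltW he) // ltW // (lt_trans h1).
  have [e e0 he] := per_lt tau h1; exists e => //.
  by rewrite min_r ?max_l ?(ltW h2) ?(ltW he) // ltW // (lt_trans he).
have [c /[!in_itv] /= /andP[c0 _] cE] := IVT (ltW e0) (perw 0 e) et.
exists c => //; rewrite lt_neqAle c0 andbT; apply/eqP => c00.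
by move: cases; rewrite c00 cE !ltxx andbF; case.
Qed.

End Chart.

End Oscillator.

(** The positive derivative gives injectivity; the shift, repeated, makes th unbounded in both
    directions. The inverse inherits the shift with a and b exchanged. *)
Lemma inverse_shift {R : realType} (th dth : R -> R) (a b : R) :
  (forall x : R, is_derive x 1 th (dth x)) -> (forall x, 0 < dth x) ->
  0 < b -> (forall x, th (x + a) = th x + b) ->
  exists F : R -> R, [/\ forall u, th (F u) = u,
    forall u : R, is_derive u 1 F (dth (F u))^-1,
    forall x, F (th x) = x & forall u, F (u + b) = F u + a].
Proof.
move=> dT T0 b0 Ta.
have inc x y : x < y -> th x < th y.
  move=> xy; have [c _ cE] := mean_value th dth x y dT (ltW xy).
  by rewrite -subr_gt0 cE mulr_gt0 ?subr_gt0.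
have inj x y : th x = th y -> x = y.
  by move=> xy; case: (ltgtP x y) => [/inc|/inc|//]; rewrite xy ltxx.
have shift (k : nat) x : th (x + a *+ k) = th x + b *+ k.
  elim: k => [|k IHk]; first by rewrite !mulr0n !addr0.
  by rewrite !mulrSr !addrA Ta IHk.
have surj u : exists x, th x = u.
  pose k := Num.bound (`|u - th 0| / b).
  have kb : `|u - th 0| < b *+ k.
    have := archi_boundP (divr_ge0 (normr_ge0 (u - th 0)) (ltW b0)).
    by rewrite ltr_pdivrMr // -/k mulr_natl.
  have hi : u <= th (a *+ k).
    by have := shift k 0; rewrite add0r => ->; have := ler_norm (u - th 0); lra.
  have lo : th (- (a *+ k)) <= u.
    have := shift k (- (a *+ k)); rewrite addNr => e.
    by have := ler_norm (- (u - th 0)); rewrite normrN; lra.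
  have le : - (a *+ k) <= a *+ k.
    by rewrite leNgt; apply/negP => /inc; lra.
  have Tc : {within `[- (a *+ k), a *+ k], continuous th}.
    by apply: continuous_subspaceT => x; exact: is_derive_cont (dT x).
  have [|x _ xE] := IVT le Tc (_ : Num.min _ _ <= u <= Num.max _ _).
    by rewrite min_l ?max_r ?lo ?hi //; lra.
  by exists x.
have [F FE] := choice surj.
have FK x : F (th x) = x by apply: inj.
exists F; split => // u; last by apply: inj; rewrite Ta !FE.
rewrite -[in X in is_derive X _ _ _](FE u); apply: (@is_derive_inverse R th F).
- by near=> x; exact: FK.
- by near=> x; exact: is_derive_cont (dT x).
- by rewrite gt_eqF.
Unshelve. all: by end_near. Qed.

(** * The profile of an orbit of period 2 pi / m *)

Section ProfileConstruction.
Context {R : realType} (n m : nat) (H A e : R) (P P' T : R -> R).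
Hypotheses (n_gt1 : (1 < n)%N) (m_gt1 : (1 < m)%N) (H_gt0 : 0 < H).
Hypotheses (A_gt0 : 0 < A) (e_gt0 : 0 < e).

Let N : R := n%:R.
Let lp y : R := lamg n H (P y).
Let b x : R := A * dens n H P P' (e * sin x).

Hypothesis P_gt0 : forall y, 0 < P y.
Hypothesis P'_gt0 : forall y, 0 < P' y.
Hypothesis dP : forall y : R, is_derive y 1 P (P' y).
Hypothesis energy : forall y, potential n H (P y) = A ^+ 2 - e ^+ 2 + y ^+ 2.
(** Half the derivative of [energy], written without the critical point. *)
Hypothesis force : forall y,
  y = - (P y * P' y * (N * lp y * (lp y - H) - 1 - lp y ^+ 2)).
Hypothesis lp_decr : forall y z, y < z -> lp z < lp y.
Hypothesis dlp : forall y : R, is_derive y 1 lp (- (N * P' y / (P y * P y ^+ n))).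
Hypothesis dT : forall x : R, is_derive x 1 T (b x).
Hypothesis T_shift : forall x, T (x + pi *+ 2) = T x + pi *+ 2 / m%:R.

Let yf (x : R) : R := e * sin x.
Let lam x : R := lp (yf x).
Let w x : R := P (yf x) ^+ n.
(** Conservation with constant A^2 reads 1 - sg^2 = V / A^2 = 1 - (e^2 - y^2) / A^2; the sign is
    negative because [lam] decreases when y increases. Likewise r^2 s^2 = V / A^2 gives the radius P
    / A. *)
Let sg x : R := - (e / A) * cos x.
Let s x : R := Num.sqrt (1 + lam x ^+ 2).
Let r x : R := P (yf x) / A.
Let q x : R := Num.sqrt (lam x ^+ 2 + sg x ^+ 2).
(** As z = e^{iT} (lam + i sg) / s with lam > 0, this is the polar angle of z in terms of the
    phase. *)
Let th x : R := T x + atan (sg x / lam x).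

Let N_neq0 : N != 0. Proof. by rewrite pnatr_eq0 -lt0n ltnW. Qed.
Let A_neq0 : A != 0. Proof. by rewrite gt_eqF. Qed.
Let lam_gt0 x : 0 < lam x. Proof. by apply: lamg_gt0. Qed.
Let lam_neq0 x : lam x != 0. Proof. by rewrite gt_eqF. Qed.
Let P_neq0 y : P y != 0. Proof. by rewrite gt_eqF. Qed.
Let Pn_neq0 y : P y ^+ n != 0. Proof. by rewrite expf_neq0. Qed.
Let l2_gt0 y : 0 < 1 + lp y ^+ 2. Proof. by rewrite ltr_pwDl ?sqr_ge0. Qed.
Let l2_neq0 y : 1 + lp y ^+ 2 != 0. Proof. by rewrite gt_eqF. Qed.
Let s2E x : s x ^+ 2 = 1 + lam x ^+ 2. Proof. by rewrite sqr_sqrtr // ltW ?l2_gt0. Qed.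
Let s_gt0 x : 0 < s x. Proof. by rewrite sqrtr_gt0; exact: l2_gt0. Qed.
Let s_neq0 x : s x != 0. Proof. by rewrite gt_eqF. Qed.
Let r_gt0 x : 0 < r x. Proof. by rewrite divr_gt0. Qed.
Let r_neq0 x : r x != 0. Proof. by rewrite gt_eqF. Qed.

Let r2s2 x : r x ^+ 2 * s x ^+ 2 = 1 - sg x ^+ 2.
Proof.
rewrite s2E /r /sg expr_div_n -mulrA [_^-1 * _]mulrC mulrA.
have -> : P (yf x) ^+ 2 * (1 + lam x ^+ 2) = A ^+ 2 - e ^+ 2 + yf x ^+ 2.
  by rewrite -energy.
rewrite /yf; have := cos2Dsin2 x => c2.
have -> : (e * sin x) ^+ 2 = e ^+ 2 * (1 - cos x ^+ 2) by rewrite -c2; ring.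
by field.
Qed.

Let q2_gt0 x : 0 < lam x ^+ 2 + sg x ^+ 2.
Proof. by rewrite ltr_pwDl ?sqr_ge0 ?exprn_gt0. Qed.

Let q2E x : lam x ^+ 2 + sg x ^+ 2 = s x ^+ 2 * (1 - r x ^+ 2).
Proof. by have := r2s2 x; rewrite mulrBr mulr1 [s x ^+ 2 * _]mulrC => ->; rewrite s2E; ring. Qed.

Let r2_lt1 x : r x ^+ 2 < 1.
Proof.
rewrite -subr_gt0; have := q2_gt0 x; rewrite q2E pmulr_rgt0 //.
by rewrite exprn_gt0.
Qed.
Let rho_neq0 x : 1 - r x ^+ 2 != 0. Proof. by rewrite gt_eqF // subr_gt0. Qed.

Let qE x : q x = s x * Num.sqrt (1 - r x ^+ 2).
Proof. by rewrite /q q2E sqrtrM ?sqr_ge0 // sqrtr_sqr gtr0_norm. Qed.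

Let dy (x : R) : is_derive x 1 yf (e * cos x).
Proof. exact: (is_derive_cmul _ e _ _ _ (is_derive_sin x)). Qed.

Let bE x : b x = A * (N * P' (yf x) / (P (yf x) * P (yf x) ^+ n * s x ^+ 2)).
Proof. by rewrite s2E. Qed.

Let dlam (x : R) : is_derive x 1 lam (s x ^+ 2 * sg x * b x).
Proof.
apply: (is_derive_eq (is_derive_comp1 lp yf x 1 _ _ (dlp (yf x)) (dy x))).
by rewrite bE /sg; field; rewrite A_neq0 s_neq0 P_neq0 Pn_neq0.
Qed.

Let wE x : lam x = H + (w x)^-1. Proof. by []. Qed.

Let dw (x : R) : is_derive x 1 w (- (w x ^+ 2 * s x ^+ 2 * sg x * b x)).
Proof.
have -> : w = (fun x => (lam x - H)^-1).
  by apply/funext => z; rewrite wE addrC addKr invrK.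
have d := is_derive_sub _ _ _ _ _ _ (dlam x) (is_derive_cst H x 1).
have l0 : lam x - H != 0 by rewrite wE addrC addKr invr_neq0 ?Pn_neq0.
apply: (is_derive_eq (is_derive_inv (fun x => lam x - H) x 1 _ l0 d)).
by rewrite /cst; field.
Qed.

Let dsg (x : R) : is_derive x 1 sg
  (- (r x ^+ 2 * s x ^+ 2 * (lam x - s x ^+ 2 * w x / N) * b x)).
Proof.
apply: (is_derive_eq (is_derive_cmul _ (- (e / A)) _ _ _ (is_derive_cos x))).
transitivity (yf x / A); first by rewrite /yf; field.
transitivity (- (P (yf x) * P' (yf x) * (N * lam x * (lam x - H) - 1 - lam x ^+ 2)) / A).
  by rewrite -force.
rewrite bE s2E /r /w.
have -> : H = lam x - (P (yf x) ^+ n)^-1 by rewrite wE addrK.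
by field; rewrite A_neq0 N_neq0 P_neq0 Pn_neq0 l2_neq0.
Qed.

Let ds (x : R) : is_derive x 1 s (s x * lam x * sg x * b x).
Proof.
have d := is_derive_add _ _ _ _ _ _ (is_derive_cst (1 : R) x 1)
  (is_derive_mul _ _ _ _ _ _ (dlam x) (dlam x)).
apply: (is_derive_eq (is_derive_comp1 (@Num.sqrt R) (fun x => 1 + lam x ^+ 2) x 1 _ _
  (is_derive1_sqrt (l2_gt0 (yf x))) d)).
rewrite -/(lam x) -/(s x).
have -> : s x ^+ 2 * sg x * b x * lam x = s x * (s x * lam x * sg x * b x) by ring.
by field.
Qed.

Let dr (x : R) : is_derive x 1 r (- (r x * s x ^+ 2 * sg x * w x / N * b x)).
Proof.
apply: (is_derive_eq (is_derive_mulc _ A^-1 _ _ _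
  (is_derive_comp1 P yf x 1 _ _ (dP (yf x)) (dy x)))).
by rewrite bE /r /sg /w; field; rewrite A_neq0 N_neq0 s_neq0 P_neq0 Pn_neq0.
Qed.

(** The normal angle advances at rate [b] in the phase and at rate [turn] in the polar angle. Both
    rates are positive, which makes the polar angle an admissible parameter. *)
Let dth (x : R) : is_derive x 1 th (b x / turn n lam w s r x).
Proof.
have d1 := is_derive_mul _ _ _ _ _ _ (dsg x) (is_derive_inv _ _ _ _ (lam_neq0 x) (dlam x)).
have d2 := is_derive_comp1 (@atan R) _ x 1 _ _ (is_derive1_atan _) d1.
apply: (is_derive_eq (is_derive_add _ _ _ _ _ _ (dT x) d2)).
have sg2 : sg x ^+ 2 = 1 - r x ^+ 2 * (1 + lam x ^+ 2) by rewrite -s2E r2s2; ring.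
have w0 : w x != 0 by exact: Pn_neq0.
have q0 : lam x ^+ 2 + sg x ^+ 2 != 0 by rewrite gt_eqF.
pose k := r x ^+ 2 * (1 + lam x ^+ 2) * (lam x - (1 + lam x ^+ 2) * w x / N) * lam x.
transitivity (b x + b x * (- k - (1 + lam x ^+ 2) * sg x ^+ 2) /
    (lam x ^+ 2 + sg x ^+ 2)).
  by rewrite /k -s2E; field; rewrite q0 lam_neq0 N_neq0.
rewrite q2E sg2 /turn /k s2E.
by field; rewrite rho_neq0 l2_neq0 N_neq0 lam_neq0 r_neq0 w0.
Qed.

Let b_gt0 x : 0 < b x.
Proof.
rewrite bE mulr_gt0 // divr_gt0 ?mulr_gt0 ?exprn_gt0 //.
by rewrite ltr0n ltnW.
Qed.

Let turn_gt0 x : 0 < turn n lam w s r x.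
Proof.
have w0 : 0 < w x by rewrite exprn_gt0.
have n0 : 0 < n%:R :> R by rewrite ltr0n ltnW.
have rho : 0 < 1 - r x ^+ 2 by rewrite subr_gt0.
rewrite /turn divr_gt0 //; first exact: mulr_gt0.
by do 3?apply: mulr_gt0 => //; exact: exprn_gt0.
Qed.

Let fD2pi (f : R -> R) x : f (e * sin (x + pi *+ 2)) = f (e * sin x).
Proof. by rewrite sinD2pi. Qed.

Lemma profile_exists :
  exists t lam w sg s r : R -> R, is_profile n m H t lam w sg s r.
Proof.
have pi2 : 0 < pi *+ 2 :> R by rewrite mulrn_wgt0 // pi_gt0.
have step_gt0 : 0 < pi *+ 2 / m%:R :> R by rewrite divr_gt0 // ltr0n ltnW.
have lam_shift x : lam (x + pi *+ 2) = lam x by exact: (fD2pi lp).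
have sg_shift x : sg (x + pi *+ 2) = sg x by rewrite /sg cosD2pi.
have th_shift x : th (x + pi *+ 2) = th x + pi *+ 2 / m%:R.
  by rewrite /th T_shift lam_shift sg_shift addrAC.
have dth_gt0 x : 0 < b x / turn n lam w s r x by rewrite divr_gt0.
(* F is the phase in terms of the polar angle. Its derivative is turn / b, so the factor [b] of each
   derivative in the phase turns into the factor [turn] of [is_profile]. *)
have [F [FE dF FK Fs]] :=
  inverse_shift th _ (pi *+ 2) (pi *+ 2 / m%:R) dth dth_gt0 step_gt0 th_shift.
have comp (f X : R -> R) : (forall x : R, is_derive x 1 f (X x * b x)) ->
    forall u : R, is_derive u 1 (fun u => f (F u)) (X (F u) * turn n lam w s r (F u)).
  move=> df u; apply: (is_derive_eq (is_derive_comp1 f F u 1 _ _ (df (F u)) (dF u))).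
  by rewrite invf_div; field; rewrite gt_eqF.
have compN (f X : R -> R) : (forall x : R, is_derive x 1 f (- (X x * b x))) ->
    forall u : R, is_derive u 1 (fun u => f (F u)) (- (X (F u) * turn n lam w s r (F u))).
  move=> df u; rewrite -mulNr; apply: (comp f (fun x => - X x)) => x.
  by rewrite mulNr.
have compT (u : R) : is_derive u 1 (fun u => T (F u)) (turn n lam w s r (F u)).
  rewrite -[turn _ _ _ _ _ _]mul1r; apply: (comp T (fun=> 1)) => x.
  by rewrite mul1r.
have polar x : lam x = q x * cos (atan (sg x / lam x)) /\
    sg x = q x * sin (atan (sg x / lam x)).
  have q_gt0 : 0 < q x by rewrite sqrtr_gt0.
  have -> : q x = lam x * Num.sqrt (1 + (sg x / lam x) ^+ 2).
    rewrite /q -[X in X * Num.sqrt _](gtr0_norm (lam_gt0 x)) -sqrtr_sqr -sqrtrM ?sqr_ge0 //.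
    by congr Num.sqrt; field.
  have z0 : Num.sqrt (1 + (sg x / lam x) ^+ 2) != 0.
    by rewrite gt_eqF // sqrtr_gt0 ltr_pwDl ?sqr_ge0.
  by rewrite cos_atan sin_atan; split; field; rewrite ?z0 ?lam_neq0.
exists (fun u => T (F u)), (fun u => lam (F u)), (fun u => w (F u)),
  (fun u => sg (F u)), (fun u => s (F u)), (fun u => r (F u)).
split.
- by move=> u; exact: lam_gt0.
- by move=> u; exact: exprn_gt0.
- by move=> u; exact: s_gt0.
- by move=> u; exact: r_gt0.
- by move=> u; exact: r2_lt1.
- by move=> u; exact: wE.
- by move=> u; exact: s2E.
- by move=> u; exact: r2s2.
- exact: compT.
- exact: (comp lam (fun x => s x ^+ 2 * sg x) dlam).
- exact: (compN w (fun x => w x ^+ 2 * s x ^+ 2 * sg x) dw).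
- exact: (compN sg (fun x => r x ^+ 2 * s x ^+ 2 * (lam x - s x ^+ 2 * w x / N)) dsg).
- exact: (comp s (fun x => s x * lam x * sg x) ds).
- exact: (compN r (fun x => r x * s x ^+ 2 * sg x * w x / N) dr).
- by move=> u; rewrite Fs T_shift.
- by move=> u; rewrite Fs lam_shift.
- by move=> u; rewrite Fs; exact: (fD2pi (fun y => P y ^+ n)).
- by move=> u; rewrite Fs sg_shift.
- by move=> u; rewrite Fs /s lam_shift.
- by move=> u; rewrite Fs; exact: (fD2pi (fun y => P y / A)).
- move=> u; have [la si] := polar (F u).
  rewrite -qE -[in cos u](FE u) /th cosD [RHS]mulrBr.
  by rewrite [X in _ = X - _]mulrCA -la [X in _ = _ - X]mulrCA -si.
- move=> u; have [la si] := polar (F u).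
  rewrite -qE -[in sin u](FE u) /th sinD [RHS]mulrDr.
  by rewrite [X in _ = X + _]mulrCA -la [X in _ = _ + X]mulrCA -si.
(* The turning points y = e and y = - e of the orbit. *)
exists (th (pi / 2)), (th (- (pi / 2))).
rewrite !FK /lam /yf sinN sin_pihalf mulr1 mulrN1 lt_eqF //.
by apply: lp_decr; rewrite gtrN.
Qed.

End ProfileConstruction.

Lemma oscillator_profile {R : realType} (n m : nat) (H : R)
    (p0 := pi *+ 2 / Num.sqrt ((n%:R - 1) * lam0 n H ^+ 2 + 1) : R)
    (p1 := 2 * (pi / 2 - atan H)) (tau := pi *+ 2 / m%:R : R) :
  (1 < n)%N -> (1 < m)%N -> 0 < H -> p0 < tau < p1 \/ p1 < tau < p0 ->
  exists t lam w sg s r : R -> R, is_profile n m H t lam w sg s r.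
Proof.
move=> n1 m1 H0 cases.
have g00 := g0_gt0 n H n1 H0.
have [P [P' [[P0 PE dP cP' P'0] [P00 P'00 surj]]]] :=
  morse_chart (potential n H) (stiffness n H n1 H0) (g0 n H n1 H0) g00
    (is_derive_potential n H n1 H0) (fun g => stiffness_cont n H n1 H0 g)
    (stiffness_gt0 n H n1 H0) (potential_lo n H n1 H0) (potential_hi n H n1 H0).
have tau0 : 0 < tau by rewrite divr_gt0 // mulrn_wgt0 ?ltr01 ?pi_gt0 // ltnW.
move: cases; rewrite /p0 -(per_0 n H n1 H0 P P' P0 dP cP' P'0 P00 P'00) => cases.
have [e e0 eE] := per_value n H n1 H0 P P' P0 PE dP cP' P'0 P00 surj tau tau0 cases.
have V0 : 0 < potential n H (g0 n H n1 H0).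
  by rewrite /potential mulr_gt0 ?exprn_gt0 // ltr_pwDl ?sqr_ge0.
have A2 : amp n H n1 H0 e ^+ 2 = potential n H (g0 n H n1 H0) + e ^+ 2.
  by rewrite sqr_sqrtr // addr_ge0 ?sqr_ge0 // ltW.
apply: (profile_exists n m H (amp n H n1 H0 e) e P P' (prim n H n1 H0 P P' P0 dP cP' e)
  n1 m1 H0 _ e0 P0 P'0 dP _ _ (lp_decr n H n1 P P' P0 dP P'0)
  (is_derive_lp n H n1 P P' P0 dP) (is_derive_prim n H n1 H0 P P' P0 dP cP' e)).
- by rewrite sqrtr_gt0 ltr_pwDl ?sqr_ge0.
- by move=> y; rewrite PE A2 addrK.
- move=> y; have q := quadratic_factor n H n1 H0 (lamg n H (P y)).
  rewrite {1}(chart_speed n H n1 H0 P P' P0 PE dP y) -mulrA [_ * P' y]mulrC.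
  transitivity (- (P y * P' y * ((lamg n H (P y) - lam0 n H) *
    ((n%:R - 1) * lamg n H (P y) + (lam0 n H)^-1)))); first by ring.
  by rewrite -q; ring.
- by move=> x; rewrite prim_shift eE.
Qed.

(** * Comparison of the limit periods with the bounds on H *)

Lemma atan_cotan {R : realType} (x : R) : 0 < x < pi -> atan (cotan x) = pi / 2 - x.
Proof.
move=> /andP[x0 xpi].
have -> : cotan x = tan (pi / 2 - x).
  rewrite /cotan /tan sinB cosB sin_pihalf cos_pihalf.
  by rewrite !mul0r mul1r subr0 add0r mul1r.
by rewrite tanK // in_itv /=; apply/andP; split; lra.
Qed.

(** Put a = sqrt (n - 1) and d = sqrt (m^2 - 1). Equality of [p0] and [tau] means (n - 1) lam0^2 + 1
    = m^2, that is lam0 = d / a. At d / a the quadratic with root lam0 takes the value m^2 - 2 - n H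
    d / a, so its factorisation turns the comparison of lam0 with d / a into that of H with B. *)
Lemma period_cmp {R : realType} (n m : nat) (H : R)
    (B := (m%:R ^+ 2 - 2) * Num.sqrt (n%:R - 1) / (n%:R * Num.sqrt (m%:R ^+ 2 - 1)))
    (p0 := pi *+ 2 / Num.sqrt ((n%:R - 1) * lam0 n H ^+ 2 + 1))
    (tau := pi *+ 2 / m%:R : R) :
  (1 < n)%N -> (1 < m)%N -> 0 < H ->
  (H < B -> tau < p0) /\ (B < H -> p0 < tau).
Proof.
move=> n1 m1 H0.
have N1 : 0 < n%:R - 1 :> R by rewrite subr_gt0 ltr1n.
have N0 : 0 < n%:R :> R by rewrite ltr0n ltnW.
have M2 : 2 <= m%:R :> R by rewrite -[2]/(2%:R) ler_nat.
have M1 : 0 < m%:R ^+ 2 - 1 :> R by rewrite expr2; nra.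
have M0 : 0 < m%:R :> R by lra.
rewrite /B /p0 /tau; set a := Num.sqrt (n%:R - 1); set d := Num.sqrt (m%:R ^+ 2 - 1).
have a0 : 0 < a by rewrite sqrtr_gt0.
have d0 : 0 < d by rewrite sqrtr_gt0.
have a2 : a ^+ 2 = n%:R - 1 by rewrite sqr_sqrtr // ltW.
have d2 : d ^+ 2 = m%:R ^+ 2 - 1 by rewrite sqr_sqrtr // ltW.
have l0 := lam0_gt0 n H n1 H0; set l := lam0 n H in l0 *.
have nd0 : 0 < n%:R * d by rewrite mulr_gt0.
have key : (m%:R ^+ 2 - 2) * a - H * (n%:R * d) = (d - a * l) * (a * d + l^-1).
  have := quadratic_factor n H n1 H0 (d / a); rewrite -/l -a2 => e.
  transitivity (a * (a ^+ 2 * (d / a) ^+ 2 - n%:R * H * (d / a) - 1)).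
    rewrite exprMn exprVn d2; field; rewrite gt_eqF //.
  by rewrite e; field; rewrite !gt_eqF.
have f0 : 0 < a * d + l^-1.
  by rewrite addr_gt0 ?mulr_gt0 ?invr_gt0.
have q0 : 0 < (n%:R - 1) * l ^+ 2 + 1.
  by rewrite addr_gt0 // mulr_gt0 // exprn_gt0.
have qE : (n%:R - 1) * l ^+ 2 + 1 - m%:R ^+ 2 = (a * l) ^+ 2 - d ^+ 2.
  by rewrite [(a * l) ^+ 2]exprMn a2 d2; ring.
have al0 : 0 < a * l by rewrite mulr_gt0.
have s2 : Num.sqrt (m%:R ^+ 2) = m%:R :> R by rewrite sqrtr_sqr gtr0_norm.
have pi2 : 0 < pi *+ 2 :> R by rewrite mulrn_wgt0 // pi_gt0.
split.
  rewrite ltr_pdivlMr // -subr_gt0 key pmulr_lgt0 // subr_gt0 => ald.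
  rewrite ltr_pM2l // ltf_pV2 ?posrE ?sqrtr_gt0 // -[ltRHS]s2 ltr_sqrt ?exprn_gt0 //.
  rewrite -subr_lt0 qE subr_lt0 ltrXn2r //; exact: ltW.
rewrite ltr_pdivrMr // -subr_lt0 key pmulr_llt0 // subr_lt0 => dal.
rewrite ltr_pM2l // ltf_pV2 ?posrE ?sqrtr_gt0 // -[ltLHS]s2 ltr_sqrt //.
rewrite -subr_gt0 qE subr_gt0 ltrXn2r //; exact: ltW.
Qed.

(** Neither bound is negative when m >= 2, so H > 0. Comparing 2 pi / m with the period at infinity
    amounts to comparing atan H with pi / 2 - pi / m, the arctangent of the cotangent bound. *)
Lemma profile_between {R : realType} (n m : nat) (H : R) : (1 < n)%N -> (1 < m)%N ->
  strictly_between H (cotan (pi / m%:R))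
    ((m%:R ^+ 2 - 2) * Num.sqrt (n%:R - 1) / (n%:R * Num.sqrt (m%:R ^+ 2 - 1))) ->
  exists t lam w sg s r : R -> R, is_profile n m H t lam w sg s r.
Proof.
move=> n1 m1; set c := cotan _; set B := _ / _.
have N1 : 0 < n%:R - 1 :> R by rewrite subr_gt0 ltr1n.
have N0 : 0 < n%:R :> R by rewrite ltr0n ltnW.
have M2 : 2 <= m%:R :> R by rewrite -[2]/(2%:R) ler_nat.
have M1 : 0 < m%:R ^+ 2 - 2 :> R by rewrite expr2; nra.
have pi0 := pi_gt0 R.
have x0 : 0 < pi / m%:R :> R by rewrite divr_gt0 //; lra.
have x1 : pi / m%:R <= pi / 2 :> R by rewrite ler_pM2l // lef_pV2 ?posrE //; lra.
have cE : atan c = pi / 2 - pi / m%:R by apply: atan_cotan; lra.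
have c0 : 0 <= c 
  by rewrite divr_ge0 ?cos_ge0_pihalf ?sin_ge0_pi //; lra.
have B0 : 0 < B.
  have d0 : 0 < m%:R ^+ 2 - 1 :> R by lra.
  by rewrite /B divr_gt0 ?mulr_gt0 ?sqrtr_gt0.
move=> /andP[lo hi].
have H0 : 0 < H.
  by apply: le_lt_trans lo; rewrite le_min c0 ltW.
have [up down] := period_cmp n m H n1 m1 H0.
apply: oscillator_profile => //.
have tau2 : pi *+ 2 / m%:R = 2 * (pi / m%:R) :> R by rewrite mulrA mulr_natl.
have [cB|Bc] := leP c B.
  move: lo hi; rewrite min_l // max_r // => lo hi.
  right; rewrite up // andbT tau2.
  have : atan c < atan H by exact: lt_atan.
  by rewrite cE; lra.
move: lo hi; rewrite min_r ?(ltW Bc) // max_l ?(ltW Bc) // => lo hi.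
left; rewrite down //= tau2.
have : atan H < atan c by exact: lt_atan.
by rewrite cE; lra.
Qed.

Theorem theorem5p3 (R : realType) (n : nat) (hn : (2 <= n)%N) :
  (forall H : R,
     0 < H < 2 * Num.sqrt (n%:R - 1) / (n%:R * Num.sqrt 3) ->
     exists M : set 'rV[R]_(n.+2),
       [/\ compact_embedded_hypersurface M, ~ isoparametric M
         & constant_mean_curvature M H]) /\
  (forall (m : nat) (H : R), (1 < m)%N ->
     strictly_between H (cotan (pi / m%:R))
       ((m%:R ^+ 2 - 2) * Num.sqrt (n%:R - 1) /
          (n%:R * Num.sqrt (m%:R ^+ 2 - 1))) ->
     exists M : set 'rV[R]_(n.+2),
       [/\ compact_embedded_hypersurface M, ~ isoparametric M,
           constant_mean_curvature M H & isometries_contain_OnZm m M]).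
Proof.
have main (m : nat) (H : R) : (1 < m)%N ->
     strictly_between H (cotan (pi / m%:R))
       ((m%:R ^+ 2 - 2) * Num.sqrt (n%:R - 1) /
          (n%:R * Num.sqrt (m%:R ^+ 2 - 1))) ->
     exists M : set 'rV[R]_(n.+2),
       [/\ compact_embedded_hypersurface M, ~ isoparametric M,
           constant_mean_curvature M H & isometries_contain_OnZm m M].
  move=> m1 /(profile_between _ _ _ hn m1)[t [lam [w [sg [s [r prof]]]]]].
  exists (surface n t lam sg s r); split.
  - exact: surface_compact_embedded hn m1 prof.
  - exact: surface_not_isoparametric hn m1 prof.
  - exact: surface_cmc hn m1 prof.
  - exact: surface_isometries hn m1 prof.
split=> // H /andP[H0 H1].
(* For m = 2 the bounds are cot (pi / 2) = 0 and 2 sqrt (n - 1) / (n sqrt 3). *)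
have [|M [M1 M2 M3 _]] := main 2%N H isT; last by exists M.
rewrite /strictly_between /cotan cos_pihalf mul0r.
have -> : 2 ^+ 2 - 2 = 2 :> R by ring.
have -> : 2 ^+ 2 - 1 = 3 :> R by ring.
have B0 := lt_trans H0 H1.
by rewrite min_l ?max_r ?(ltW B0) // H0.
Qed.
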